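(* Let $k\ge 0$ be an integer, let $\Gamma_k,\Gamma_k'$ be the graphs described in the context, and let $V=V_{11}\sqcup V_{12}\sqcup V_{21}\sqcup V_{22}$ be the associated set of vertices. There is one and only one fusion algebra $\mathcal{A}=\mathbb{Z}\mathcal{X}$ with basis $\mathcal{X}={}_N\mathcal{X}_N\sqcup{}_N\mathcal{X}_M\sqcup{}_M\mathcal{X}_N\sqcup{}_M\mathcal{X}_M$ that is compatible with the graphs $\Gamma_k,\Gamma'_k$, i.e. such that, as sets, ${}_N\mathcal{X}_N=V_{11}$, ${}_N\mathcal{X}_M=V_{12}$, ${}_M\mathcal{X}_N=V_{21}$, ${}_M\mathcal{X}_M=V_{22}$, and, for all $X,Y\in\mathcal{X}$ with suitable coefficients (so that the structure constants below are defined), $N_{X,\alpha_1}^{Y}$ (respectively $N_{X,\overline{\alpha}_1}^{Y}$) equals $1$ if $X$ and $Y$ are connected by an edge and $0$ otherwise, and $N_{X,1}^Y=\delta_{X,Y}$, where $1$ denotes the identity objects $1_N=\alpha_0\in{}_N\mathcal{X}_N$ and $1_M=\alpha_0'\in{}_M\mathcal{X}_M$.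
   Context: Graphs. Put $n=4k+3$. $\Gamma_k$ is the simple graph with vertices $\alpha_0,\dots,\alpha_n,\beta_1,\beta_2,\beta_3,\gamma_1,\gamma_2,\gamma_3$ and edges $\alpha_{i-1}\alpha_i$ ($1\le i\le n$), $\alpha_n\beta_1,\ \beta_1\beta_2,\ \beta_2\beta_3,\ \alpha_n\gamma_1,\ \gamma_1\gamma_2,\ \gamma_2\gamma_3$. $\Gamma'_k$ is the simple graph with vertices $\alpha'_0,\overline{\alpha}_1,\alpha'_2,\overline{\alpha}_3,\dots,\alpha'_{n-1},\overline{\alpha}_n,f,g,\overline{\beta}_2,\overline{\gamma}_2$; its edges are those of the path $\alpha'_0-\overline{\alpha}_1-\alpha'_2-\overline{\alpha}_3-\cdots-\alpha'_{n-1}-\overline{\alpha}_n$ together with $\overline{\alpha}_nf,\ \overline{\alpha}_ng,\ g\overline{\beta}_2,\ g\overline{\gamma}_2$. A vertex is even or odd according to the parity of its distance to $\alpha_0$ (resp. $\alpha'_0$). $V_{11}=\{\alpha_0,\alpha_2,\dots,\alpha_{n-1},\beta_1,\gamma_1,\beta_3,\gamma_3\}$ (even vertices of $\Gamma_k$), $V_{12}=\{\alpha_1,\alpha_3,\dots,\alpha_n,\beta_2,\gamma_2\}$ (odd vertices of $\Gamma_k$), $V_{21}=\{\overline{\alpha}_1,\overline{\alpha}_3,\dots,\overline{\alpha}_n,\overline{\beta}_2,\overline{\gamma}_2\}$ (odd vertices of $\Gamma'_k$), $V_{22}=\{\alpha'_0,\alpha'_2,\dots,\alpha'_{n-1},f,g\}$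 (even vertices of $\Gamma'_k$). Fusion algebra. A fusion algebra (fusion ring) is a bi-graded associative $\mathbb{Z}$-algebra with a finite $\mathbb{Z}$-basis $\mathcal{X}=\bigsqcup_{P,Q\in\{N,M\}}{}_P\mathcal{X}_Q$ ($P$ is the left and $Q$ the right coefficient of elements of ${}_P\mathcal{X}_Q$) such that: (i) there is an involution $X\mapsto\overline{X}$ of $\mathcal{X}$ mapping ${}_P\mathcal{X}_Q$ to ${}_Q\mathcal{X}_P$; (ii) $XY$ is defined whenever the right coefficient of $X$ equals the left coefficient of $Y$, and then $XY=\sum_Z N_{X,Y}^Z Z$, the sum being over $Z\in\mathcal{X}$ with the same left coefficient as $X$ and the same right coefficient as $Y$, with $N_{X,Y}^Z\in\mathbb{N}_0$; (iii) Frobenius reciprocity: $N_{X,Y}^Z=N_{Z,\overline{Y}}^X=N_{\overline{X},Z}^Y=N_{\overline{Y},\overline{X}}^{\overline{Z}}=N_{\overline{Z},X}^{\overline{Y}}=N_{Y,\overline{Z}}^{\overline{X}}$; (iv) there are identity objects $1_N\in{}_N\mathcal{X}_N$, $1_M\in{}_M\mathcal{X}_M$ acting as identities whenever the product is defined. The bars in the labels of the vertices in $V_{21}$ refer to the involution: the involution maps $\alpha_{2j+1},\beta_2,\gamma_2\in V_{12}$ to the vertices $\overline{\alpha}_{2j+1},\overline{\beta}_2,\overline{\gamma}_2\in V_{21}$ respectively. *)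

(* Defs.v *)
From HB Require Import structures.
From mathcomp Require Import all_boot all_order all_algebra.
Set Implicit Arguments.
Unset Strict Implicit.
Unset Printing Implicit Defensive.
Import GRing.Theory.
Local Open Scope ring_scope.

Variant side := sN | sM.

(* Data of a bigraded based algebra: the basis [X P Q] is the set of elements
   with left coefficient P and right coefficient Q; [coef x y z] is the
   structure constant N_{x,y}^z; [one P] is the identity object 1_P. *)
Record fusion_data (X : side -> side -> finType) := FusionData {
  dual : forall P Q, X P Q -> X Q P;
  coef : forall P Q R, X P Q -> X Q R -> X P R -> nat;
  one : forall P, X P P
}.

Arguments dual {X} f {P Q} _.
Arguments coef {X} f {P Q R} _ _ _.
Arguments one {X} f P.

Section FusionAlgebra.

Variables (X : side -> side -> finType) (A : fusion_data X).

(* The component of bidegree (P, Q) of the algebra: the free Z-module on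
   [X P Q]. *)
Definition homog (P Q : side) := {ffun X P Q -> int}.

Definition basis_vec P Q (x : X P Q) : homog P Q := [ffun y => (y == x)%:R].

(* The bilinear extension of x y = \sum_z N_{x,y}^z z. *)
Definition fmul P Q R (a : homog P Q) (b : homog Q R) : homog P R :=
  [ffun z => \sum_(x : X P Q) \sum_(y : X Q R) a x * b y * (coef A x y z)%:Z].

Record fusion_algebra : Prop := {
  fmulA : forall P Q R S (a : homog P Q) (b : homog Q R) (c : homog R S),
    fmul a (fmul b c) = fmul (fmul a b) c;
  dualK : forall P Q (x : X P Q), dual A (dual A x) = x;
  frobenius_reciprocity :
    forall P Q R (x : X P Q) (y : X Q R) (z : X P R),
    [/\ coef A x y z = coef A z (dual A y) x,
        coef A x y z = coef A (dual A x) z y,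
        coef A x y z = coef A (dual A y) (dual A x) (dual A z),
        coef A x y z = coef A (dual A z) x (dual A y)
      & coef A x y z = coef A y (dual A z) (dual A x)];
  fmul1l : forall P Q (a : homog P Q), fmul (basis_vec (one A P)) a = a;
  fmul1r : forall P Q (a : homog P Q), fmul a (basis_vec (one A Q)) = a
}.

End FusionAlgebra.

Definition nk (k : nat) : nat := (4 * k).+3.

Inductive Gamma (k : nat) :=
  | alpha of 'I_(nk k).+1
  | beta1 | beta2 | beta3
  | gamma1 | gamma2 | gamma3.

Arguments beta1 {k}. Arguments beta2 {k}. Arguments beta3 {k}.
Arguments gamma1 {k}. Arguments gamma2 {k}. Arguments gamma3 {k}.

(* [palpha i] is the i-th vertex of the long path of Gamma'_k: alpha'_i when i
   is even and \bar{alpha}_i when i is odd; [vf], [vg] are f and g; [bbeta2] and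
   [bgamma2] are \bar{beta}_2 and \bar{gamma}_2. *)
Inductive Gamma' (k : nat) :=
  | palpha of 'I_(nk k).+1
  | vf | vg | bbeta2 | bgamma2.

Arguments vf {k}. Arguments vg {k}. Arguments bbeta2 {k}. Arguments bgamma2 {k}.

Section GammaFinite.

Variable k : nat.

Definition Gamma_code (u : Gamma k) : 'I_(nk k).+1 + 'I_6 :=
  match u with
  | alpha i => inl i
  | beta1 => inr (inord 0) | beta2 => inr (inord 1) | beta3 => inr (inord 2)
  | gamma1 => inr (inord 3) | gamma2 => inr (inord 4) | gamma3 => inr (inord 5)
  end.

Definition Gamma_decode (c : 'I_(nk k).+1 + 'I_6) : Gamma k :=
  match c with
  | inl i => alpha i
  | inr j => nth beta1 [:: beta1; beta2; beta3; gamma1; gamma2; gamma3] j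
  end.

Lemma Gamma_codeK : cancel Gamma_code Gamma_decode.
Proof. by case=> //=; rewrite inordK. Qed.

HB.instance Definition _ := Finite.copy (Gamma k) (can_type Gamma_codeK).

Definition Gamma'_code (u : Gamma' k) : 'I_(nk k).+1 + 'I_4 :=
  match u with
  | palpha i => inl i
  | vf => inr (inord 0) | vg => inr (inord 1)
  | bbeta2 => inr (inord 2) | bgamma2 => inr (inord 3)
  end.

Definition Gamma'_decode (c : 'I_(nk k).+1 + 'I_4) : Gamma' k :=
  match c with
  | inl i => palpha i
  | inr j => nth vf [:: vf; vg; bbeta2; bgamma2] j
  end.

Lemma Gamma'_codeK : cancel Gamma'_code Gamma'_decode.
Proof. by case=> //=; rewrite inordK. Qed.

HB.instance Definition _ := Finite.copy (Gamma' k) (can_type Gamma'_codeK).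

End GammaFinite.

Section Graphs.

Variable k : nat.

Local Open Scope nat_scope.

(* Each edge listed once; [adj] and [adj'] are the symmetric closures. *)
Definition arc (u v : Gamma k) : bool :=
  match u, v with
  | alpha i, alpha j => i.+1 == j
  | alpha i, beta1 | alpha i, gamma1 => i == nk k :> nat
  | beta1, beta2 | beta2, beta3 | gamma1, gamma2 | gamma2, gamma3 => true
  | _, _ => false
  end.

Definition adj (u v : Gamma k) : bool := arc u v || arc v u.

Definition arc' (u v : Gamma' k) : bool :=
  match u, v with
  | palpha i, palpha j => i.+1 == j
  | palpha i, vf | palpha i, vg => i == nk k :> nat
  | vg, bbeta2 | vg, bgamma2 => true
  | _, _ => false
  end.

Definition adj' (u v : Gamma' k) : bool := arc' u v || arc' v u.

Definition odd_vertex (u : Gamma k) : bool :=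
  match u with
  | alpha i => odd i
  | beta2 | gamma2 => true
  | beta1 | beta3 | gamma1 | gamma3 => false
  end.

Definition odd_vertex' (u : Gamma' k) : bool :=
  match u with
  | palpha i => odd i
  | bbeta2 | bgamma2 => true
  | vf | vg => false
  end.

Lemma odd_nk : odd (nk k).
Proof. by rewrite /nk /= oddM. Qed.

(* As the graphs are connected and alpha_0, alpha'_0 are not odd vertices,
   these lemmas identify [odd_vertex] and [odd_vertex'] with the parity of the
   distance to alpha_0, resp. alpha'_0. *)
Lemma adj_odd_vertex (u v : Gamma k) : adj u v -> odd_vertex v = ~~ odd_vertex u.
Proof.
have arcP : forall x y : Gamma k, arc x y -> odd_vertex y = ~~ odd_vertex x.
  by case=> [i||||||] [j||||||] //= /eqP => [<-|->|->] //; rewrite odd_nk.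
by case/orP=> /arcP -> //; rewrite negbK.
Qed.

Lemma adj'_odd_vertex' (u v : Gamma' k) :
  adj' u v -> odd_vertex' v = ~~ odd_vertex' u.
Proof.
have arcP : forall x y : Gamma' k, arc' x y -> odd_vertex' y = ~~ odd_vertex' x.
  by case=> [i||||] [j||||] //= /eqP => [<-|->|->] //; rewrite odd_nk.
by case/orP=> /arcP -> //; rewrite negbK.
Qed.

Definition V11 : finType := {u : Gamma k | ~~ odd_vertex u}.
Definition V12 : finType := {u : Gamma k | odd_vertex u}.
Definition V21 : finType := {u : Gamma' k | odd_vertex' u}.
Definition V22 : finType := {u : Gamma' k | ~~ odd_vertex' u}.

Definition basis (P Q : side) : finType :=
  match P, Q with
  | sN, sN => V11
  | sN, sM => V12
  | sM, sN => V21
  | sM, sM => V22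
  end.

Definition alpha0 : V11 := exist _ (alpha ord0) isT.
Definition alpha'0 : V22 := exist _ (palpha ord0) isT.
Definition alpha1 : V12 :=
  exist _ (alpha (Ordinal (isT : 1 < (nk k).+1))) isT.
Definition balpha1 : V21 :=
  exist _ (palpha (Ordinal (isT : 1 < (nk k).+1))) isT.

(* [is_bar u v] holds iff the label of v is that of u with a bar added. *)
Definition is_bar (u : V12) (v : V21) : bool :=
  match val u, val v with
  | alpha i, palpha j => i == j
  | beta2, bbeta2 | gamma2, bgamma2 => true
  | _, _ => false
  end.

Record compatible (A : fusion_data basis) : Prop := {
  coef_alpha1_N : forall (x : V11) (y : V12),
    @coef _ A sN sN sM x alpha1 y = adj (val x) (val y);
  coef_alpha1_M : forall (x : V21) (y : V22),
    @coef _ A sM sN sM x alpha1 y = adj' (val x) (val y);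
  coef_balpha1_N : forall (x : V12) (y : V11),
    @coef _ A sN sM sN x balpha1 y = adj (val x) (val y);
  coef_balpha1_M : forall (x : V22) (y : V21),
    @coef _ A sM sM sN x balpha1 y = adj' (val x) (val y);
  one_N : one A sN = alpha0;
  one_M : one A sM = alpha'0;
  coef_one : forall P Q (x y : basis P Q), coef A x (one A Q) y = (x == y);
  dual_bar : forall x : V12, is_bar x (@dual _ A sN sM x)
}.

End Graphs.

(* Main.v *)
Require Import Defs.
From HB Require Import structures.
From mathcomp Require Import all_boot all_order all_algebra.
From mathcomp Require Import ring lra zify.
From Stdlib Require Import FunctionalExtensionality.
Set Implicit Arguments.
Unset Strict Implicit.
Unset Printing Implicit Defensive.
Import Order.TTheory GRing.Theory Num.Theory.
Local Open Scope ring_scope.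

(** The algebra is studied through its right regular representation: [R y] is
the matrix of [x |-> x y] on the span of all the vertices of both graphs, and
[R y = 0] on the elements with which [y] cannot be multiplied.  Write [Delta]
for the adjacency matrix of the two graphs, [J] for the permutation matrix of
the involution and [U_m] for the Chebyshev polynomials, [U_{m+1} = U_m Delta -
U_{m-1}].

Along the long paths [alpha_j = 1 U_j (Delta)], so [R (alpha_j)] can only be
[U_j (Delta)], restricted to the elements with right label N (or M for the
second graph).  Continuing past the branch point gives [R (beta_1 + gamma_1) =
U_{n+1}] and [R (beta_3 + gamma_3) = S3], polynomials in [Delta] too.  What
the graphs do not show at once is [R (e)] for [e = beta_3 - gamma_3].

Existence.  Here [R (e)] is given by an explicit antisymmetric matrix of rank
six, [Rdif], built from two eigenvectors [X0] and [X2] of [Delta^2] with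
eigenvalues 0 and 2, which have entries of modulus one at the even vertices
of the long path; [X2] exists because [n = 3] modulo 4.  Left
multiplications are the conjugates by [J] of the right ones, and they commute
with the right multiplications since [J Delta J] and [J Rdif J] commute with
[Delta] and [Rdif] ([Gl_Dl], [Gl_Rdif], [J_Rdif_J_Rdif]).  This commutation
([lmul_rmul]) is associativity, and with [R (x)^T = R (bar x)] ([rmul_tr]) it
gives Frobenius reciprocity.

What remains for existence is that the coefficients, a priori half-integers
of unknown sign, are natural numbers ([natmx_rmul]).  The products
[beta_3 U_m] are waves that start at a tip of the first graph and run out
along the long leg, without being reflected while [m <= n + 3]; their
amplitudes are given by tribonacci numbers ([tip_waveE]).  The other products
[x U_m] reduce to these, and the products with [beta_3] itself reduce by the
involution to the coefficients of [beta_3 beta_3] and [gamma_3 beta_3] at the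
even vertices beyond the branch point, where the parity of the tribonacci
numbers decides ([natv_tip_Rb3_at]).

Uniqueness.  Let [Ke] be the matrix [R (e)] in an arbitrary compatible fusion
algebra.  The involution preserves the pairs [{beta_1, gamma_1}] and
[{beta_3, gamma_3}], and [Delta Ke Delta = 0] forces it to exchange the
elements of exactly one of them ([dual_signs]).  If it exchanged [beta_1] and
[gamma_1], the sum of the coefficients of [beta_3] and [beta_1] in
[beta_3 beta_3] would be half an odd integer ([not_selfdual]).  So the
involution is the expected one.  It makes [Ke] antisymmetric and turns [x e]
into [- e bar(x)], so that the rows of [Ke - Rdif] vanish on the long paths
and are opposite to each other at the two elements of a pair.  Only the
coefficient of [beta_3] in [beta_1 e] is left open by this; Frobenius
reciprocity determines it ([Ke_ed]), and [Ke = Rdif]. *)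

(** * Vectors and matrices indexed by a finite type *)

(* These operations are sealed because unification, when it fails on two
   matrix expressions, would otherwise unfold them down to finite functions. *)
Unset Implicit Arguments.
HB.lock Definition crd (T : finType) (v : 'rV[rat]_#|T|) (x : T) : rat :=
  v 0 (enum_rank x).
HB.lock Definition rowf (T : finType) (f : T -> rat) : 'rV[rat]_#|T| :=
  \row_i f (enum_val i).
HB.lock Definition bv (T : finType) (x : T) : 'rV[rat]_#|T| :=
  rowf T (fun y => (y == x)%:R).
HB.lock Definition opf (T : finType) (f : T -> T -> rat) : 'M[rat]_#|T| :=
  \matrix_(i, j) f (enum_val i) (enum_val j).
HB.lock Definition dot N (u v : 'rV[rat]_N) : rat := (u *m v^T) 0 0.
HB.lock Definition tens N (u v : 'rV[rat]_N) : 'M[rat]_N :=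
  \matrix_(i, j) (u 0 i * v 0 j).

HB.lock Definition wedge N (u v : 'rV[rat]_N) : 'M[rat]_N :=
  tens N u v - tens N v u.
Fixpoint cheb_rec (N : nat) (M : 'M[rat]_N) (m : nat) : 'M[rat]_N :=
  match m with
  | 0 => 1%:M
  | m'.+1 => match m' with
             | 0 => M
             | m''.+1 => cheb_rec N M m' *m M - cheb_rec N M m'' end
  end.
HB.lock Definition cheb (N : nat) (M : 'M[rat]_N) (m : nat) : 'M[rat]_N :=
  cheb_rec N M m.

Set Implicit Arguments.
Arguments cheb {N} M m.
Arguments crd {T} v x.
Arguments rowf {T} f.
Arguments bv {T} x.
Arguments opf {T} f.
Arguments dot {N} u v.
Arguments tens {N} u v.
Arguments wedge {N} u v.

Section IndexedMatrices.

Variable T : finType.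
Implicit Types (u v w : 'rV[rat]_#|T|) (M : 'M[rat]_#|T|) (x y : T).

Lemma crd_rowf (f : T -> rat) x : crd (rowf f) x = f x.
Proof. by rewrite crd.unlock rowf.unlock mxE enum_rankK. Qed.

Lemma crd_bv x y : crd (bv x) y = (y == x)%:R.
Proof. by rewrite bv.unlock crd_rowf. Qed.

Lemma crdP u v : (forall x, crd u x = crd v x) -> u = v.
Proof.
by move=> uv; apply/rowP=> i; have := uv (enum_val i); rewrite crd.unlock enum_valK.
Qed.

Lemma crdD u v x : crd (u + v) x = crd u x + crd v x.
Proof. by rewrite crd.unlock mxE. Qed.
Lemma crdN u x : crd (- u) x = - crd u x.
Proof. by rewrite crd.unlock mxE. Qed.
Lemma crdZ a u x : crd (a *: u) x = a * crd u x.
Proof. by rewrite crd.unlock mxE. Qed.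
Lemma crd0 x : crd 0 x = 0.
Proof. by rewrite crd.unlock mxE. Qed.

Lemma crd_sum (I : Type) (r : seq I) (P : pred I) (F : I -> 'rV_#|T|) x :
  crd (\sum_(i <- r | P i) F i) x = \sum_(i <- r | P i) crd (F i) x.
Proof. by rewrite crd.unlock summxE. Qed.

Lemma big_enum_rank (F : 'I_#|T| -> rat) :
  \sum_i F i = \sum_(x : T) F (enum_rank x).
Proof.
rewrite (reindex (@enum_rank T)) //=; last first.
  by exists enum_val => i _; [exact: enum_rankK | exact: enum_valK].
Qed.

Lemma dotE u v : dot u v = \sum_x crd u x * crd v x.
Proof.
rewrite dot.unlock mxE big_enum_rank; apply: eq_bigr => x _.
by rewrite mxE crd.unlock.
Qed.

Lemma crd_mulopf v (f : T -> T -> rat) x : crd (v *m opf f) x = \sum_y crd v y * f y x.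
Proof.
rewrite crd.unlock opf.unlock mxE big_enum_rank; apply: eq_bigr => y _.
by rewrite mxE !enum_rankK.
Qed.

Lemma crd_mul v M x :
  crd (v *m M) x = \sum_y crd v y * M (enum_rank y) (enum_rank x).
Proof. by rewrite crd.unlock mxE big_enum_rank. Qed.

Lemma bv_mulE x y M : crd (bv x *m M) y = M (enum_rank x) (enum_rank y).
Proof.
rewrite crd_mul (bigD1 x) //= crd_bv eqxx mul1r big1 ?addr0 // => z zx.
by rewrite crd_bv (negPf zx) mul0r.
Qed.

Lemma mx_bvP M M' : (forall x, bv x *m M = bv x *m M') -> M = M'.
Proof.
move=> MM'; apply/matrixP => i j; rewrite -(enum_valK i) -(enum_valK j).
by rewrite -!bv_mulE MM'.
Qed.

Lemma dotC u v : dot u v = dot v u.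
Proof. by rewrite !dotE; apply: eq_bigr => x _; rewrite mulrC. Qed.
Lemma dotDl u v w : dot (u + v) w = dot u w + dot v w.
Proof. by rewrite dot.unlock mulmxDl mxE. Qed.
Lemma dotNl u w : dot (- u) w = - dot u w.
Proof. by rewrite dot.unlock mulNmx mxE. Qed.
Lemma dotZl a u w : dot (a *: u) w = a * dot u w.
Proof. by rewrite dot.unlock -scalemxAl mxE. Qed.
Lemma dot0l w : dot 0 w = 0.
Proof. by rewrite dot.unlock mul0mx mxE. Qed.
Lemma dotDr u v w : dot w (u + v) = dot w u + dot w v.
Proof. by rewrite !(dotC w) dotDl. Qed.
Lemma dotNr u w : dot w (- u) = - dot w u.
Proof. by rewrite !(dotC w) dotNl. Qed.
Lemma dotZr a u w : dot w (a *: u) = a * dot w u.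
Proof. by rewrite !(dotC w) dotZl. Qed.
Lemma dot0r w : dot w 0 = 0.
Proof. by rewrite dotC dot0l. Qed.

Definition dotLE := (dotDl, dotNl, dotZl, dot0l, dotDr, dotNr, dotZr, dot0r).

Lemma dot_bv u x : dot u (bv x) = crd u x.
Proof.
rewrite dotE (bigD1 x) //= crd_bv eqxx mulr1 big1 ?addr0 // => z zx.
by rewrite crd_bv (negPf zx) mulr0.
Qed.

Lemma dot_adj u v M : dot (u *m M) v = dot u (v *m M^T).
Proof. by rewrite dot.unlock trmx_mul trmxK mulmxA. Qed.

Lemma dot_eq0 u v : (forall x, crd u x * crd v x = 0) -> dot u v = 0.
Proof. by move=> uv; rewrite dotE big1. Qed.

Lemma tens_mulr u v M : tens u v *m M = tens u (v *m M).
Proof.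
rewrite tens.unlock; apply/matrixP=> i j; rewrite !mxE big_distrr; apply: eq_bigr => l _ /=.
by rewrite !mxE mulrA.
Qed.

Lemma tens_mull u v M : M *m tens u v = tens (u *m M^T) v.
Proof.
rewrite tens.unlock; apply/matrixP=> i j; rewrite [RHS]mxE [in RHS]mxE big_distrl [LHS]mxE.
by apply: eq_bigr => l _ /=; rewrite !mxE; ring.
Qed.

Lemma tens_tr u v : (tens u v)^T = tens v u.
Proof. by rewrite tens.unlock; apply/matrixP=> i j; rewrite !mxE mulrC. Qed.

Lemma mul_tens w u v : w *m tens u v = dot w u *: v.
Proof.
rewrite tens.unlock; apply/rowP=> j; rewrite [RHS]mxE dot.unlock [in RHS]mxE big_distrl [LHS]mxE.
by apply: eq_bigr => l _ /=; rewrite !mxE; ring.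
Qed.

Lemma tensZl a u v : tens (a *: u) v = a *: tens u v.
Proof. by rewrite tens.unlock; apply/matrixP=> i j; rewrite !mxE mulrA. Qed.
Lemma tensZr a u v : tens u (a *: v) = a *: tens u v.
Proof. by rewrite tens.unlock; apply/matrixP=> i j; rewrite !mxE; ring. Qed.
Lemma tens0l v : tens 0 v = 0.
Proof. by rewrite tens.unlock; apply/matrixP=> i j; rewrite !mxE mul0r. Qed.
Lemma tens0r v : tens v 0 = 0.
Proof. by rewrite tens.unlock; apply/matrixP=> i j; rewrite !mxE mulr0. Qed.
Lemma tensNl u v : tens (- u) v = - tens u v.
Proof. by rewrite tens.unlock; apply/matrixP=> i j; rewrite !mxE mulNr. Qed.
Lemma tensNr u v : tens u (- v) = - tens u v.
Proof. by rewrite tens.unlock; apply/matrixP=> i j; rewrite !mxE mulrN. Qed.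

Lemma mul_wedge w u v : w *m wedge u v = dot w u *: v - dot w v *: u.
Proof. by rewrite wedge.unlock mulmxBr !mul_tens. Qed.

Lemma wedge_tr u v : (wedge u v)^T = - wedge u v.
Proof. by rewrite wedge.unlock linearB /= !tens_tr opprB. Qed.

Definition natv v := forall x, crd v x \is a Num.nat.
Definition natmx M := forall x, natv (bv x *m M).

Lemma natmx_ent M : natmx M <-> (forall i j, M i j \is a Num.nat).
Proof.
split=> [N i j|N x y]; last by rewrite bv_mulE.
by rewrite -(enum_valK i) -(enum_valK j) -bv_mulE; apply: N.
Qed.

Lemma natv_mul v M : natv v -> natmx M -> natv (v *m M).
Proof.
move=> Nv /natmx_ent NM x; rewrite crd_mul; apply: rpred_sum => y _.
by apply: rpredM; [exact: Nv | exact: NM].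
Qed.

Lemma natmx_mul M M' : natmx M -> natmx M' -> natmx (M *m M').
Proof. by move=> NM NM' x; rewrite mulmxA; apply: natv_mul. Qed.

Lemma natmx_tr M : natmx M -> natmx M^T.
Proof. by move/natmx_ent=> N; apply/natmx_ent => i j; rewrite mxE. Qed.

Lemma natv_bv x : natv (bv x).
Proof. by move=> y; rewrite crd_bv natr_nat. Qed.

Lemma cheb0 M : cheb M 0 = 1%:M.
Proof. by rewrite cheb.unlock. Qed.
Lemma cheb1 M : cheb M 1 = M.
Proof. by rewrite cheb.unlock. Qed.
Lemma chebSS M m : cheb M m.+2 = cheb M m.+1 *m M - cheb M m.
Proof. by rewrite cheb.unlock. Qed.

Lemma cheb_mulr M m : cheb M m.+1 *m M = cheb M m + cheb M m.+2.
Proof. by rewrite chebSS addrC subrK. Qed.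

Lemma comm_cheb M M' m : comm_mx M' M -> comm_mx M' (cheb M m).
Proof.
move=> cM; elim/ltn_ind: m => -[|[|m]] IH; rewrite ?cheb0 ?cheb1 //; first exact: comm_mx1.
by rewrite chebSS; apply: comm_mxB; [apply: comm_mxM => // |]; apply: IH.
Qed.

Lemma cheb_comm M m m' : comm_mx (cheb M m) (cheb M m').
Proof. by apply: comm_cheb; apply/comm_mx_sym/comm_cheb. Qed.

Lemma cheb_tr M m : M^T = M -> (cheb M m)^T = cheb M m.
Proof.
move=> MT; elim/ltn_ind: m => -[|[|m]] IH; rewrite ?cheb0 ?cheb1 ?trmx1 //.
have IH1 := IH m.+1 (ltnSn _); have IH0 := IH m (leqW (ltnSn _)).
rewrite chebSS linearB /= trmx_mul MT IH1 IH0.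
by congr (_ - _); apply: comm_cheb.
Qed.

(** The product rule for Chebyshev polynomials in the form that allows an
    induction on [i]: it trades a product for one of lower degree and a single
    polynomial of degree [i + j + 2]. *)
Lemma cheb_mulSS M i j :
  cheb M i.+1 *m cheb M j.+1 = cheb M i *m cheb M j + cheb M (i + j).+2.
Proof.
elim/ltn_ind: j i => -[|[|j]] IH i.
- by rewrite cheb0 mulmx1 addn0 cheb1 cheb_mulr.
- rewrite (chebSS M 0) cheb0 cheb1 mulmxBr mulmxA cheb_mulr mulmxDl mulmx1 addn1 cheb_mulr.
  by rewrite -addrA; congr (_ + _); rewrite addrC addKr.
rewrite (chebSS M j.+1) mulmxBr mulmxA (IH j.+1) // (IH j (leqW (ltnSn _))).
rewrite [in RHS](chebSS M j) [in RHS]mulmxBr mulmxDl !addnS mulmxA cheb_mulr.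
rewrite opprD addrACA; congr (_ + _).
by rewrite addrC addKr.
Qed.

End IndexedMatrices.

(** Vectors do not form a ring; their coordinates do.  The coordinates of the vectors
    that occur are treated as unknowns. *)
Ltac vring :=
  let y := fresh "y" in apply: crdP => y;
  rewrite ?(crdD, crdN, crdZ, crd0);
  repeat match goal with |- context [crd ?v y] =>
    let t := fresh "t" in move: (crd v y) => t end;
  by field.

Lemma mxentD N (A B : 'M[rat]_N) i j : (A + B) i j = A i j + B i j.
Proof. by rewrite mxE. Qed.
Lemma mxentN N (A : 'M[rat]_N) i j : (- A) i j = - A i j.
Proof. by rewrite mxE. Qed.
Lemma mxentZ N a (A : 'M[rat]_N) i j : (a *: A) i j = a * A i j.
Proof. by rewrite mxE. Qed.
Lemma mxent0 N i j : (0 : 'M[rat]_N) i j = 0.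
Proof. by rewrite mxE. Qed.

(** The same for linear combinations of square matrices. *)
Ltac mring :=
  let i := fresh "i" in let j := fresh "j" in apply/matrixP => i j;
  rewrite ?(mxentD, mxentN, mxentZ, mxent0);
  repeat match goal with |- context [fun_of_matrix ?M i j] =>
    let t := fresh "t" in move: (fun_of_matrix M i j) => t end;
  by field.

(** * The two graphs and the involution *)

Section GraphPair.

Variable k : nat.
Local Notation n := (nk k).
Definition vertex : finType := (Gamma k + Gamma' k)%type.

(** The vertices of the long paths are indexed by all natural numbers, so that
    recurrences along the paths need no casts; only indices up to [n] matter. *)
Definition al (m : nat) : vertex := inl (alpha (inord m)).
Definition pl (m : nat) : vertex := inr (palpha (inord m)).
Definition vb1 : vertex := inl beta1.
Definition vb2 : vertex := inl beta2.
Definition vb3 : vertex := inl beta3.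
Definition vc1 : vertex := inl gamma1.
Definition vc2 : vertex := inl gamma2.
Definition vc3 : vertex := inl gamma3.
Definition vF : vertex := inr vf.
Definition vG : vertex := inr vg.
Definition vbb : vertex := inr bbeta2.
Definition vbc : vertex := inr bgamma2.

Variant vertex_spec : vertex -> Type :=
  | VAl m of (m <= n)%N : vertex_spec (al m)
  | VB1 : vertex_spec vb1 | VB2 : vertex_spec vb2 | VB3 : vertex_spec vb3
  | VC1 : vertex_spec vc1 | VC2 : vertex_spec vc2 | VC3 : vertex_spec vc3
  | VPl m of (m <= n)%N : vertex_spec (pl m)
  | VF : vertex_spec vF | VG : vertex_spec vG
  | VBB : vertex_spec vbb | VBC : vertex_spec vbc.

Lemma vertexP x : vertex_spec x.
Proof.
case: x => [[i||||||]|[i||||]]; try by constructor.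
- rewrite -(inord_val i); apply: (VAl (m := i)); exact: leq_ord.
- rewrite -(inord_val i); apply: (VPl (m := i)); exact: leq_ord.
Qed.

(** The equality inherited from the encoding of vertices as a finite type does
    not reduce; this one does. *)
Definition eqv (x y : vertex) : bool :=
  match x, y with
  | inl u, inl v => match u, v with
     | alpha i, alpha j => (i == j :> nat)
     | beta1, beta1 | beta2, beta2 | beta3, beta3 => true
     | gamma1, gamma1 | gamma2, gamma2 | gamma3, gamma3 => true
     | _, _ => false end
  | inr u, inr v => match u, v with
     | palpha i, palpha j => (i == j :> nat)
     | vf, vf | vg, vg | bbeta2, bbeta2 | bgamma2, bgamma2 => true
     | _, _ => false end
  | _, _ => false
  end.

Lemma eqvE (x y : vertex) : (x == y) = eqv x y.
Proof.
apply/eqP/idP => [->|]; first by case: y => [[i||||||]|[i||||]] /=.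
case: x => [[i||||||]|[i||||]]; case: y => [[j||||||]|[j||||]] //= /eqP ij.
  by congr (inl (alpha _)); apply: val_inj.
by congr (inr (palpha _)); apply: val_inj.
Qed.

Definition adjv (x y : vertex) : bool :=
  match x, y with
  | inl u, inl v => adj u v
  | inr u, inr v => adj' u v
  | _, _ => false
  end.

Lemma adjvC x y : adjv x y = adjv y x.
Proof. by case: x y => [u|u] [v|v] //=; rewrite /adj /adj' orbC. Qed.

(** Sums over neighbours are written over this list, so that products with the
    adjacency matrix reduce to explicit short sums. *)
Definition nbs (x : vertex) : seq vertex :=
  match x with
  | inl u => match u with
    | alpha i => (if i == 0%N :> nat then [::] else [:: al i.-1]) ++
                 (if i == n :> nat then [:: vb1; vc1] else [:: al i.+1])
    | beta1 => [:: al n; vb2]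
    | beta2 => [:: vb1; vb3]
    | beta3 => [:: vb2]
    | gamma1 => [:: al n; vc2]
    | gamma2 => [:: vc1; vc3]
    | gamma3 => [:: vc2]
    end
  | inr u => match u with
    | palpha i => (if i == 0%N :> nat then [::] else [:: pl i.-1]) ++
                 (if i == n :> nat then [:: vF; vG] else [:: pl i.+1])
    | vf => [:: pl n]
    | vg => [:: pl n; vbb; vbc]
    | bbeta2 => [:: vG]
    | bgamma2 => [:: vG]
    end
  end.

Lemma mem_nbs x y : (y \in nbs x) = adjv x y.
Proof.
have n_gt0 : (0 < n)%N by [].
case: x => [[[i Hi]||||||]|[[i Hi]||||]]; rewrite /nbs /=.
all: try (case: ifP => i0; case: ifP => i1).
all: rewrite ?inE ?eqvE.
all: case: y => [[[j Hj]||||||]|[[j Hj]||||]] //=.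
all: rewrite /adj /adj' /= ?inordK //; lia.
Qed.

Lemma nbs_uniq x : uniq (nbs x).
Proof.
have n_gt0 : (0 < n)%N by [].
case: x => [[[i Hi]||||||]|[[i Hi]||||]]; rewrite /nbs /=.
all: try (case: ifP => i0; case: ifP => i1).
all: rewrite /= ?inE ?eqvE //= ?inordK //; lia.
Qed.

(** Compatibility prescribes the involution only between the odd vertices of the two
    graphs.  That it exchanges [beta_3] and [gamma_3] but fixes [beta_1] and
    [gamma_1] is a consequence of associativity, see [dual_signs] and
    [not_selfdual]. *)
Definition bar (x : vertex) : vertex :=
  match x with
  | inl u => match u with
    | alpha i => if odd i then inr (palpha i) else x
    | beta1 => vb1 | gamma1 => vc1 | beta3 => vc3 | gamma3 => vb3
    | beta2 => vbb | gamma2 => vbc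
    end
  | inr u => match u with
    | palpha i => if odd i then inl (alpha i) else x
    | vf => vF | vg => vG | bbeta2 => vb2 | bgamma2 => vc2
    end
  end.

Lemma barK : involutive bar.
Proof.
case=> [[i||||||]|[i||||]] //=; case: (boolP (odd i)) => oi //=;
  by rewrite ?oi ?(negPf oi).
Qed.

Lemma bar_al m : (m <= n)%N -> bar (al m) = if odd m then pl m else al m.
Proof. by move=> mn; rewrite /= inordK. Qed.
Lemma bar_pl m : (m <= n)%N -> bar (pl m) = if odd m then al m else pl m.
Proof. by move=> mn; rewrite /= inordK. Qed.

End GraphPair.

Arguments barK {k}.

(** * The vectors and matrices of the construction *)

(** The entries along the long path of the eigenvectors [X0] and [X2] of
    [Delta^2] for the eigenvalues 0 and 2; at odd places [osc8] lists those of
    [X2 Delta], as [X2] itself vanishes there. *)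
Definition osc4 (i : nat) : rat := nth 0 [:: 1; 0; -1; 0] (i %% 4).
Definition osc8 (i : nat) : rat := nth 0 [:: 1; 2; 1; 0; -1; -2; -1; 0] (i %% 8).

Lemma osc4SS i : osc4 i.+2 = - osc4 i.
Proof.
have i2 : (i.+2 %% 4 = (i %% 4).+2 %% 4)%N by rewrite -[in LHS]addn2 -modnDml addn2.
rewrite /osc4 i2.
have : (i %% 4 < 4)%N by rewrite ltn_mod.
by case: (i %% 4)%N => [|[|[|[|]]]] //= _; ring.
Qed.

Lemma osc8_sum i : osc8 i + osc8 i.+2 = (if odd i then 2 else 1) * osc8 i.+1.
Proof.
have -> : odd i = odd (i %% 8) by rewrite odd_mod.
have i1 : (i.+1 %% 8 = (i %% 8).+1 %% 8)%N by rewrite -[in LHS]addn1 -modnDml addn1.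
have i2 : (i.+2 %% 8 = (i %% 8).+2 %% 8)%N by rewrite -[in LHS]addn2 -modnDml addn2.
rewrite /osc8 i1 i2.
have : (i %% 8 < 8)%N by rewrite ltn_mod.
by case: (i %% 8)%N => [|[|[|[|[|[|[|[|]]]]]]]] //= _; ring.
Qed.

Lemma osc4_n1 k : osc4 (nk k).-1 = -1.
Proof. by rewrite /osc4 /nk /= mulnC -[((k * 4).+2)%N]addn2 modnMDl. Qed.
Lemma osc4_n k : osc4 (nk k) = 0.
Proof. by rewrite /osc4 /nk /= mulnC -[((k * 4).+3)%N]addn3 modnMDl. Qed.
Lemma osc4_odd i : odd i -> osc4 i = 0.
Proof.
have -> : odd i = odd (i %% 4) by rewrite odd_mod.
rewrite /osc4; have : (i %% 4 < 4)%N by rewrite ltn_mod.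
by case: (i %% 4)%N => [|[|[|[|]]]].
Qed.

Lemma osc8_n1 k : osc8 (nk k).-1 = if odd k then -1 else 1.
Proof.
rewrite /osc8 /nk /=; have -> : ((4 * k).+2 = k./2 * 8 + ((odd k) * 4 + 2))%N.
  by rewrite -[in LHS](odd_double_half k) -muln2; lia.
by rewrite modnMDl; case: (odd k).
Qed.

(** The vanishing at [n] holds because [n = 3] modulo 4.  It is the condition
    under which the sequence extends over the branch point to an eigenvector
    symmetric in beta and gamma. *)
Lemma osc8_n k : osc8 (nk k) = 0.
Proof.
rewrite /osc8 /nk /=; have -> : ((4 * k).+3 = k./2 * 8 + ((odd k) * 4 + 3))%N.
  by rewrite -[in LHS](odd_double_half k) -muln2; lia.
by rewrite modnMDl; case: (odd k).
Qed.
Lemma sqr_osc4 i : ~~ odd i -> osc4 i ^+ 2 = 1.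
Proof.
have -> : odd i = odd (i %% 4) by rewrite odd_mod.
rewrite /osc4; have : (i %% 4 < 4)%N by rewrite ltn_mod.
by case: (i %% 4)%N => [|[|[|[|]]]].
Qed.
Lemma sqr_osc8 i : ~~ odd i -> osc8 i ^+ 2 = 1.
Proof.
have -> : odd i = odd (i %% 8) by rewrite odd_mod.
rewrite /osc8; have : (i %% 8 < 8)%N by rewrite ltn_mod.
by case: (i %% 8)%N => [|[|[|[|[|[|[|[|]]]]]]]].
Qed.

Definition onN k (a : nat -> rat) (b1 b2 b3 c1 c2 c3 : rat) : 'rV[rat]_#|vertex k| :=
  rowf (fun x : vertex k => match x with
    | inl u => match u with
      | alpha i => a i | beta1 => b1 | beta2 => b2 | beta3 => b3
      | gamma1 => c1 | gamma2 => c2 | gamma3 => c3 end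
    | inr _ => 0 end).

Definition onM k (a : nat -> rat) (f g b c : rat) : 'rV[rat]_#|vertex k| :=
  rowf (fun x : vertex k => match x with
    | inl _ => 0
    | inr u => match u with
      | palpha i => a i | vf => f | vg => g | bbeta2 => b | bgamma2 => c end
    end).

(** For the left and right labels, [true] stands for N and [false] for M. *)
Definition lft k (x : vertex k) : bool := if x is inl _ then true else false.
Definition rgt k (x : vertex k) : bool :=
  match x with inl u => ~~ odd_vertex u | inr u => odd_vertex' u end.

Unset Implicit Arguments.

HB.lock Definition Dl (k : nat) : 'M[rat]_#|vertex k| :=
  opf (fun x y => (adjv x y)%:R).
HB.lock Definition J (k : nat) : 'M[rat]_#|vertex k| :=
  opf (fun x y => (bar x == y)%:R).
(* As J exchanges left and right, this is left multiplication by alpha_1 and its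
   conjugate. *)
HB.lock Definition Gl (k : nat) : 'M[rat]_#|vertex k| :=
  J k *m Dl k *m J k.

(* In terms of e = beta_3 - gamma_3, these are e, e U_2 and e Delta. *)
HB.lock Definition ve (k : nat) : 'rV[rat]_#|vertex k| := bv (vb3 k) - bv (vc3 k).
HB.lock Definition vd (k : nat) : 'rV[rat]_#|vertex k| := bv (vb1 k) - bv (vc1 k).
HB.lock Definition ve2 (k : nat) : 'rV[rat]_#|vertex k| := bv (vb2 k) - bv (vc2 k).
HB.lock Definition vsum (k : nat) : 'rV[rat]_#|vertex k| := ve k + vd k.
HB.lock Definition vdif (k : nat) : 'rV[rat]_#|vertex k| := ve k - vd k.
HB.lock Definition X0 (k : nat) : 'rV[rat]_#|vertex k| :=
  onN k osc4 (1/2) 0 (-(1/2)) (1/2) 0 (-(1/2)).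
HB.lock Definition X2 (k : nat) : 'rV[rat]_#|vertex k| :=
  onN k (fun i => if odd i then 0 else osc8 i) (- osc8 (nk k).-1 / 2) 0
    (- osc8 (nk k).-1 / 2) (- osc8 (nk k).-1 / 2) 0 (- osc8 (nk k).-1 / 2).

HB.lock Definition Pi (k : nat) (b : bool) : 'M[rat]_#|vertex k| :=
  opf (fun x y => ((x == y) && (rgt x == b))%:R).
HB.lock Definition Lam (k : nat) (b : bool) : 'M[rat]_#|vertex k| :=
  opf (fun x y => ((x == y) && (lft x == b))%:R).

(** The product with [e] on the right.  Since [alpha_j e] is, up to sign, the image
    of [e U_j] under the involution, and [e U_j] runs through
    [e, ve2, vd, 0, -vd, -ve2, -e, 0] with period 8, the rows of [alpha_j] are
    [(osc4 j * vsum + osc8 j * vdif) / 2] for even [j] and similar for the odd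
    vertices of the second graph.  Antisymmetry then leaves little choice for the
    other entries. *)
HB.lock Definition Rdif (k : nat) : 'M[rat]_#|vertex k| :=
  (1/2) *: (wedge (X0 k) (vsum k) + wedge (X2 k) (vdif k)
            + wedge (ve2 k *m J k) (X2 k *m Dl k *m J k)).
(* The polynomial in Delta that sends alpha_0 to beta_3 + gamma_3. *)
HB.lock Definition S3 (k : nat) : 'M[rat]_#|vertex k| :=
  cheb (Dl k) (nk k).+3 - cheb (Dl k) (nk k).+1 - cheb (Dl k) (nk k).-1.

HB.lock Definition Rb3 (k : nat) : 'M[rat]_#|vertex k| :=
  (1/2) *: (Pi k true *m (S3 k + Rdif k)).
HB.lock Definition Rc3 (k : nat) : 'M[rat]_#|vertex k| :=
  (1/2) *: (Pi k true *m (S3 k - Rdif k)).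

Set Implicit Arguments.

(** Besides the products with [alpha_j], only those with [beta_3] and [gamma_3]
    are independent: [beta_2 = beta_3 Delta], [beta_1 = beta_3 U_2], the
    elements with left label M follow by transposition, [g] is
    [bar(gamma_2) Delta], and [f] is what remains of [alpha'_0 U_{n+1} = f + g]. *)
Definition rmul k (x : vertex k) : 'M[rat]_#|vertex k| :=
  match x with
  | inl u => match u with
    | alpha i => Pi k true *m cheb (Dl k) i
    | beta1 => Rb3 k *m cheb (Dl k) 2 | beta2 => Rb3 k *m Dl k | beta3 => Rb3 k
    | gamma1 => Rc3 k *m cheb (Dl k) 2 | gamma2 => Rc3 k *m Dl k | gamma3 => Rc3 k
    end
  | inr u => match u with
    | palpha i => Pi k false *m cheb (Dl k) i
    | vf => Pi k false *m cheb (Dl k) (nk k).+1 - Dl k *m Rb3 k *m Dl k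
    | vg => Dl k *m Rb3 k *m Dl k
    | bbeta2 => Dl k *m Rc3 k
    | bgamma2 => Dl k *m Rb3 k
    end
  end.

Definition lmul k (x : vertex k) : 'M[rat]_#|vertex k| :=
  J k *m rmul (bar x) *m J k.

Definition unit_of k (b : bool) : vertex k := if b then al k 0 else pl k 0.

(** * Adjacency matrix and involution *)

Section Construction.

Variable k : nat.
Local Notation n := (nk k).
Local Notation vertex := (vertex k).
Local Notation Dl := (Dl k).
Local Notation J := (J k).
Local Notation Gl := (Gl k).
Local Notation al := (al k).
Local Notation pl := (pl k).
Local Notation vb1 := (vb1 k).
Local Notation vb2 := (vb2 k).
Local Notation vb3 := (vb3 k).
Local Notation vc1 := (vc1 k).
Local Notation vc2 := (vc2 k).
Local Notation vc3 := (vc3 k).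
Local Notation vF := (vF k).
Local Notation vG := (vG k).
Local Notation vbb := (vbb k).
Local Notation vbc := (vbc k).
Local Notation Pi := (Pi k).
Local Notation Lam := (Lam k).
Local Notation Rdif := (Rdif k).
Local Notation S3 := (S3 k).
Local Notation X0 := (X0 k).
Local Notation X2 := (X2 k).
Local Notation vsum := (vsum k).
Local Notation vdif := (vdif k).
Local Notation ve := (ve k).
Local Notation vd := (vd k).
Local Notation ve2 := (ve2 k).
Local Notation Rb3 := (Rb3 k).
Local Notation Rc3 := (Rc3 k).
Local Notation rmul := (@rmul k).
Local Notation lmul := (@lmul k).
Local Notation unit_of := (@unit_of k).
Local Notation onN := (onN k).
Local Notation onM := (onM k).
Local Notation U := (cheb Dl).
Local Notation basis := (basis k).

Lemma Dl_tr : Dl^T = Dl.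
Proof. by rewrite Dl.unlock opf.unlock; apply/matrixP=> i j; rewrite !mxE adjvC. Qed.

Lemma crd_Dl v x : crd (v *m Dl) x = \sum_(y <- nbs x) crd v y.
Proof.
rewrite Dl.unlock crd_mulopf (bigID (mem (nbs x))) /= addrC big1 ?add0r; last first.
  by move=> y; rewrite mem_nbs adjvC => /negPf ->; rewrite mulr0.
rewrite -(big_uniq _ (nbs_uniq x)) /=; apply: eq_big_seq => y.
by rewrite mem_nbs adjvC => ->; rewrite mulr1.
Qed.

Lemma bv_Dl x : bv x *m Dl = \sum_(y <- nbs x) bv y.
Proof.
apply: crdP => y; rewrite bv_mulE Dl.unlock opf.unlock mxE !enum_rankK crd_sum -mem_nbs.
case yx: (y \in nbs x).
  rewrite (bigD1_seq y) ?nbs_uniq //= crd_bv eqxx big1 ?addr0 // => z /negPf zy.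
  by rewrite crd_bv eq_sym zy.
rewrite big1_seq // => z /= zx; rewrite crd_bv; case: eqP => // yz.
by rewrite yz zx in yx.
Qed.

Lemma nbs_al m : (m <= n)%N -> nbs (al m) =
  (if m == 0%N then [::] else [:: al m.-1]) ++
  (if m == n then [:: vb1; vc1] else [:: al m.+1]).
Proof. by move=> mn; rewrite /= !inordK. Qed.

Lemma nbs_pl m : (m <= n)%N -> nbs (pl m) =
  (if m == 0%N then [::] else [:: pl m.-1]) ++
  (if m == n then [:: vF; vG] else [:: pl m.+1]).
Proof. by move=> mn; rewrite /= !inordK. Qed.

Lemma crd_J v x : crd (v *m J) x = crd v (bar x).
Proof.
rewrite J.unlock crd_mulopf (bigD1 (bar x)) //= barK eqxx mulr1 big1 ?addr0 // => y.
by rewrite -(inj_eq (inv_inj barK)) barK => /negPf ->; rewrite mulr0.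
Qed.

Lemma bv_J x : bv x *m J = bv (bar x).
Proof.
by apply: crdP => y; rewrite crd_J !crd_bv -(inj_eq (inv_inj barK)) barK.
Qed.

Lemma J_tr : J^T = J.
Proof.
by rewrite J.unlock opf.unlock; apply/matrixP=> i j; rewrite !mxE -(inj_eq (inv_inj barK)) barK eq_sym.
Qed.

Lemma JK : J *m J = 1%:M.
Proof. by apply: mx_bvP => x; rewrite mulmxA !bv_J barK mulmx1. Qed.

Lemma mulJK m (A : 'M_(m, _)) : A *m J *m J = A.
Proof. by rewrite -mulmxA JK mulmx1. Qed.

Lemma Gl_tr : Gl^T = Gl.
Proof. by rewrite Gl.unlock !trmx_mul J_tr Dl_tr mulmxA. Qed.

(** The vertices of a long path ([true] for the first graph), shifted by one to
    start with a zero and continued by one step beyond the branch point, so that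
    the adjacency matrix acts by the same formula at all of its vertices. *)
Definition aseq (P : bool) (m : nat) : 'rV[rat]_#|vertex| :=
  match m with
  | 0 => 0
  | m.+1 => if m == n.+1 then (if P then bv vb1 + bv vc1 else bv vF + bv vG)
            else bv (if P then al m else pl m)
  end.

Arguments aseq : simpl never.

Lemma aseq0 P : aseq P 0 = 0. Proof. by []. Qed.

Lemma aseq_bv P m : (m <= n)%N -> aseq P m.+1 = bv (if P then al m else pl m).
Proof. by move=> mn; rewrite /aseq; case: eqP => // ?; lia. Qed.

Lemma aseq_D P m : (m <= n)%N ->
  aseq P m.+1 *m Dl = aseq P m + aseq P m.+2.
Proof.
move=> mn; rewrite aseq_bv // bv_Dl.
case: P; rewrite ?nbs_al ?nbs_pl // big_cat /=; congr (_ + _).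
- case: m mn => [|m] mn; rewrite ?big_nil // big_seq1 aseq_bv //=; lia.
- by rewrite /aseq eqSS; case: ifP => _; rewrite ?big_seq1 // big_cons big_seq1.
- case: m mn => [|m] mn; rewrite ?big_nil // big_seq1 aseq_bv //=; lia.
- by rewrite /aseq eqSS; case: ifP => _; rewrite ?big_seq1 // big_cons big_seq1.
Qed.

Lemma aseq_J P m : (m <= n.+2)%N -> aseq P m *m J = aseq (P (+) odd m.-1) m.
Proof.
case: m => [|m] mn; rewrite /aseq ?mul0mx //=; case: eqP => [->|mE].
  have -> : odd n.+1 = false by rewrite oddS odd_nk.
  by case: P; rewrite mulmxDl !bv_J.
rewrite bv_J; case: P; rewrite ?bar_al ?bar_pl; try lia; by case: (odd m).
Qed.

Lemma bvD_b1 : bv vb1 *m Dl = bv (al n) + bv vb2.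
Proof. by rewrite bv_Dl big_cons big_seq1. Qed.
Lemma bvD_b2 : bv vb2 *m Dl = bv vb1 + bv vb3.
Proof. by rewrite bv_Dl big_cons big_seq1. Qed.
Lemma bvD_b3 : bv vb3 *m Dl = bv vb2.
Proof. by rewrite bv_Dl big_seq1. Qed.
Lemma bvD_c1 : bv vc1 *m Dl = bv (al n) + bv vc2.
Proof. by rewrite bv_Dl big_cons big_seq1. Qed.
Lemma bvD_c2 : bv vc2 *m Dl = bv vc1 + bv vc3.
Proof. by rewrite bv_Dl big_cons big_seq1. Qed.
Lemma bvD_c3 : bv vc3 *m Dl = bv vc2.
Proof. by rewrite bv_Dl big_seq1. Qed.
Lemma bvD_F : bv vF *m Dl = bv (pl n).
Proof. by rewrite bv_Dl big_seq1. Qed.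
Lemma bvD_G : bv vG *m Dl = bv (pl n) + bv vbb + bv vbc.
Proof. by rewrite bv_Dl !big_cons big_nil addr0 addrA. Qed.
Lemma bvD_bb : bv vbb *m Dl = bv vG.
Proof. by rewrite bv_Dl big_seq1. Qed.
Lemma bvD_bc : bv vbc *m Dl = bv vG.
Proof. by rewrite bv_Dl big_seq1. Qed.
Lemma bvD_aln : bv (al n) *m Dl = bv (al n.-1) + bv vb1 + bv vc1.
Proof. by rewrite bv_Dl nbs_al // eqxx /= !big_cons big_nil addr0 addrA. Qed.
Lemma bvD_pln : bv (pl n) *m Dl = bv (pl n.-1) + bv vF + bv vG.
Proof. by rewrite bv_Dl nbs_pl // eqxx /= !big_cons big_nil addr0 addrA. Qed.

Lemma barE_al_n : bar (al n) = pl n.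
Proof. by rewrite bar_al // odd_nk. Qed.
Lemma barE_pl_n : bar (pl n) = al n.
Proof. by rewrite bar_pl // odd_nk. Qed.
Lemma odd_predn : odd n.-1 = false.
Proof. by have := odd_nk k; case: n => //= m; case: odd. Qed.
Lemma barE_al_n1 : bar (al n.-1) = al n.-1.
Proof. by rewrite bar_al ?odd_predn // leq_pred. Qed.
Lemma barE_pl_n1 : bar (pl n.-1) = pl n.-1.
Proof. by rewrite bar_pl ?odd_predn // leq_pred. Qed.

Definition bvDE := (bvD_b1, bvD_b2, bvD_b3, bvD_c1, bvD_c2, bvD_c3,
  bvD_F, bvD_G, bvD_bb, bvD_bc, bvD_aln, bvD_pln).
Lemma bar_special :
  ((bar vb1 = vb1) * (bar vb2 = vbb) * (bar vb3 = vc3) * (bar vc1 = vc1) *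
   (bar vc2 = vbc) * (bar vc3 = vb3) * (bar vF = vF) * (bar vG = vG) *
   (bar vbb = vb2) * (bar vbc = vc2))%type.
Proof. by []. Qed.
Definition barE :=
  (barE_al_n, barE_pl_n, barE_al_n1, barE_pl_n1, bar_special).

Lemma aseq_G P m : (m <= n)%N ->
  aseq P m.+1 *m Gl = aseq (~~ P) m + aseq (~~ P) m.+2.
Proof.
move=> mn; rewrite Gl.unlock !mulmxA aseq_J ?aseq_D ?mulmxDl ?aseq_J //; try lia.
case: m mn => [|m] mn; first by rewrite !aseq0; case: P.
by rewrite /= ; case: P; case: (odd m).
Qed.

Lemma aseq_top P : aseq P n.+2 = if P then bv vb1 + bv vc1 else bv vF + bv vG.
Proof. by rewrite /aseq eqxx. Qed.

Ltac vsimp := rewrite ?mulmxA; do 4? (rewrite ?mulmxDl; rewrite ?bv_J ?barE; rewrite ?bvDE).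

(** The commutation of left and right multiplication by [alpha_1], the first
    instance of associativity.  On a path [J Delta J] acts as [Delta] does, followed
    by the exchange of the two paths; only the vertices from [alpha_n] on need a
    computation. *)
Lemma Gl_Dl : comm_mx Gl Dl.
Proof.
apply: mx_bvP => x; rewrite !mulmxA.
have path P m : (m < n)%N ->
  aseq P m.+1 *m Gl *m Dl = aseq P m.+1 *m Dl *m Gl.
  move=> mn; rewrite aseq_G ?aseq_D ?mulmxDl; try lia.
  rewrite (@aseq_D _ m.+1) // (@aseq_G _ m.+1) //.
  case: m mn => [|m] mn; first by rewrite !aseq0 !mul0mx.
  by rewrite aseq_D ?aseq_G //; lia.
have pathn P : aseq P n.+1 *m Gl *m Dl = aseq P n.+1 *m Dl *m Gl.
  have predD Q : aseq Q n *m Dl = aseq Q n.-1 + aseq Q n.+1.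
    exact: (@aseq_D Q n.-1 (leq_pred _)).
  have predG Q : aseq Q n *m Gl = aseq (~~ Q) n.-1 + aseq (~~ Q) n.+1.
    exact: (@aseq_G Q n.-1 (leq_pred _)).
  rewrite aseq_G // aseq_D // !mulmxDl predD predG.
  congr (_ + _); rewrite !aseq_top Gl.unlock.
  by case: P => /=; vsimp; vring.
case: (vertexP x) => [m|||||||m||||].
- rewrite leq_eqVlt => /orP[/eqP ->|mn].
    by have := pathn true; rewrite aseq_bv.
  by have := path true m mn; rewrite aseq_bv // ltnW.
7: rewrite leq_eqVlt => /orP[/eqP ->|mn].
7: by have := pathn false; rewrite aseq_bv.
7: by have := path false m mn; rewrite aseq_bv // ltnW.
all: rewrite Gl.unlock; vsimp.
all: by vring.
Qed.

(** * The eigenvectors of the squared adjacency matrix *)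

Lemma onN_al a b1 b2 b3 c1 c2 c3 m : (m <= n)%N ->
  crd (onN a b1 b2 b3 c1 c2 c3) (al m) = a m.
Proof. by move=> mn; rewrite crd_rowf /= inordK. Qed.
Lemma onN_pl a b1 b2 b3 c1 c2 c3 m : crd (onN a b1 b2 b3 c1 c2 c3) (pl m) = 0.
Proof. by rewrite crd_rowf. Qed.
Lemma onN_E a b1 b2 b3 c1 c2 c3 (v := onN a b1 b2 b3 c1 c2 c3) :
  ((crd v vb1 = b1) * (crd v vb2 = b2) * (crd v vb3 = b3) *
   (crd v vc1 = c1) * (crd v vc2 = c2) * (crd v vc3 = c3) *
   (crd v vF = 0) * (crd v vG = 0) * (crd v vbb = 0) * (crd v vbc = 0))%type.
Proof. by rewrite !crd_rowf. Qed.
Lemma onM_pl a f g b c m : (m <= n)%N -> crd (onM a f g b c) (pl m) = a m.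
Proof. by move=> mn; rewrite crd_rowf /= inordK. Qed.
Lemma onM_al a f g b c m : crd (onM a f g b c) (al m) = 0.
Proof. by rewrite crd_rowf. Qed.
Lemma onM_E a f g b c (v := onM a f g b c) :
  ((crd v vF = f) * (crd v vG = g) * (crd v vbb = b) * (crd v vbc = c) *
   (crd v vb1 = 0) * (crd v vb2 = 0) * (crd v vb3 = 0) *
   (crd v vc1 = 0) * (crd v vc2 = 0) * (crd v vc3 = 0))%type.
Proof. by rewrite !crd_rowf. Qed.

Lemma eq_onN a b1 b2 b3 c1 c2 c3 a' b1' b2' b3' c1' c2' c3' :
  (forall m, (m <= n)%N -> a m = a' m) -> b1 = b1' -> b2 = b2' -> b3 = b3' ->
  c1 = c1' -> c2 = c2' -> c3 = c3' ->
  onN a b1 b2 b3 c1 c2 c3 = onN a' b1' b2' b3' c1' c2' c3'.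
Proof.
move=> aE <- <- <- <- <- <-; apply: crdP => x; case: (vertexP x) => *;
  by rewrite ?onN_al ?onN_pl ?onN_E ?aE.
Qed.

Lemma eq_onM a f g b c a' f' g' b' c' :
  (forall m, (m <= n)%N -> a m = a' m) -> f = f' -> g = g' -> b = b' ->
  c = c' -> onM a f g b c = onM a' f' g' b' c'.
Proof.
move=> aE <- <- <- <-; apply: crdP => x; case: (vertexP x) => *;
  by rewrite ?onM_pl ?onM_al ?onM_E ?aE.
Qed.

(** The action of the adjacency matrix on coefficients along a long path: the sum
    of the coefficients at the two neighbours, where [top] stands for the
    coefficients beyond the branch point. *)
Definition shift_sum (a : nat -> rat) (top : rat) m : rat :=
  (if m is m'.+1 then a m' else 0) + (if m == n then top else a m.+1).

Lemma shift_sum_n a t : shift_sum a t n = a n.-1 + t.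
Proof. by rewrite /shift_sum eqxx. Qed.
Lemma shift_sum_0 a t : shift_sum a t 0 = a 1%N.
Proof. by rewrite /shift_sum add0r. Qed.
Lemma shift_sum_S a t m : (m.+1 < n)%N -> shift_sum a t m.+1 = a m + a m.+2.
Proof. by rewrite /shift_sum; case: eqP => // ->; rewrite ltnn. Qed.

Lemma shift_sumP (a a' : nat -> rat) t :
  a 1%N = a' 0%N -> (forall m, (m.+1 < n)%N -> a m + a m.+2 = a' m.+1) ->
  a n.-1 + t = a' n -> forall m, (m <= n)%N -> shift_sum a t m = a' m.
Proof.
move=> H0 HS Hn m; rewrite leq_eqVlt => /orP[/eqP ->|].
  by rewrite shift_sum_n.
by case: m => [|m] mn; rewrite ?shift_sum_0 // shift_sum_S // HS.
Qed.

Lemma onN_D a b1 b2 b3 c1 c2 c3 : onN a b1 b2 b3 c1 c2 c3 *m Dl =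
  onN (shift_sum a (b1 + c1)) (a n + b2) (b1 + b3) b2 (a n + c2) (c1 + c3) c2.
Proof.
apply: crdP => x; rewrite crd_Dl; case: (vertexP x) => [m mn||||||| m mn||||].
2-7: by rewrite /= ?big_cons big_nil ?onN_E ?onN_al ?addr0.
3-6: by rewrite /= ?big_cons big_nil ?onN_E ?onN_pl ?addr0.
- rewrite nbs_al // big_cat onN_al //=; congr (_ + _).
    case: m mn => [|m] mn; rewrite ?big_nil ?big_seq1 //=.
    by rewrite onN_al // ltnW.
  case: eqP => mE; rewrite ?big_cons big_nil ?onN_E ?addr0 // onN_al //; lia.
- rewrite nbs_pl // onN_pl big1_seq // => y /andP[_].
  rewrite mem_cat => /orP[]; case: ifP => _; rewrite ?inE //.
  - by move=> /eqP ->; rewrite onN_pl.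
  - by case/orP => /eqP ->; rewrite onN_E.
  - by move=> /eqP ->; rewrite onN_pl.
Qed.

Lemma onM_D a f g b c : onM a f g b c *m Dl =
  onM (shift_sum a (f + g)) (a n) (a n + (b + c)) g g.
Proof.
apply: crdP => x; rewrite crd_Dl; case: (vertexP x) => [m mn||||||| m mn||||].
2-7: by rewrite /= ?big_cons big_nil ?onM_E ?onM_al ?addr0.
3-6: by rewrite /= ?big_cons big_nil ?onM_E ?onM_pl ?addr0.
- rewrite nbs_al // onM_al big1_seq // => y /andP[_].
  rewrite mem_cat => /orP[]; case: ifP => _; rewrite ?inE //.
  - by move=> /eqP ->; rewrite onM_al.
  - by case/orP => /eqP ->; rewrite onM_E.
  - by move=> /eqP ->; rewrite onM_al.
- rewrite nbs_pl // big_cat onM_pl //=; congr (_ + _).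
    case: m mn => [|m] mn; rewrite ?big_nil ?big_seq1 //=.
    by rewrite onM_pl // ltnW.
  case: eqP => mE; rewrite ?big_cons big_nil ?onM_E ?addr0 // onM_pl //; lia.
Qed.

Lemma ve_D : ve *m Dl = ve2.
Proof. by rewrite ve.unlock ve2.unlock mulmxBl !bvDE. Qed.
Lemma vd_D : vd *m Dl = ve2.
Proof. by rewrite vd.unlock mulmxBl !bvDE ve2.unlock; vring. Qed.
Lemma ve2_D : ve2 *m Dl = vsum.
Proof. by rewrite ve2.unlock mulmxBl !bvDE vsum.unlock ve.unlock vd.unlock; vring. Qed.
Lemma ve_J : ve *m J = - ve.
Proof. by rewrite ve.unlock mulmxBl !bv_J !barE; vring. Qed.
Lemma vd_J : vd *m J = vd.
Proof. by rewrite vd.unlock mulmxBl !bv_J !barE. Qed.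
Lemma vsum_D : vsum *m Dl = 2 *: ve2.
Proof. by rewrite vsum.unlock mulmxDl ve_D vd_D; vring. Qed.
Lemma vdif_D : vdif *m Dl = 0.
Proof. by rewrite vdif.unlock mulmxBl ve_D vd_D subrr. Qed.
Lemma vsum_J : vsum *m J = - vdif.
Proof. by rewrite vsum.unlock mulmxDl ve_J vd_J vdif.unlock; vring. Qed.
Lemma vdif_J : vdif *m J = - vsum.
Proof. by rewrite vdif.unlock mulmxBl ve_J vd_J vsum.unlock; vring. Qed.

Lemma X0_D : X0 *m Dl = 0.
Proof.
rewrite X0.unlock onN_D osc4_n; transitivity (onN (fun _ => 0) 0 0 0 0 0 0); last first.
  by apply: crdP => x; case: (vertexP x) => *; rewrite ?onN_al ?onN_pl ?onN_E ?crd0.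
apply: eq_onN; try by ring.
apply: shift_sumP => // [m _|]; last by rewrite osc4_n1; field.
by rewrite osc4SS subrr.
Qed.

Lemma X2_DE : X2 *m Dl =
  onN (fun i => if odd i then osc8 i else 0) 0 (- osc8 n.-1) 0 0 (- osc8 n.-1) 0.
Proof.
rewrite X2.unlock onN_D; cbv beta; rewrite odd_nk.
apply: eq_onN; try by field.
apply: shift_sumP => // [m _|]; last by rewrite odd_nk odd_predn osc8_n; field.
  by rewrite /= negbK; case: ifP => om; rewrite ?addr0 // osc8_sum om mul1r.

Qed.

Lemma X2_DD : X2 *m Dl *m Dl = 2 *: X2.
Proof.
rewrite X2_DE onN_D; cbv beta; rewrite odd_nk osc8_n.
transitivity (let t := - osc8 n.-1 in
  onN (fun i => if odd i then 0 else 2 * osc8 i) t 0 t t 0 t).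
  apply: eq_onN; try by ring.
  apply: shift_sumP => // [m _|]; last by rewrite odd_nk odd_predn addr0.
  by rewrite /= negbK; case: ifP => om; rewrite ?addr0 // osc8_sum om.
rewrite X2.unlock; apply: crdP => x; rewrite crdZ.
case: (vertexP x) => *; rewrite ?onN_al ?onN_pl ?onN_E //; try by field.
by case: ifP; rewrite ?mulr0.
Qed.

Lemma onN_J (a : nat -> rat) b1 b3 c1 c3 : (forall i, odd i -> a i = 0) ->
  onN a b1 0 b3 c1 0 c3 *m J = onN a b1 0 c3 c1 0 b3.
Proof.
move=> a0; apply: crdP => x; rewrite crd_J; case: (vertexP x) => [m mn||||||| m mn||||];
  rewrite ?barE ?onN_E // ?bar_al ?bar_pl //.
- by case: ifP => om; rewrite ?onN_al ?onN_pl // a0.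
- by case: ifP => om; rewrite ?onN_al ?onN_pl // a0.
Qed.

Lemma X0_J : X0 *m J = X0.
Proof. by rewrite X0.unlock onN_J // => i; apply: osc4_odd. Qed.
Lemma X2_J : X2 *m J = X2.
Proof. by rewrite X2.unlock onN_J // => i ->. Qed.

(** * The product with the difference of the two tips *)

Lemma crd_Pi v b x : crd (v *m Pi b) x = if rgt x == b then crd v x else 0.
Proof.
rewrite Pi.unlock crd_mulopf (bigD1 x) //= eqxx big1 ?addr0.
  by case: eqP => _; rewrite ?mulr1 ?mulr0.
by move=> y /negPf ->; rewrite mulr0.
Qed.

Lemma crd_Lam v b x : crd (v *m Lam b) x = if lft x == b then crd v x else 0.
Proof.
rewrite Lam.unlock crd_mulopf (bigD1 x) //= eqxx big1 ?addr0.
  by case: eqP => _; rewrite ?mulr1 ?mulr0.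
by move=> y /negPf ->; rewrite mulr0.
Qed.

Lemma bv_Pi x b : bv x *m Pi b = if rgt x == b then bv x else 0.
Proof.
apply: crdP => y; rewrite crd_Pi crd_bv; case: (y =P x) => [->|yx].
  by case: ifP => _; rewrite ?crd_bv ?eqxx ?crd0.
by case: ifP => _; case: ifP => _; rewrite ?crd_bv ?crd0 //; case: eqP.
Qed.

Lemma bv_Lam x b : bv x *m Lam b = if lft x == b then bv x else 0.
Proof.
apply: crdP => y; rewrite crd_Lam crd_bv; case: (y =P x) => [->|yx].
  by case: ifP => _; rewrite ?crd_bv ?eqxx ?crd0.
by case: ifP => _; case: ifP => _; rewrite ?crd_bv ?crd0 //; case: eqP.
Qed.

Lemma Pi_tr b : (Pi b)^T = Pi b.
Proof.
rewrite Pi.unlock opf.unlock; apply/matrixP => i j; rewrite !mxE eq_sym.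
by case: eqP => // ->.
Qed.

Lemma Lam_tr b : (Lam b)^T = Lam b.
Proof.
rewrite Lam.unlock opf.unlock; apply/matrixP => i j; rewrite !mxE eq_sym.
by case: eqP => // ->.
Qed.

Lemma rgt_bar (x : vertex) : rgt (bar x) = lft x.
Proof. by case: x => [[i||||||]|[i||||]] //=; case: ifP => //= ->. Qed.
Lemma lft_bar (x : vertex) : lft (bar x) = rgt x.
Proof. by rewrite -rgt_bar barK. Qed.

Lemma J_Pi b : J *m Pi b *m J = Lam b.
Proof.
apply: mx_bvP => x; rewrite !mulmxA bv_J bv_Pi bv_Lam rgt_bar.
by case: ifP => _; rewrite ?mul0mx // bv_J barK.
Qed.
Lemma J_Lam b : J *m Lam b *m J = Pi b.
Proof. by rewrite -J_Pi !mulmxA JK mul1mx mulJK. Qed.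

Lemma adjv_rgt x y : adjv x y -> rgt (y : vertex) = ~~ rgt (x : vertex).
Proof.
by case: x y => [u|u] [v|v] //= => [/adj_odd_vertex|/adj'_odd_vertex'] ->.
Qed.
Lemma adjv_lft x y : adjv x y -> lft (y : vertex) = lft (x : vertex).
Proof. by case: x y => [u|u] [v|v]. Qed.

Lemma Pi_Dl b : Pi b *m Dl = Dl *m Pi (~~ b).
Proof.
apply: mx_bvP => x; rewrite !mulmxA bv_Pi; apply: crdP => y; rewrite crd_Pi.
have yx : crd (bv x *m Dl) y != 0 -> rgt y = ~~ rgt x.
  rewrite bv_mulE Dl.unlock opf.unlock mxE !enum_rankK.
  by case: (boolP (adjv x y)) => [/adjv_rgt|] //; rewrite eqxx.
case: (eqVneq (crd (bv x *m Dl) y) 0) => [xy0|/yx ->].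
  by rewrite xy0 if_same; case: ifP => [_|]; rewrite ?mul0mx ?crd0.
by rewrite (inj_eq negb_inj); case: ifP => _; rewrite ?mul0mx ?crd0.
Qed.

Lemma Lam_Dl b : comm_mx (Lam b) Dl.
Proof.
apply: mx_bvP => x; rewrite !mulmxA bv_Lam; apply: crdP => y; rewrite crd_Lam.
have yx : crd (bv x *m Dl) y != 0 -> lft y = lft x.
  rewrite bv_mulE Dl.unlock opf.unlock mxE !enum_rankK.
  by case: (boolP (adjv x y)) => [/adjv_lft|] //; rewrite eqxx.
case: (eqVneq (crd (bv x *m Dl) y) 0) => [xy0|/yx ->].
  by rewrite xy0 if_same; case: ifP => [_|]; rewrite ?mul0mx ?crd0.
by case: ifP => _; rewrite ?mul0mx ?crd0.
Qed.

Lemma Pi_Pi b c : Pi b *m Pi c = if b == c then Pi b else 0.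
Proof.
apply: mx_bvP => x; rewrite mulmxA bv_Pi.
case: (eqVneq b c) => [<-|bc]; case: (eqVneq (rgt x) b) => rx.
- by [].
- by rewrite mul0mx bv_Pi (negPf rx).
- by rewrite mulmx0 bv_Pi rx (negPf bc).
- by rewrite mul0mx mulmx0.
Qed.

Lemma Pi_cheb b m : Pi b *m U m = U m *m Pi (b (+) odd m).
Proof.
elim/ltn_ind: m => -[|[|m]] IH.
- by rewrite cheb0 mulmx1 mul1mx addbF.
- by rewrite cheb1 Pi_Dl addbT.
rewrite chebSS mulmxBr mulmxA (IH m.+1) // (IH m (leqW (ltnSn _))).
rewrite -mulmxA Pi_Dl mulmxBl !mulmxA.
have -> : ~~ (b (+) odd m.+1) = b (+) odd m by rewrite /=; case: (b); case: odd.
by rewrite /= negbK.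
Qed.

(** Hence [alpha_m] is [alpha_0 U_m], as long as the branch point has not been
    passed. *)
Lemma aseq_U P m : (m <= n.+1)%N -> bv (if P then al 0 else pl 0) *m U m = aseq P m.+1.
Proof.
elim/ltn_ind: m => -[|[|m]] IH mn.
- by rewrite cheb0 mulmx1 aseq_bv.
- by rewrite cheb1 -aseq_bv // aseq_D // aseq0 add0r.
rewrite chebSS mulmxBr mulmxA (IH m.+1) //; last by lia.
rewrite (IH m) //; try lia; rewrite aseq_D; last by lia.
by rewrite addrC addKr.
Qed.

Lemma one_U m : (m <= n)%N -> bv (al 0) *m U m = bv (al m).
Proof. by move=> mn; rewrite (@aseq_U true) ?aseq_bv // leqW. Qed.
Lemma one'_U m : (m <= n)%N -> bv (pl 0) *m U m = bv (pl m).
Proof. by move=> mn; rewrite (@aseq_U false) ?aseq_bv // leqW. Qed.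
Lemma one_Un1 : bv (al 0) *m U n.+1 = bv vb1 + bv vc1.
Proof. by rewrite (@aseq_U true) // aseq_top. Qed.
Lemma one'_Un1 : bv (pl 0) *m U n.+1 = bv vF + bv vG.
Proof. by rewrite (@aseq_U false) // aseq_top. Qed.

Lemma one_Un2 : bv (al 0) *m U n.+2 = bv (al n) + bv vb2 + bv vc2.
Proof. by rewrite chebSS mulmxBr mulmxA one_Un1 one_U // mulmxDl !bvDE; vring. Qed.
Lemma one_Un3 : bv (al 0) *m U n.+3 =
  bv (al n.-1) + bv vb1 + bv vc1 + bv vb3 + bv vc3.
Proof.
by rewrite chebSS mulmxBr mulmxA one_Un2 one_Un1 // !mulmxDl !bvDE; vring.
Qed.
Lemma one_S3 : bv (al 0) *m S3 = bv vb3 + bv vc3.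
Proof.
rewrite S3.unlock !mulmxBr one_Un3 one_Un1 one_U ?leq_pred //; vring.
Qed.

Lemma S3_tr : S3^T = S3.
Proof. by rewrite S3.unlock !linearB /= !cheb_tr // Dl_tr. Qed.
Lemma comm_S3 M : comm_mx M Dl -> comm_mx M S3.
Proof.
move=> MD; rewrite S3.unlock; apply: comm_mxB; last exact: comm_cheb.
by apply: comm_mxB; exact: comm_cheb.
Qed.
Lemma Pi_S3 b : comm_mx (Pi b) S3.
Proof.
have o1 : odd n.+1 = false by rewrite oddS odd_nk.
have o3 : odd n.+3 = false by rewrite 3!oddS odd_nk.
by rewrite /comm_mx S3.unlock !mulmxBr !mulmxBl !Pi_cheb o1 o3 odd_predn !addbF.
Qed.

Lemma Rdif_tr : Rdif^T = - Rdif.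
Proof. by rewrite Rdif.unlock linearZ /= !linearD /= !wedge_tr !scalerN -!opprD. Qed.

Lemma mul_Rdif v : v *m Rdif = (1/2) *:
  (dot v X0 *: vsum - dot v vsum *: X0 + (dot v X2 *: vdif - dot v vdif *: X2)
   + (dot v (ve2 *m J) *: (X2 *m Dl *m J) - dot v (X2 *m Dl *m J) *: (ve2 *m J))).
Proof. by rewrite Rdif.unlock -scalemxAr !mulmxDr !mul_wedge. Qed.

Lemma wedge_mulr (u v : 'rV_#|vertex|) (M : 'M_#|vertex|) :
  M^T = M -> wedge u v *m M = tens u (v *m M) - tens v (u *m M).
Proof. by move=> MT; rewrite wedge.unlock mulmxBl !tens_mulr. Qed.
Lemma wedge_mull (u v : 'rV_#|vertex|) (M : 'M_#|vertex|) :
  M^T = M -> M *m wedge u v = tens (u *m M) v - tens (v *m M) u.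
Proof. by move=> MT; rewrite wedge.unlock mulmxBr !tens_mull MT. Qed.

Lemma X0_G : X0 *m Gl = 0.
Proof. by rewrite Gl.unlock !mulmxA X0_J X0_D mul0mx. Qed.
Lemma vsum_G : vsum *m Gl = 0.
Proof. by rewrite Gl.unlock !mulmxA vsum_J mulNmx vdif_D oppr0 mul0mx. Qed.
Lemma X2_G : X2 *m Gl = X2 *m Dl *m J.
Proof. by rewrite Gl.unlock !mulmxA X2_J. Qed.
Lemma vdif_G : vdif *m Gl = - 2 *: (ve2 *m J).
Proof. by rewrite Gl.unlock !mulmxA vdif_J !mulNmx vsum_D -scalemxAl scaleNr. Qed.
Lemma ve2J_G : ve2 *m J *m Gl = - vdif.
Proof. by rewrite Gl.unlock !mulmxA mulJK ve2_D vsum_J. Qed.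
Lemma X2DJ_G : X2 *m Dl *m J *m Gl = 2 *: X2.
Proof. by rewrite Gl.unlock !mulmxA mulJK X2_DD -scalemxAl X2_J. Qed.

(** [J Delta J] annihilates [X0] and [vsum] and exchanges, up to factors, [X2] with
    [X2 Delta J] and [vdif] with [ve2 J], so that multiplication on either side of
    [Rdif] produces the same tensors. *)
Lemma Gl_Rdif : comm_mx Gl Rdif.
Proof.
rewrite /comm_mx Rdif.unlock -scalemxAr -scalemxAl; congr (_ *: _).
rewrite !mulmxDl !mulmxDr !wedge_mull ?wedge_mulr ?Gl_tr //.
rewrite X0_G vsum_G X2_G vdif_G ve2J_G X2DJ_G.
rewrite !(tensZl, tensZr, tensNl, tensNr, tens0l, tens0r).
mring.
Qed.

Lemma ve2J_D : ve2 *m J *m Dl = 0.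
Proof. by rewrite ve2.unlock mulmxBl !bv_J !barE mulmxBl !bvDE subrr. Qed.

Lemma X2DJ_DD : X2 *m Dl *m J *m Dl *m Dl = 2 *: (X2 *m Dl *m J).
Proof.
by rewrite -X2_G -!mulmxA (mulmxA Gl) Gl_Dl -(mulmxA Dl) Gl_Dl !mulmxA X2_DD -scalemxAl.
Qed.

(** One factor of each of the three wedges lies in the kernel of the adjacency
    matrix: [X0], [vdif] and [ve2 J]. *)
Lemma Dl_Rdif_Dl : Dl *m Rdif *m Dl = 0.
Proof.
rewrite Rdif.unlock -scalemxAr -scalemxAl !mulmxDr !mulmxDl !wedge_mull ?Dl_tr //.
by rewrite !mulmxBl !tens_mulr X0_D vdif_D ve2J_D !(tens0l, tens0r) !(subr0, addr0) scaler0.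
Qed.

(** In each wedge one factor has eigenvalue 0 and the other eigenvalue 2 under
    [Delta^2], so that [Rdif] exchanges the two eigenspaces and [U_2 = Delta^2 - 1]
    acts on them by opposite signs. *)
Lemma Rdif_U2 : Rdif *m U 2 = - (U 2 *m Rdif).
Proof.
have U2E : U 2 = Dl *m Dl - 1%:M by rewrite chebSS cheb1 cheb0.
have DD : (Dl *m Dl)^T = Dl *m Dl by rewrite trmx_mul Dl_tr.
suff : Rdif *m (Dl *m Dl) + (Dl *m Dl) *m Rdif = 2 *: Rdif.
  rewrite U2E mulmxBr mulmxBl mulmx1 mul1mx => DRD.
  have -> : Rdif *m (Dl *m Dl) = 2 *: Rdif - Dl *m Dl *m Rdif.
    by rewrite -DRD addrK.
  mring.
rewrite Rdif.unlock -!scalemxAr -!scalemxAl !mulmxDr !mulmxDl.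
rewrite !wedge_mull ?wedge_mulr //.
rewrite !mulmxA X0_D vsum_D vdif_D ve2J_D X2_DD X2DJ_DD -scalemxAl ve2_D !mul0mx.
rewrite wedge.unlock !(tensZl, tensZr, tensNl, tensNr, tens0l, tens0r).
mring.
Qed.

(** * Left and right products with the difference commute *)

Lemma dot_J u v : dot (u *m J) (v *m J) = dot u v.
Proof. by rewrite dot_adj J_tr mulJK. Qed.

Lemma dot_D u v : dot (u *m Dl) v = dot u (v *m Dl).
Proof. by rewrite dot_adj Dl_tr. Qed.

Lemma vsum_DD : vsum *m Dl *m Dl = 2 *: vsum.
Proof. by rewrite vsum_D -scalemxAl ve2_D. Qed.

Lemma dot_ker_eig2 u v : u *m Dl = 0 -> v *m Dl *m Dl = 2 *: v -> dot u v = 0.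
Proof.
move=> u0 v2; have : dot u (2 *: v) = 0.
  by rewrite -v2 -!dot_D u0 mul0mx dot0l.
by rewrite dotZr; lra.
Qed.

Lemma dot_X0_X2 : dot X0 X2 = 0.
Proof. exact: dot_ker_eig2 X0_D X2_DD. Qed.
Lemma dot_X0_vsum : dot X0 vsum = 0.
Proof. exact: dot_ker_eig2 X0_D vsum_DD. Qed.
Lemma dot_vdif_X2 : dot vdif X2 = 0.
Proof. exact: dot_ker_eig2 vdif_D X2_DD. Qed.
Lemma dot_vdif_vsum : dot vdif vsum = 0.
Proof. exact: dot_ker_eig2 vdif_D vsum_DD. Qed.

(** The eigenvalues agree here and in the next lemma; the vectors are orthogonal
    because only one of them changes sign when beta and gamma are exchanged. *)
Lemma dot_X0_vdif : dot X0 vdif = 0.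
Proof.
rewrite vdif.unlock ve.unlock vd.unlock !dotLE !dot_bv X0.unlock !onN_E; lra.
Qed.
Lemma dot_X2_vsum : dot X2 vsum = 0.
Proof.
rewrite vsum.unlock ve.unlock vd.unlock !dotLE !dot_bv X2.unlock !onN_E; lra.
Qed.

Lemma dot_vdif_vdif : dot vdif vdif = dot vsum vsum.
Proof. by rewrite -(dot_J vsum) vsum_J dotNl dotNr opprK. Qed.

(** The entries of both vectors on the even vertices of the long path are signs,
    and those at the four even vertices beyond it are signs divided by two. *)
Lemma dot_X2_X2 : dot X2 X2 = dot X0 X0.
Proof.
rewrite !dotE; apply: eq_bigr => x _; rewrite -!expr2.
have t2 : osc8 n.-1 ^+ 2 = 1 by rewrite sqr_osc8 // odd_predn.
rewrite X0.unlock X2.unlock.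
case: (vertexP x) => [m mn||||||| m mn||||]; rewrite ?onN_pl ?onN_E //.
2-5: by rewrite ?expr_div_n ?sqrrN t2; field.
rewrite !onN_al //; case: ifP => om; first by rewrite osc4_odd.
by rewrite sqr_osc4 ?sqr_osc8 ?om.
Qed.

Lemma dot_Lam u v : u *m Lam true = u -> v *m Lam false = v -> dot u v = 0.
Proof.
move=> <- <-; apply: dot_eq0 => x; rewrite !crd_Lam.
by case: (lft x); rewrite ?mulr0 ?mul0r.
Qed.
Lemma dot_Pi u v : u *m Pi true = u -> v *m Pi false = v -> dot u v = 0.
Proof.
move=> <- <-; apply: dot_eq0 => x; rewrite !crd_Pi.
by case: (rgt x); rewrite ?mulr0 ?mul0r.
Qed.

Lemma rgt_al m : (m <= n)%N -> rgt (al m) = ~~ odd m.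
Proof. by move=> mn; rewrite /= inordK. Qed.
Lemma rgt_pl m : (m <= n)%N -> rgt (pl m) = odd m.
Proof. by move=> mn; rewrite /= inordK. Qed.

Lemma Pi_id (v : 'rV_#|vertex|) b :
  (forall x, rgt x = ~~ b -> crd v x = 0) -> v *m Pi b = v.
Proof.
move=> v0; apply: crdP => x; rewrite crd_Pi; case: eqP => // /eqP rx.
by rewrite v0 //; case: (rgt x) b rx {v0} => [] [].
Qed.
Lemma Lam_id (v : 'rV_#|vertex|) b :
  (forall x, lft x = ~~ b -> crd v x = 0) -> v *m Lam b = v.
Proof.
move=> v0; apply: crdP => x; rewrite crd_Lam; case: eqP => // /eqP rx.
by rewrite v0 //; case: (lft x) b rx {v0} => [] [].
Qed.

Lemma X0_Lam : X0 *m Lam true = X0.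
Proof. by apply: Lam_id => -[] // u _; rewrite X0.unlock crd_rowf. Qed.
Lemma X2_Lam : X2 *m Lam true = X2.
Proof. by apply: Lam_id => -[] // u _; rewrite X2.unlock crd_rowf. Qed.
Lemma X0_Pi : X0 *m Pi true = X0.
Proof.
apply: Pi_id => x; rewrite X0.unlock.
case: (vertexP x) => [m mn||||||| m mn||||] //; rewrite ?onN_pl ?onN_E //.
by rewrite rgt_al // onN_al // => /negbFE /osc4_odd.
Qed.
Lemma X2_Pi : X2 *m Pi true = X2.
Proof.
apply: Pi_id => x; rewrite X2.unlock.
case: (vertexP x) => [m mn||||||| m mn||||] //; rewrite ?onN_pl ?onN_E //.
by rewrite rgt_al // onN_al // => /negbFE ->.
Qed.
Lemma ve_Pi : ve *m Pi true = ve.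
Proof. by rewrite ve.unlock mulmxBl !bv_Pi. Qed.
Lemma vd_Pi : vd *m Pi true = vd.
Proof. by rewrite vd.unlock mulmxBl !bv_Pi. Qed.
Lemma ve2_Pi : ve2 *m Pi false = ve2.
Proof. by rewrite ve2.unlock mulmxBl !bv_Pi. Qed.
Lemma ve_Lam : ve *m Lam true = ve.
Proof. by rewrite ve.unlock mulmxBl !bv_Lam. Qed.
Lemma vd_Lam : vd *m Lam true = vd.
Proof. by rewrite vd.unlock mulmxBl !bv_Lam. Qed.
Lemma ve2_Lam : ve2 *m Lam true = ve2.
Proof. by rewrite ve2.unlock mulmxBl !bv_Lam. Qed.
Lemma vsum_Pi : vsum *m Pi true = vsum.
Proof. by rewrite vsum.unlock mulmxDl ve_Pi vd_Pi. Qed.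
Lemma vdif_Pi : vdif *m Pi true = vdif.
Proof. by rewrite vdif.unlock mulmxBl ve_Pi vd_Pi. Qed.
Lemma vsum_Lam : vsum *m Lam true = vsum.
Proof. by rewrite vsum.unlock mulmxDl ve_Lam vd_Lam. Qed.
Lemma vdif_Lam : vdif *m Lam true = vdif.
Proof. by rewrite vdif.unlock mulmxBl ve_Lam vd_Lam. Qed.
Lemma X2D_Pi : X2 *m Dl *m Pi false = X2 *m Dl.
Proof. by rewrite -mulmxA -(Pi_Dl true) mulmxA X2_Pi. Qed.
Lemma X2D_Lam : X2 *m Dl *m Lam true = X2 *m Dl.
Proof. by rewrite -mulmxA -Lam_Dl mulmxA X2_Lam. Qed.

Lemma J_Pi' b : J *m Pi b = Lam b *m J.
Proof. by rewrite -J_Pi mulJK. Qed.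
Lemma J_Lam' b : J *m Lam b = Pi b *m J.
Proof. by rewrite -J_Lam mulJK. Qed.

Lemma ve2J_Pi : ve2 *m J *m Pi true = ve2 *m J.
Proof. by rewrite -mulmxA J_Pi' mulmxA ve2_Lam. Qed.
Lemma ve2J_Lam : ve2 *m J *m Lam false = ve2 *m J.
Proof. by rewrite -mulmxA J_Lam' mulmxA ve2_Pi. Qed.
Lemma X2DJ_Pi : X2 *m Dl *m J *m Pi true = X2 *m Dl *m J.
Proof. by rewrite -(mulmxA (X2 *m Dl)) J_Pi' mulmxA X2D_Lam. Qed.
Lemma X2DJ_Lam : X2 *m Dl *m J *m Lam false = X2 *m Dl *m J.
Proof. by rewrite -(mulmxA (X2 *m Dl)) J_Lam' mulmxA X2D_Pi. Qed.

Lemma Rdif_Pi : Rdif *m Pi true = Rdif.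
Proof.
rewrite Rdif.unlock -scalemxAl !mulmxDl !wedge_mulr ?Pi_tr //.
by rewrite X0_Pi vsum_Pi X2_Pi vdif_Pi ve2J_Pi X2DJ_Pi wedge.unlock.
Qed.
Lemma Pi_Rdif : Pi true *m Rdif = Rdif.
Proof. by rewrite -[LHS]trmxK trmx_mul Rdif_tr Pi_tr mulNmx Rdif_Pi linearN /= Rdif_tr opprK. Qed.

Lemma wedge_Lam (u v : 'rV_#|vertex|) b : u *m Lam b = u -> v *m Lam b = v ->
  forall c, comm_mx (Lam c) (wedge u v).
Proof.
move=> ub vb c; rewrite /comm_mx wedge_mull ?wedge_mulr ?Lam_tr //.
have LL (w : 'rV_#|vertex|) : w *m Lam b = w -> w *m Lam c = if c == b then w else 0.
  move=> wb; case: (eqVneq c b) => [->|cb]; first by [].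
  apply: crdP => x; rewrite crd0 crd_Lam -wb crd_Lam.
  by move: cb; case: (lft x); case: (c); case: (b).
rewrite (LL _ ub) (LL _ vb).
case: eqP => _; first by [].
by rewrite !tens0l !tens0r !subr0.
Qed.

Lemma Lam_Rdif b : comm_mx (Lam b) Rdif.
Proof.
rewrite Rdif.unlock /comm_mx -scalemxAr -scalemxAl; congr (_ *: _).
rewrite -/(comm_mx _ _); do 2?apply: comm_mxD.
- exact: wedge_Lam X0_Lam vsum_Lam b.
- exact: wedge_Lam X2_Lam vdif_Lam b.
- exact: wedge_Lam ve2J_Lam X2DJ_Lam b.
Qed.

Lemma tens_tens (u v w z : 'rV_#|vertex|) :
  tens u v *m tens w z = dot v w *: tens u z.
Proof. by rewrite tens_mulr mul_tens tensZr. Qed.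

Lemma wedge_wedge (u v w z : 'rV_#|vertex|) : wedge u v *m wedge w z =
  dot v w *: tens u z - dot v z *: tens u w - dot u w *: tens v z
  + dot u z *: tens v w.
Proof.
rewrite wedge.unlock mulmxBl !mulmxBr !tens_tens.
by rewrite opprB addrA addrAC.
Qed.

(** As [gamma_3 - beta_3] is the image of [e] under the involution, this is the
    left multiplication by [- e]. *)
Lemma J_Rdif_J : J *m Rdif *m J = (1/2) *:
  (- wedge X0 vdif - wedge X2 vsum + wedge ve2 (X2 *m Dl)).
Proof.
have Jw (u v : 'rV_#|vertex|) : J *m wedge u v *m J = wedge (u *m J) (v *m J).
  by rewrite wedge_mull ?J_tr // mulmxBl !tens_mulr wedge.unlock.
rewrite Rdif.unlock -scalemxAr -scalemxAl !mulmxDr !mulmxDl !Jw.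
rewrite X0_J X2_J vsum_J vdif_J !mulJK; congr (_ *: (_ + _ + _)).
  by rewrite wedge.unlock tensNl tensNr -opprB opprK addrC.
by rewrite wedge.unlock tensNl tensNr -opprB opprK addrC.
Qed.

(** Associativity of the products with [e] on both sides.  In the product of the two
    sums of wedges all scalar products vanish by labels, by eigenvalues or by
    inspection, except those of [X0], [X2], [vsum], [vdif] with themselves, and
    these agree in pairs. *)
Lemma J_Rdif_J_Rdif : comm_mx (J *m Rdif *m J) Rdif.
Proof.
rewrite /comm_mx J_Rdif_J Rdif.unlock -!scalemxAr -!scalemxAl; congr (_ *: (_ *: _)).
rewrite !(mulmxDl, mulmxDr, mulNmx, mulmxN) !wedge_wedge.
have be2N u : u *m Lam true = u -> dot u (ve2 *m J) = 0.
  by move=> uL; apply: dot_Lam uL ve2J_Lam.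
have bYN u : u *m Lam true = u -> dot u (X2 *m Dl *m J) = 0.
  by move=> uL; apply: dot_Lam uL X2DJ_Lam.
have e2N u : u *m Pi true = u -> dot u ve2 = 0.
  by move=> uL; apply: dot_Pi uL ve2_Pi.
have YN u : u *m Pi true = u -> dot u (X2 *m Dl) = 0.
  by move=> uL; apply: dot_Pi uL X2D_Pi.
rewrite !(dotC (ve2 *m J)) !(dotC (X2 *m Dl *m J)) !(dotC ve2) !(dotC (X2 *m Dl)).
rewrite !be2N ?(X0_Lam, X2_Lam, vsum_Lam, vdif_Lam, ve2_Lam, X2D_Lam) //.
rewrite !bYN ?(X0_Lam, X2_Lam, vsum_Lam, vdif_Lam, ve2_Lam, X2D_Lam) //.
rewrite !e2N ?(X0_Pi, X2_Pi, vsum_Pi, vdif_Pi, ve2J_Pi, X2DJ_Pi) //.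
rewrite !YN ?(X0_Pi, X2_Pi, vsum_Pi, vdif_Pi, ve2J_Pi, X2DJ_Pi) //.
rewrite (dotC X2 X0) (dotC vsum vdif) (dotC vsum X0).
rewrite (dotC X2 vdif) (dotC vdif X0) (dotC vsum X2).
rewrite dot_X0_X2 dot_X0_vsum dot_vdif_X2 dot_vdif_vsum dot_X0_vdif dot_X2_vsum.
rewrite dot_vdif_vdif dot_X2_X2 !scale0r.
mring.
Qed.

(** * Left and right multiplications *)

Lemma rmul_al m : (m <= n)%N -> rmul (al m) = Pi true *m U m.
Proof. by move=> mn; rewrite /= inordK. Qed.
Lemma rmul_pl m : (m <= n)%N -> rmul (pl m) = Pi false *m U m.
Proof. by move=> mn; rewrite /= inordK. Qed.
Lemma rmulE :
  ((rmul vb1 = Rb3 *m U 2) * (rmul vb2 = Rb3 *m Dl) * (rmul vb3 = Rb3) *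
   (rmul vc1 = Rc3 *m U 2) * (rmul vc2 = Rc3 *m Dl) * (rmul vc3 = Rc3) *
   (rmul vF = Pi false *m U n.+1 - Dl *m Rb3 *m Dl) *
   (rmul vG = Dl *m Rb3 *m Dl) * (rmul vbb = Dl *m Rc3) * (rmul vbc = Dl *m Rb3))%type.
Proof. by []. Qed.

Lemma Rb3E : Rb3 = (1/2) *: (Pi true *m S3) + (1/2) *: Rdif.
Proof. by rewrite Rb3.unlock mulmxDr Pi_Rdif scalerDr. Qed.
Lemma Rc3E : Rc3 = (1/2) *: (Pi true *m S3) - (1/2) *: Rdif.
Proof. by rewrite Rc3.unlock mulmxBr Pi_Rdif scalerBr. Qed.

Lemma Rb3_tr : Rb3^T = Rc3.
Proof.
by rewrite Rb3E Rc3E linearD !linearZ /= trmx_mul Rdif_tr S3_tr Pi_tr scalerN -Pi_S3.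
Qed.
Lemma Rc3_tr : Rc3^T = Rb3.
Proof. by rewrite -Rb3_tr trmxK. Qed.

Lemma Pi_U b m : (Pi b *m U m)^T = Pi (b (+) odd m) *m U m.
Proof.
rewrite trmx_mul cheb_tr ?Dl_tr // Pi_tr Pi_cheb -addbA addbb addbF; exact: erefl.
Qed.

Lemma Dl_Rb3_Dl : Dl *m Rb3 *m Dl = Dl *m Rc3 *m Dl.
Proof.
rewrite Rb3E Rc3E !mulmxDr !mulmxDl mulmxN mulNmx -!scalemxAr -!scalemxAl.
by rewrite Dl_Rdif_Dl scaler0 subr0 addr0.
Qed.

Lemma U2_tr : (U 2)^T = U 2.
Proof. by rewrite cheb_tr ?Dl_tr. Qed.

Lemma Pi_U2 b : Pi b *m U 2 = U 2 *m Pi b.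
Proof. by rewrite Pi_cheb addbF. Qed.

Lemma S3_U2 : S3 *m U 2 = U 2 *m S3.
Proof. by apply/esym/comm_S3/comm_mx_sym/comm_cheb. Qed.

Lemma Rb3_U2 : Rb3 *m U 2 = U 2 *m Rc3.
Proof.
rewrite Rb3E Rc3E mulmxDl mulmxBr -!scalemxAl -!scalemxAr Rdif_U2 scalerN.
by rewrite -mulmxA S3_U2 mulmxA Pi_U2 -mulmxA.
Qed.
Lemma Rc3_U2 : Rc3 *m U 2 = U 2 *m Rb3.
Proof.
rewrite Rb3E Rc3E mulmxBl mulmxDr -!scalemxAl -!scalemxAr Rdif_U2 scalerN opprK.
by rewrite -mulmxA S3_U2 mulmxA Pi_U2 -mulmxA.
Qed.

Lemma rmul_tr x : (rmul x)^T = rmul (bar x).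
Proof.
case: (vertexP x) => [m mn||||||| m mn||||]; rewrite ?barE ?rmulE.
- rewrite rmul_al // Pi_U bar_al //.
  by case: ifP => om; rewrite ?rmul_pl ?rmul_al.
- by rewrite trmx_mul Rb3_tr U2_tr Rb3_U2.
- by rewrite trmx_mul Rb3_tr Dl_tr.
- exact: Rb3_tr.
- by rewrite trmx_mul Rc3_tr U2_tr Rc3_U2.
- by rewrite trmx_mul Rc3_tr Dl_tr.
- exact: Rc3_tr.
- rewrite rmul_pl // Pi_U bar_pl //.
  by case: ifP => om; rewrite ?rmul_pl ?rmul_al.
- rewrite linearB /= Pi_U oddS odd_nk addbF !trmx_mul Rb3_tr Dl_tr mulmxA.
  by rewrite Dl_Rb3_Dl.
- by rewrite !trmx_mul Rb3_tr Dl_tr mulmxA Dl_Rb3_Dl.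
- by rewrite trmx_mul Rc3_tr Dl_tr.
- by rewrite trmx_mul Rb3_tr Dl_tr.
Qed.

Lemma comm_Rb3 M : comm_mx M Dl -> comm_mx M Rdif -> comm_mx M (Pi true) ->
  comm_mx M Rb3 * comm_mx M Rc3.
Proof.
move=> MD MR MP; rewrite Rb3.unlock Rc3.unlock /comm_mx -!scalemxAr -!scalemxAl.
by split; congr (_ *: _); rewrite -/(comm_mx _ _); apply: comm_mxM => //;
  [apply: comm_mxD | apply: comm_mxB] => //; apply: comm_S3.
Qed.

(** All right multiplications are polynomials in [Dl], [Rdif] and the
    projections. *)
Lemma comm_rmul M : comm_mx M Dl -> comm_mx M Rdif ->
  (forall b, comm_mx M (Pi b)) -> forall x, comm_mx M (rmul x).
Proof.
move=> MD MR MP x; have [MH MHc] := comm_Rb3 MD MR (MP true).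
have MU m : comm_mx M (U m) by apply: comm_cheb.
have MDHD : comm_mx M (Dl *m Rb3 *m Dl) by do 2?apply: comm_mxM.
case: x => [[i||||||]|[i||||]] //=; try by apply: comm_mxM.
by apply: comm_mxB => //; apply: comm_mxM.
Qed.

Lemma comm_conj M N : comm_mx M (J *m N *m J) -> comm_mx (J *m M *m J) N.
Proof.
rewrite /comm_mx => MN; have := congr1 (fun A => J *m A *m J) MN.
by rewrite /= !mulmxA !mulJK JK mul1mx.
Qed.

Lemma Lam_Pi b c : comm_mx (Lam b) (Pi c).
Proof.
apply: mx_bvP => x; rewrite !mulmxA bv_Pi bv_Lam.
by case: ifP => lx; case: ifP => rx; rewrite ?mul0mx ?bv_Pi ?bv_Lam ?lx ?rx.
Qed.

Lemma Lam_rmul b x : comm_mx (Lam b) (rmul x).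
Proof.
apply: comm_rmul => [||c]; [exact: Lam_Dl | exact: Lam_Rdif | exact: Lam_Pi].
Qed.

Lemma J_Dl_J : J *m Dl *m J = Gl.
Proof. by rewrite Gl.unlock. Qed.

Lemma Gl_Pi b : comm_mx Gl (Pi b).
Proof.
by rewrite -J_Dl_J; apply: comm_conj; rewrite J_Pi; apply/comm_mx_sym/Lam_Dl.
Qed.

Lemma Gl_rmul x : comm_mx Gl (rmul x).
Proof. by apply: comm_rmul; [exact: Gl_Dl | exact: Gl_Rdif | exact: Gl_Pi]. Qed.

Lemma J_Rdif_J_rmul x : comm_mx (J *m Rdif *m J) (rmul x).
Proof.
apply: comm_rmul => [||b].
- by apply: comm_conj; rewrite J_Dl_J; apply/comm_mx_sym/Gl_Rdif.
- exact: J_Rdif_J_Rdif.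
- by apply: comm_conj; rewrite J_Pi; apply/comm_mx_sym/Lam_Rdif.
Qed.

(** Associativity.  By [comm_rmul] it is enough to commute a left multiplication
    with the generators of the right ones, and conjugation by [J] moves each of
    these to the left, where [comm_rmul] applies again. *)
Lemma lmul_rmul x y : comm_mx (lmul x) (rmul y).
Proof.
apply: comm_rmul => [||b]; apply: comm_conj; apply/comm_mx_sym.
- by rewrite J_Dl_J; apply: Gl_rmul.
- exact: J_Rdif_J_rmul.
- by rewrite J_Pi; apply: Lam_rmul.
Qed.

Lemma bar_unit b : bar (unit_of b) = unit_of b.
Proof. by case: b; rewrite /unit_of ?bar_al ?bar_pl. Qed.
Lemma rgt_unit b : rgt (unit_of b) = b.
Proof. by case: b; rewrite /= ?inordK. Qed.

(** Among the vectors that make up [Rdif], only [X0] and [X2] have a coefficient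
    at [alpha_0], and both coefficients are 1; so the value is
    [(vsum + vdif) / 2]. *)
Lemma one_Rdif : bv (al 0) *m Rdif = ve.
Proof.
have d0 v : dot (bv (al 0)) v = crd v (al 0) by rewrite dotC dot_bv.
rewrite mul_Rdif !d0.
have n3 : (0 < n)%N by [].
have z1 : crd vsum (al 0) = 0.
  by rewrite vsum.unlock ve.unlock vd.unlock !(crdD, crdN, crd_bv) !eqvE.
have z2 : crd vdif (al 0) = 0.
  by rewrite vdif.unlock ve.unlock vd.unlock !(crdD, crdN, crd_bv) !eqvE.
have z3 : crd (ve2 *m J) (al 0) = 0 by rewrite -ve2J_Lam crd_Lam.
have z4 : crd (X2 *m Dl *m J) (al 0) = 0 by rewrite -X2DJ_Lam crd_Lam.
have o1 : crd X0 (al 0) = 1 by rewrite X0.unlock onN_al.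
have o2 : crd X2 (al 0) = 1 by rewrite X2.unlock onN_al.
rewrite z1 z2 z3 z4 o1 o2 vsum.unlock vdif.unlock.
apply: crdP => y; by rewrite !(crdD, crdN, crdZ, crd0); field.
Qed.

Lemma one_Pi b : bv (unit_of b) *m Pi b = bv (unit_of b).
Proof. by rewrite bv_Pi rgt_unit eqxx. Qed.

Lemma one_Rb3 : bv (al 0) *m Rb3 = bv vb3.
Proof.
rewrite Rb3E mulmxDr -!scalemxAr mulmxA (one_Pi true) one_S3 one_Rdif ve.unlock.
apply: crdP => y; by rewrite !(crdD, crdN, crdZ, crd0); field.
Qed.
Lemma one_Rc3 : bv (al 0) *m Rc3 = bv vc3.
Proof.
rewrite Rc3E mulmxBr -!scalemxAr mulmxA (one_Pi true) one_S3 one_Rdif ve.unlock.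
apply: crdP => y; by rewrite !(crdD, crdN, crdZ, crd0); field.
Qed.

Lemma U2E : U 2 = Dl *m Dl - 1%:M.
Proof. by rewrite chebSS cheb1 cheb0. Qed.

Lemma b3_U2 : bv vb3 *m U 2 = bv vb1.
Proof. by rewrite U2E mulmxBr mulmxA !bvDE mulmx1; vring. Qed.
Lemma c3_U2 : bv vc3 *m U 2 = bv vc1.
Proof. by rewrite U2E mulmxBr mulmxA !bvDE mulmx1; vring. Qed.

Lemma one_G : bv (al 0) *m Gl = bv (pl 1).
Proof.
by rewrite Gl.unlock !mulmxA bv_J bar_al //= -(@aseq_bv true) // aseq_D //
  aseq0 add0r aseq_bv // bv_J bar_al.
Qed.

Lemma b3_G : bv vb3 *m Gl = bv vbc.
Proof. by rewrite Gl.unlock !mulmxA bv_J barE bvDE bv_J barE. Qed.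
Lemma c3_G : bv vc3 *m Gl = bv vbb.
Proof. by rewrite Gl.unlock !mulmxA bv_J barE bvDE bv_J barE. Qed.

Lemma one'_D : bv (pl 0) *m Dl = bv (pl 1).
Proof. by rewrite -(@aseq_bv false) // aseq_D // aseq0 add0r aseq_bv. Qed.

Lemma one_rmul x : bv (unit_of (lft x)) *m rmul x = bv x.
Proof.
have GH : comm_mx Gl Rb3 by apply: (Gl_rmul vb3).
have GHc : comm_mx Gl Rc3 by apply: (Gl_rmul vc3).
case: (vertexP x) => [m mn||||||| m mn||||]; rewrite ?rmulE.
- by rewrite rmul_al // mulmxA one_Pi /= one_U.
- by rewrite mulmxA one_Rb3 b3_U2.
- by rewrite mulmxA one_Rb3 bvDE.
- exact: one_Rb3.
- by rewrite mulmxA one_Rc3 c3_U2.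
- by rewrite mulmxA one_Rc3 bvDE.
- exact: one_Rc3.
- by rewrite rmul_pl // mulmxA one_Pi /= one'_U.
- rewrite mulmxBr !mulmxA one_Pi /= one'_Un1 one'_D -one_G -(mulmxA _ Gl) GH.
  by rewrite mulmxA one_Rb3 b3_G bvDE; vring.
- by rewrite !mulmxA /= one'_D -one_G -(mulmxA _ Gl) GH mulmxA one_Rb3 b3_G bvDE.
- by rewrite !mulmxA /= one'_D -one_G -(mulmxA _ Gl) GHc mulmxA one_Rc3 c3_G.
- by rewrite !mulmxA /= one'_D -one_G -(mulmxA _ Gl) GH mulmxA one_Rb3 b3_G.
Qed.

Lemma one_lmul x : bv (unit_of (rgt x)) *m lmul x = bv x.
Proof.
by rewrite /lmul !mulmxA bv_J bar_unit -lft_bar one_rmul bv_J barK.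
Qed.

(** The product of [x] and [y] is [1 L(x) R(y)], hence can be read off from
    either side because left and right multiplications commute. *)
Lemma mul_swap x y : rgt x = lft y -> bv x *m rmul y = bv y *m lmul x.
Proof.
move=> xy; rewrite -{1}(one_lmul x) xy -mulmxA lmul_rmul mulmxA.
by rewrite one_rmul.
Qed.

(** The involution is an anti-automorphism. *)
Lemma rmul_bar x y : rgt x = lft y ->
  bv x *m rmul y = bv (bar y) *m rmul (bar x) *m J.
Proof. by move/mul_swap => ->; rewrite /lmul !mulmxA bv_J. Qed.

Lemma rmul_Pil x : Pi (lft x) *m rmul x = rmul x.
Proof.
have PP b : Pi b *m Pi b = Pi b by rewrite Pi_Pi eqxx.
have PH : Pi true *m Rb3 = Rb3 by rewrite Rb3.unlock -scalemxAr mulmxA PP.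
have PHc : Pi true *m Rc3 = Rc3 by rewrite Rc3.unlock -scalemxAr mulmxA PP.
have PD : Pi false *m Dl = Dl *m Pi true by rewrite Pi_Dl.
case: (vertexP x) => [m mn||||||| m mn||||]; rewrite ?rmulE.
- by rewrite rmul_al // mulmxA PP.
- by rewrite /= mulmxA PH.
- by rewrite /= mulmxA PH.
- exact: PH.
- by rewrite /= mulmxA PHc.
- by rewrite /= mulmxA PHc.
- exact: PHc.
- by rewrite rmul_pl // mulmxA PP.
- by rewrite /= mulmxBr !mulmxA PP PD -(mulmxA Dl) PH.
- by rewrite /= !mulmxA PD -(mulmxA Dl) PH.
- by rewrite /= !mulmxA PD -(mulmxA Dl) PHc.
- by rewrite /= !mulmxA PD -(mulmxA Dl) PH.
Qed.

Lemma rmul_Pir x : rmul x *m Pi (rgt x) = rmul x.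
Proof.
rewrite -[LHS]trmxK trmx_mul Pi_tr rmul_tr -lft_bar rmul_Pil.
by rewrite rmul_tr barK.
Qed.

Lemma rmul_support x y z : crd (bv x *m rmul y) z != 0 ->
  [/\ rgt x = lft y, lft z = lft x & rgt z = rgt y].
Proof.
move=> xyz; split; apply/eqP; apply: contraNT xyz.
- by move=> xy; rewrite -rmul_Pil mulmxA bv_Pi (negPf xy) mul0mx crd0.
- move=> zx; have -> : bv x = bv x *m Lam (lft x) by rewrite bv_Lam eqxx.
  by rewrite -mulmxA Lam_rmul mulmxA crd_Lam (negPf zx).
- by move=> zy; rewrite -rmul_Pir mulmxA crd_Pi (negPf zy).
Qed.

(** * Tribonacci numbers *)

(** The coefficients of [beta_3 U_{2i}] at [beta_3] and at [gamma_3].  Each of the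
    two sequences continues with the sum of three terms of the other one. *)
Fixpoint htribo_pair (i : nat) : nat * nat :=
  match i with
  | 0 => (1, 0)
  | i1.+1 => match i1 with
    | 0 => (0, 0)
    | i2.+1 => match i2 with
      | 0 => (0, 0)
      | i3.+1 => ((htribo_pair i3).2 + (htribo_pair i2).2 + (htribo_pair i1).2,
                  (htribo_pair i3).1 + (htribo_pair i2).1 + (htribo_pair i1).1) end end
  end%N.
Definition htribo (s : bool) i := if s then (htribo_pair i).1 else (htribo_pair i).2.
#[global] Arguments htribo : simpl never.
Definition tribo i := (htribo true i + htribo false i)%N.

Lemma htriboSSS s i :
  htribo s i.+3 = (htribo (~~ s) i + htribo (~~ s) i.+1 + htribo (~~ s) i.+2)%N.
Proof. by case: s. Qed.
Lemma triboSSS i : tribo i.+3 = (tribo i + tribo i.+1 + tribo i.+2)%N.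
Proof. by rewrite /tribo !htriboSSS /=; lia. Qed.
Lemma htribo_sum s i : (htribo s i + htribo (~~ s) i = tribo i)%N.
Proof. by case: s; rewrite /tribo //= addnC. Qed.

(** The difference of the two sequences has period 4, with values 1, 0, 0, -1. *)
Lemma htribo_mod4 l :
  [/\ (htribo true (4 * l) = htribo false (4 * l) + 1)%N,
      htribo true (4 * l).+1 = htribo false (4 * l).+1,
      htribo true (4 * l).+2 = htribo false (4 * l).+2,
      ~~ odd (htribo false (4 * l)) & ~~ odd (htribo false (4 * l).+2)].
Proof.
have HP i : htribo true i.+3 = (htribo false i + htribo false i.+1 + htribo false i.+2)%N.
  exact: htriboSSS true i.
have HQ i : htribo false i.+3 = (htribo true i + htribo true i.+1 + htribo true i.+2)%N.
  exact: htriboSSS false i.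
elim: l => [|l [h0 h1 h2 o0 o2]] //.
rewrite mulnS; have -> : (4 + 4 * l = (4 * l).+4)%N by lia.
move: (4 * l)%N h0 h1 h2 o0 o2 => m.
move: (HP m) (HP m.+1) (HP m.+2) (HP m.+3) (HQ m) (HQ m.+1) (HQ m.+2) (HQ m.+3).
move: (htribo true) (htribo false) => P Q; split; lia.
Qed.

(** The previous lemma at the places that occur in [crd_S3], with the parity of [l] as
    the only case distinction. *)
Lemma htribo_double l :
  [/\ htribo false l.*2 = (htribo false l.*2)./2.*2,
      htribo true l.*2 = (htribo false l.*2 + ~~ odd l)%N
    & (htribo true l.*2.+1 + htribo true l.*2.+2 =
       htribo false l.*2.+1 + htribo false l.*2.+2)%N].
Proof.
have HP i : htribo true i.+3 = (htribo false i + htribo false i.+1 + htribo false i.+2)%N.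
  exact: htriboSSS true i.
have HQ i : htribo false i.+3 = (htribo true i + htribo true i.+1 + htribo true i.+2)%N.
  exact: htriboSSS false i.
have [h0 h1 h2 o0 o2] := htribo_mod4 l./2.
have -> : (l.*2 = (odd l).*2 + 4 * l./2)%N by lia.
move: (4 * l./2)%N h0 h1 h2 o0 o2 => m; case: (odd l); rewrite ?add2n ?add0n /=;
move: (HP m) (HP m.+1) (HQ m) (HQ m.+1);
move: (htribo true) (htribo false) => P Q; split; lia.
Qed.

Lemma tribo_mono i : (0 < i)%N -> (tribo i <= tribo i.+1)%N.
Proof. by case: i => // -[|[|i]] // _; rewrite [in X in (_ <= X)%N]triboSSS; lia. Qed.

(** The sequence [f] placed at the odd or at the even numbers: the coefficients of
    a wave vanish at every other time. *)
Definition spread (f : nat -> nat) (b : bool) (m : nat) :=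
  if odd m == b then f m./2 else 0%N.

Lemma spread_double f b j : spread f b j.*2 = if b then 0%N else f j.
Proof. by rewrite /spread odd_double doubleK; case: b. Qed.
Lemma spread_doubleS f b j : spread f b j.*2.+1 = if b then f j else 0%N.
Proof. by rewrite /spread /= odd_double uphalf_double; case: b. Qed.

Lemma double_ind_case m : (exists j, m = j.*2) \/ (exists j, m = j.*2.+1).
Proof.
rewrite -(odd_double_half m); case: (odd m); [right | left]; exists m./2 => //.
Qed.

(** The amplitudes at the last vertex of the long path of the waves that start at
    [beta_3] or [gamma_3], and at [f].  At the [i]-th vertex they are the same with
    a delay of [n - i]. *)
Definition leg_tip := spread (fun j => tribo j.+2) true.
Definition leg_f := spread (fun j => tribo j.+3 + tribo j.+1)%N true.

Lemma leg_tip_mono x : (leg_tip x <= leg_tip x.+2)%N.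
Proof.
case: (double_ind_case x) => -[j ->]; rewrite /leg_tip -doubleS ?spread_double //.
by rewrite !spread_doubleS tribo_mono.
Qed.

(** * Waves on the two graphs *)

Lemma onN_add a b1 b2 b3 c1 c2 c3 a' b1' b2' b3' c1' c2' c3' :
  onN a b1 b2 b3 c1 c2 c3 + onN a' b1' b2' b3' c1' c2' c3' =
  onN (fun i => a i + a' i) (b1 + b1') (b2 + b2') (b3 + b3')
    (c1 + c1') (c2 + c2') (c3 + c3').
Proof.
apply: crdP => x; rewrite crdD; case: (vertexP x) => *;
  by rewrite ?onN_al ?onN_pl ?onN_E ?addr0.
Qed.
Lemma onM_add a f g b c a' f' g' b' c' :
  onM a f g b c + onM a' f' g' b' c' =
  onM (fun i => a i + a' i) (f + f') (g + g') (b + b') (c + c').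
Proof.
apply: crdP => x; rewrite crdD; case: (vertexP x) => *;
  by rewrite ?onM_pl ?onM_al ?onM_E ?addr0.
Qed.

(** In the coefficients along the path, the truncated difference [m + i - n] is 0
    where the wave has not arrived, and both amplitudes vanish at 0. *)
Definition tip_wave s m : 'rV[rat]_#|vertex| :=
  onN (fun i => (leg_tip (m + i - n))%:R)
    (spread (fun j => htribo (~~ s) j.+2) false m)%:R
    (spread (fun j => htribo s j + htribo s j.+1)%N true m)%:R
    (spread (htribo s) false m)%:R
    (spread (fun j => htribo s j.+2) false m)%:R
    (spread (fun j => htribo (~~ s) j + htribo (~~ s) j.+1)%N true m)%:R
    (spread (htribo (~~ s)) false m)%:R.

Definition f_wave m : 'rV[rat]_#|vertex| :=
  onM (fun i => (leg_f (m + i - n))%:R)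
    (spread (fun j => tribo j.+1 + tribo j)%N false m)%:R
    (spread (fun j => tribo j.+2 + tribo j.+1)%N false m)%:R
    (spread (fun j => tribo j.+2) true m)%:R
    (spread (fun j => tribo j.+2) true m)%:R.

(** The bound on the time ensures that the end of the path is not felt: the formula
    gives the missing neighbour of [alpha_0] the amplitude [leg_tip (m - n)], which
    vanishes up to time 2. *)
Lemma tip_wave_step s m : (m.+2 <= n.+3)%N ->
  tip_wave s m.+1 *m Dl = tip_wave s m + tip_wave s m.+2.
Proof.
move=> mn; rewrite /tip_wave onN_D onN_add; apply: eq_onN; rewrite -?natrD.
- apply: shift_sumP => [|i iltn|]; rewrite -?natrD; congr _%:R.
  + have -> : leg_tip (m + 0 - n) = 0%N.
      have : (m + 0 - n <= 1)%N by lia.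
      by case: (m + 0 - n)%N => [|[|]].
    by rewrite add0n; congr leg_tip; lia.
  + by congr (leg_tip _ + leg_tip _)%N; lia.
  + have -> : (m.+1 + n.-1 - n = m)%N by have : (0 < n)%N by []; lia.
    rewrite !addnK; congr (_ + _)%N; rewrite /leg_tip.
    case: (double_ind_case m) => -[j ->]; rewrite -?doubleS !spread_doubleS ?spread_double //.
    by rewrite addnC htribo_sum.
- congr _%:R; rewrite addnK /leg_tip.
  case: (double_ind_case m) => -[j ->]; rewrite -?doubleS !(spread_doubleS, spread_double) //.
  by have := htriboSSS (~~ s) j; rewrite negbK => ->; rewrite -(htribo_sum s); lia.
- congr _%:R; case: (double_ind_case m) => -[j ->];
    rewrite -?doubleS !(spread_doubleS, spread_double) //.
  by have := htriboSSS (~~ s) j; rewrite negbK => ->; lia.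
- congr _%:R; case: (double_ind_case m) => -[j ->];
    by rewrite -?doubleS !(spread_doubleS, spread_double).
- congr _%:R; rewrite addnK /leg_tip.
  case: (double_ind_case m) => -[j ->]; rewrite -?doubleS !(spread_doubleS, spread_double) //.
  by have := htriboSSS s j => ->; rewrite -(htribo_sum s); lia.
- congr _%:R; case: (double_ind_case m) => -[j ->];
    rewrite -?doubleS !(spread_doubleS, spread_double) //.
  by have := htriboSSS s j => ->; lia.
- congr _%:R; case: (double_ind_case m) => -[j ->];
    by rewrite -?doubleS !(spread_doubleS, spread_double).
Qed.

Lemma f_wave_step m : (m.+2 <= n.+1)%N ->
  f_wave m.+1 *m Dl = f_wave m + f_wave m.+2.
Proof.
move=> mn; rewrite /f_wave onM_D onM_add; apply: eq_onM; rewrite -?natrD.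
- apply: shift_sumP => [|i iltn|]; rewrite -?natrD; congr _%:R.
  + have -> : leg_f (m + 0 - n) = 0%N by have -> : (m + 0 - n = 0)%N by lia.
    by rewrite add0n; congr leg_f; lia.
  + by congr (leg_f _ + leg_f _)%N; lia.
  + have -> : (m.+1 + n.-1 - n = m)%N by have : (0 < n)%N by []; lia.
    rewrite !addnK; congr (_ + _)%N; rewrite /leg_f.
    case: (double_ind_case m) => -[j ->]; rewrite -?doubleS !(spread_doubleS, spread_double) //.
    by rewrite [tribo j.+4]triboSSS; lia.
all: congr _%:R; rewrite ?addnK /leg_f; case: (double_ind_case m) => -[j ->];
     rewrite -?doubleS !(spread_doubleS, spread_double) // ?triboSSS; lia.
Qed.

Definition tip s := if s then vb3 else vc3.

Lemma tip_waveE s m : (m <= n.+3)%N -> bv (tip s) *m U m = tip_wave s m.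
Proof.
have r0 : bv (tip s) = tip_wave s 0.
  apply: crdP => x; rewrite crd_bv; case: (vertexP x) => [i Hi||||||| i Hi||||];
  rewrite /tip_wave ?onN_al ?onN_pl ?onN_E //; case: s; rewrite eqvE //=.
  1-2: have -> : (0 + i - n = 0)%N by lia.
  1-2: by [].
have r1 : bv (tip s) *m Dl = tip_wave s 1.
  transitivity (bv (if s then vb2 else vc2)); first by case: (s); rewrite bvDE.
  apply: crdP => x; rewrite crd_bv; case: (vertexP x) => [i Hi||||||| i Hi||||];
  rewrite /tip_wave ?onN_al ?onN_pl ?onN_E //; case: (s); rewrite eqvE //=.
  1-2: have : (1 + i - n <= 1)%N by lia.
  1-2: by case: (1 + i - n)%N => [|[|]].
elim/ltn_ind: m => -[|[|m]] IH mn; first by rewrite cheb0 mulmx1.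
  by rewrite cheb1.
rewrite chebSS mulmxBr mulmxA !IH //; try lia.
by rewrite tip_wave_step // addrC addKr.
Qed.

Lemma f_waveE m : (m <= n.+1)%N -> bv vF *m U m = f_wave m.
Proof.
have r0 : bv vF = f_wave 0.
  apply: crdP => x; rewrite crd_bv; case: (vertexP x) => [i Hi||||||| i Hi||||];
  rewrite /f_wave ?onM_al ?onM_pl ?onM_E // eqvE //=.
  have -> : (0 + i - n = 0)%N by lia.
  by [].
have r1 : bv vF *m Dl = f_wave 1.
  rewrite bvDE.
  apply: crdP => x; rewrite crd_bv; case: (vertexP x) => [i Hi||||||| i Hi||||];
  rewrite /f_wave ?onM_al ?onM_pl ?onM_E // eqvE //= !inordK //.
  case: eqP => [->|iN]; first by rewrite addnK.
  by have -> : (1 + i - n = 0)%N by lia.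
elim/ltn_ind: m => -[|[|m]] IH mn; first by rewrite cheb0 mulmx1.
  by rewrite cheb1.
rewrite chebSS mulmxBr mulmxA !IH //; try lia.
by rewrite f_wave_step // addrC addKr.
Qed.

(** * Products with powers of the generator are nonnegative *)

Lemma natmx_J : natmx J.
Proof. by move=> x; rewrite bv_J; apply: natv_bv. Qed.
Lemma natmx_Pi b : natmx (Pi b).
Proof.
by move=> x; rewrite bv_Pi; case: ifP => _ y; rewrite ?crd0 ?rpred0 //; apply: natv_bv.
Qed.
Lemma natmx_Dl : natmx Dl.
Proof.
by move=> x y; rewrite bv_Dl crd_sum; apply: rpred_sum => z _; apply: natv_bv.
Qed.
Lemma natmx_Gl : natmx Gl.
Proof.
rewrite Gl.unlock; apply: natmx_mul natmx_J; exact: natmx_mul natmx_J natmx_Dl.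
Qed.

(** The diagonal entries of [Delta^2 - 1] are the degrees minus 1, and no vertex is
    isolated. *)
Lemma natmx_U2 : natmx (U 2).
Proof.
move=> x y; rewrite U2E mulmxBr mulmx1 mulmxA crdD crdN crd_bv.
have N : crd (bv x *m Dl *m Dl) y \is a Num.nat.
  exact: natv_mul (natv_mul (natv_bv x) natmx_Dl) natmx_Dl y.
case: eqP => [->|_]; last by rewrite subr0.
have -> : crd (bv x *m Dl *m Dl) x = (size (nbs x))%:R.
  rewrite crd_Dl (eq_big_seq (fun=> 1)) ?sumr_const_seq //.
    by rewrite big_const_seq count_predT iter_addr_0.
  move=> z zx; rewrite bv_mulE Dl.unlock opf.unlock mxE !enum_rankK -mem_nbs.
  by rewrite zx.
have : (0 < size (nbs x))%N.
  by case: (vertexP x) => [m mn||||||| m mn||||] //; rewrite ?nbs_al ?nbs_pl //;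
    rewrite size_cat; case: ifP => //; case: ifP.
by case: size => // s _; rewrite -natr1 addrK natr_nat.
Qed.

Lemma natv_tip_wave s m : natv (tip_wave s m).
Proof.
move=> x; case: (vertexP x) => *; by rewrite /tip_wave ?onN_al ?onN_pl ?onN_E ?natr_nat.
Qed.
Lemma natv_f_wave m : natv (f_wave m).
Proof.
move=> x; case: (vertexP x) => *; by rewrite /f_wave ?onM_al ?onM_pl ?onM_E ?natr_nat.
Qed.

Lemma natv_tipU s m : (m <= n.+3)%N -> natv (bv (tip s) *m U m).
Proof. by move=> mn; rewrite tip_waveE //; apply: natv_tip_wave. Qed.

Local Notation s3 := (bv vb3 + bv vc3).

Lemma s3U_al m l : (m <= n.+3)%N -> (l <= n)%N ->
  crd (s3 *m U m) (al l) = 2 * (leg_tip (m + l - n))%:R.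
Proof.
move=> mn ln; rewrite mulmxDl crdD (@tip_waveE true) // (@tip_waveE false) //.
by rewrite /tip_wave !onN_al //; ring.
Qed.

(** Twice the wave that starts at [alpha_0], [j] steps after it has arrived at
    [alpha_n], in terms of [v = beta_3 + gamma_3].  Both sequences satisfy
    the Chebyshev recurrence, and [2 alpha_n = v U_3],
    [2 (beta_1 + gamma_1) = 2 v U_2]; the list continues these two values.  From
    [j = 5] on the pattern is uniform. *)
Definition reflected (v : 'rV[rat]_#|vertex|) j : 'rV[rat]_#|vertex| :=
  match j with
  | 0 => v *m U 3
  | 1 => 2 *: (v *m U 2)
  | 2 => v *m U 3 + 2 *: (v *m U 1)
  | 3 => v *m U 4 + v *m U 2 + 2 *: (v *m U 0)
  | 4 => v *m U 5 + v *m U 3 + v *m U 1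
  | m.+3.+2 => v *m U m.+4.+2 + v *m U m.+4 + v *m U m.+2 - v *m U m
  end.

Lemma reflected_step v j : reflected v j.+2 = reflected v j.+1 *m Dl - reflected v j.
Proof.
have vS i : v *m U i.+1 *m Dl = v *m U i + v *m U i.+2.
  by rewrite -mulmxA cheb_mulr mulmxDr.
have v0 : v *m U 0 *m Dl = v *m U 1 by rewrite cheb0 mulmx1 cheb1.
by case: j => [|[|[|[|[|j]]]]]; rewrite /reflected ?mulmxDl ?mulNmx -?scalemxAl
  ?v0 ?vS; vring.
Qed.

Lemma reflectedE j : 2 *: (bv (al 0) *m U (n + j)) = reflected s3 j.
Proof.
have r0 : 2 *: bv (al n) = reflected s3 0.
  rewrite /reflected chebSS mulmxBr mulmxA cheb1 (mulmxDl _ _ (U 2)) b3_U2 c3_U2.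
  by rewrite !mulmxDl !bvDE; vring.
have r1 : 2 *: (bv vb1 + bv vc1) = reflected s3 1.
  by rewrite /reflected mulmxDl b3_U2 c3_U2.
elim/ltn_ind: j => -[|[|j]] IH.
- by rewrite addn0 one_U.
- by rewrite addn1 one_Un1.
rewrite reflected_step -(IH j.+1) // -(IH j (leqW (ltnSn _))).
by rewrite !addnS chebSS mulmxBr mulmxA scalerBr -scalemxAl.
Qed.

(** The only negative term in [reflected] is compensated since the
    amplitudes of the wave are nondecreasing. *)
Lemma natv_one_U_al m l : (m <= n + n)%N -> (l <= n)%N ->
  crd (bv (al 0) *m U m) (al l) \is a Num.nat.
Proof.
move=> mn ln; case: (leqP m n) => [m_le|m_gt]; first by rewrite one_U ?natv_bv.
have [j jm] : exists j, m = (n + j)%N by exists (m - n)%N; lia.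
have jn : (j <= n)%N by lia.
have -> : crd (bv (al 0) *m U m) (al l) = crd (reflected s3 j) (al l) / 2.
  by rewrite -reflectedE crdZ -jm; field.
have n3 : (3 <= n)%N by [].
have S i : (i <= n.+3)%N -> crd (s3 *m U i) (al l) = 2 * (leg_tip (i + l - n))%:R.
  by move=> ?; apply: s3U_al.
pose o i := leg_tip (i + l - n).
have N (t : rat) (m' : nat) : t = 2 * m'%:R -> t / 2 \is a Num.nat.
  by move=> ->; rewrite mulrC mulKf ?natr_nat.
case: j {jm} jn => [|[|[|[|[|j]]]]] jn; rewrite /reflected ?(crdD, crdN, crdZ) !S;
  try by lia.
- exact: (N _ (o 3)).
- by apply: (N _ (o 2 + o 2)%N); rewrite natrD; ring.
- by apply: (N _ (o 3 + o 1 + o 1)%N); rewrite !natrD; ring.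
- by apply: (N _ (o 4 + o 2 + o 0 + o 0)%N); rewrite !natrD; ring.
- by apply: (N _ (o 5 + o 3 + o 1)%N); rewrite !natrD; ring.
- have le : (o j <= o j.+2)%N.
    rewrite /o; case: (leqP n (j + l)) => h; last by have -> : (j + l - n = 0)%N by lia.
    have -> : (j.+2 + l - n = (j + l - n).+2)%N by lia.
    exact: leg_tip_mono.
  by apply: (N _ (o j.+2.+4 + o j.+4 + (o j.+2 - o j))%N); rewrite !natrD natrB //; ring.
Qed.

Lemma crd_Umul x m z : crd (bv x *m U m) z = crd (bv z *m U m) x.
Proof. by rewrite -!dot_bv dot_adj cheb_tr ?Dl_tr // dotC. Qed.

(** As the index of the first factor drops by one with each use of the product rule,
    a product of two polynomials becomes a sum of single ones of degree at most
    [2 n]. *)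
Lemma crd_UU i j l : (i <= n)%N -> (j <= n)%N -> (l <= n)%N ->
  crd (bv (al 0) *m (U i *m U j)) (al l) \is a Num.nat.
Proof.
elim: i j => [|i IH] j iN jN lN.
  by rewrite cheb0 mul1mx natv_one_U_al //; lia.
case: j jN => [|j] jN; first by rewrite cheb0 mulmx1 natv_one_U_al //; lia.
rewrite cheb_mulSS mulmxDr crdD rpredD ?IH ?natv_one_U_al //; lia.
Qed.

Lemma natv_b2U s j : (j <= n)%N ->
  natv (bv (if s then vb2 else vc2) *m U j).
Proof.
move=> jn; have -> : bv (if s then vb2 else vc2) = bv (tip s) *m Dl.
  by case: s; rewrite bvDE.
rewrite -mulmxA (_ : Dl *m U j = U j *m Dl) ?mulmxA; last by apply: comm_cheb.
by apply: natv_mul natmx_Dl; apply: natv_tipU; lia.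
Qed.
Lemma natv_b1U s j : (j <= n)%N ->
  natv (bv (if s then vb1 else vc1) *m U j).
Proof.
move=> jn; have -> : bv (if s then vb1 else vc1) = bv (tip s) *m U 2.
  by case: s; rewrite ?b3_U2 ?c3_U2.
rewrite -mulmxA cheb_comm mulmxA.
by apply: natv_mul natmx_U2; apply: natv_tipU; lia.
Qed.

Lemma Gl_U j : comm_mx Gl (U j).
Proof. by apply: comm_cheb; apply: Gl_Dl. Qed.

Lemma natv_bb2U s j : (j <= n)%N ->
  natv (bv (if s then vbb else vbc) *m U j).
Proof.
move=> jn; have -> : bv (if s then vbb else vbc) = bv (tip (~~ s)) *m Gl.
  by case: s; rewrite ?b3_G ?c3_G.
rewrite -mulmxA Gl_U mulmxA.
by apply: natv_mul natmx_Gl; apply: natv_tipU; lia.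
Qed.

Lemma natv_gU j : (j <= n)%N -> natv (bv vG *m U j).
Proof.
move=> jn; rewrite -bvD_bb.
rewrite -mulmxA (_ : Dl *m U j = U j *m Dl) ?mulmxA; last by apply: comm_cheb.
by apply: natv_mul natmx_Dl; apply: (natv_bb2U true).
Qed.

Definition same_loops (q : 'M[rat]_#|vertex|) :=
  crd (bv (pl 0) *m q) (pl 0) = crd (bv (al 0) *m q) (al 0).

Lemma same_loopsD q r : same_loops q -> same_loops r -> same_loops (q + r).
Proof. by rewrite /same_loops !mulmxDr !crdD => -> ->. Qed.
Lemma same_loopsN q : same_loops q -> same_loops (- q).
Proof. by rewrite /same_loops !mulmxN !crdN => ->. Qed.

(** As [alpha'_0 Delta = alpha_0 (J Delta J)] and [J Delta J] commutes with [Delta],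
    closed walks at [alpha_0] and at [alpha'_0] of the same length are equally
    many.  This transports positivity from the first long path to the second. *)
Lemma same_loops_DD m : same_loops (U m *m Dl *m Dl).
Proof.
have UD : U m *m Dl = Dl *m U m by apply/esym/comm_cheb.
have GG : bv (al 0) *m Gl *m Gl = bv (al 0) *m Dl *m Dl.
  have a0D : bv (al 0) *m Dl = bv (al 1).
    by rewrite -(@aseq_bv true) // aseq_D // aseq0 add0r aseq_bv.
  have a1D : bv (al 1) *m Dl = bv (al 0) + bv (al 2).
    by rewrite -(@aseq_bv true 1) // aseq_D // !aseq_bv.
  rewrite one_G a0D a1D Gl.unlock !mulmxA bv_J bar_pl //= a1D mulmxDl !bv_J.
  by rewrite !bar_al.
rewrite /same_loops -!dot_bv !mulmxA.
rewrite (dot_D (bv (pl 0) *m U m *m Dl)) -(mulmxA (bv (pl 0))) UD mulmxA.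
rewrite one'_D -one_G -(mulmxA _ Gl (U m)) Gl_U mulmxA dot_adj Gl_tr GG.
by rewrite !dot_D.
Qed.

Lemma same_loops_U m : same_loops (U m).
Proof.
have odd0 P : crd (bv (if P then al 0 else pl 0) *m Dl) (if P then al 0 else pl 0) = 0.
  by case: P; rewrite bv_mulE Dl.unlock opf.unlock mxE !enum_rankK /= /adj /adj' /=
    !inordK.
elim/ltn_ind: m => -[|[|[|[|m]]]] IH.
- by rewrite /same_loops cheb0 !mulmx1 !crd_bv !eqxx.
- by rewrite /same_loops cheb1 (odd0 false) (odd0 true).
- rewrite U2E; apply: same_loopsD; last first.
    by apply: same_loopsN; rewrite -(cheb0 Dl); apply: IH.
  by have := same_loops_DD 0; rewrite cheb0 mul1mx.
- have -> : U 3 = U 1 *m Dl *m Dl - U 1 - U 1.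
    by rewrite (chebSS _ 1) U2E cheb1 mulmxBl mul1mx.
  have S1 := same_loopsN (IH 1%N isT).
  by apply: (same_loopsD _ S1); apply: (same_loopsD _ S1); apply: same_loops_DD.
have -> : U m.+4 = U m.+2 *m Dl *m Dl - U m.+2 - U m.+2 - U m.
  rewrite cheb_mulr mulmxDl !cheb_mulr; mring.
have S2 := same_loopsN (IH m.+2 (leqW (ltnSn _))).
have S0 : same_loops (- U m) by apply: same_loopsN; apply: IH; lia.
apply: (same_loopsD _ S0); apply: (same_loopsD _ S2); apply: (same_loopsD _ S2).
exact: same_loops_DD.
Qed.

Lemma same_loops_UU i j : same_loops (U i *m U j).
Proof.
elim: i j => [|i IH] [|j]; rewrite ?cheb0 ?mul1mx ?mulmx1;
  try exact: same_loops_U; first by rewrite -(cheb0 Dl); apply: same_loops_U.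
by rewrite cheb_mulSS; apply: same_loopsD; [apply: IH | apply: same_loops_U].
Qed.

Lemma same_loops_UUU i j l : same_loops (U i *m U j *m U l).
Proof.
elim: i j => [|i IH] [|j]; rewrite ?cheb0 ?mul1mx ?mulmx1;
  try exact: same_loops_UU; first exact: same_loops_U.
rewrite cheb_mulSS mulmxDl.
by apply: same_loopsD; [apply: IH | apply: same_loops_UU].
Qed.

Lemma crd_UU' i j l : (i <= n)%N -> (j <= n)%N -> (l <= n)%N ->
  crd (bv (pl 0) *m (U i *m U j)) (pl l) \is a Num.nat.
Proof.
move=> iN jN lN; have := crd_UU iN jN lN.
rewrite -!dot_bv -(one_U lN) -(one'_U lN) -[U l](cheb_tr l Dl_tr) -!dot_adj.
by rewrite !dot_bv; have := same_loops_UUU i j l; rewrite /same_loops !mulmxA => ->.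
Qed.

Lemma natv_alU i j : (i <= n)%N -> (j <= n)%N -> natv (bv (al i) *m U j).
Proof.
move=> iN jN z; case: (vertexP z) => [l lN||||||| l lN||||].
- by rewrite -one_U // -mulmxA crd_UU.
- by rewrite crd_Umul; apply: (natv_b1U true).
- by rewrite crd_Umul; apply: (natv_b2U true).
- by rewrite crd_Umul; apply: (natv_tipU true); lia.
- by rewrite crd_Umul; apply: (natv_b1U false).
- by rewrite crd_Umul; apply: (natv_b2U false).
- by rewrite crd_Umul; apply: (natv_tipU false); lia.
all: have -> : bv (al i) = bv (al i) *m Lam true by rewrite bv_Lam.
all: rewrite -mulmxA comm_cheb ?mulmxA ?crd_Lam ?rpred0 //; exact: Lam_Dl.
Qed.

Lemma natv_plU i j : (i <= n)%N -> (j <= n)%N -> natv (bv (pl i) *m U j).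
Proof.
move=> iN jN z; case: (vertexP z) => [l lN||||||| l lN||||].
8: by rewrite -one'_U // -mulmxA crd_UU'.
8: by rewrite crd_Umul f_waveE; [apply: natv_f_wave | lia].
8: by rewrite crd_Umul; apply: natv_gU.
8: by rewrite crd_Umul; apply: (natv_bb2U true).
8: by rewrite crd_Umul; apply: (natv_bb2U false).
all: have -> : bv (pl i) = bv (pl i) *m Lam false by rewrite bv_Lam.
all: rewrite -mulmxA comm_cheb ?mulmxA ?crd_Lam ?rpred0 //; exact: Lam_Dl.
Qed.

Lemma natmx_U j : (j <= n)%N -> natmx (U j).
Proof.
move=> jn x; case: (vertexP x) => [l lN||||||| l lN||||].
- exact: natv_alU.
- exact: (natv_b1U true).
- exact: (natv_b2U true).
- by apply: (natv_tipU true); lia.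
- exact: (natv_b1U false).
- exact: (natv_b2U false).
- by apply: (natv_tipU false); lia.
- exact: natv_plU.
- by rewrite f_waveE; [apply: natv_f_wave | lia].
- exact: natv_gU.
- exact: (natv_bb2U true).
- exact: (natv_bb2U false).
Qed.

(** * Products with the tips are nonnegative *)

(** The coefficients of [beta_3 (beta_3 + gamma_3)] and
    [gamma_3 (beta_3 + gamma_3)] at the even vertices beyond the branch point. *)
Lemma crd_S3 s : let v := bv (tip s) *m S3 in
  [/\ crd v (tip s) = (htribo false k.*2)%:R,
      crd v (tip (~~ s)) = (htribo true k.*2)%:R,
      crd v (if s then vb1 else vc1) = (htribo true k.*2.+2)%:R
    & crd v (if s then vc1 else vb1) = (htribo false k.*2.+2)%:R].
Proof.
have n1 : n.+3 = k.*2.+3.*2 by rewrite /nk; lia.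
have n2 : n.+1 = k.*2.+2.*2 by rewrite /nk; lia.
have n3 : n.-1 = k.*2.+1.*2 by rewrite /nk; lia.
have [_ _ F1] := htribo_double k; have [_ _ F2] := htribo_double k.+1.
rewrite doubleS in F2.
have HP i : htribo true i.+3 = (htribo false i + htribo false i.+1 + htribo false i.+2)%N.
  exact: htriboSSS true i.
have HQ i : htribo false i.+3 = (htribo true i + htribo true i.+1 + htribo true i.+2)%N.
  exact: htriboSSS false i.
have natB (a b c d : nat) : a = (b + c + d)%N -> a%:R - b%:R - c%:R = d%:R :> rat.
  by move=> ->; rewrite !natrD; ring.
have l1 : (n.-1 <= n.+3)%N by rewrite n1 n3; lia.
have l2 : (n.+1 <= n.+3)%N by lia.
cbv zeta; rewrite S3.unlock !mulmxBr (tip_waveE s l1) (tip_waveE s l2) (tip_waveE s (leqnn _)).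
rewrite n1 n2 n3 /tip_wave; case: s; cbv iota; split;
  rewrite !(crdD, crdN) !onN_E !spread_double /=; apply: natB;
  move: F1 F2 (HP k.*2) (HP k.*2.+1) (HP k.*2.+2) (HQ k.*2) (HQ k.*2.+1) (HQ k.*2.+2); lia.
Qed.

(** The coefficients are those of [(S3 + Rdif) / 2].  At these vertices the ones of
    [Rdif] are 0, 1 or -1, depending on [k] through the sign of
    [osc8 n.-1], and those of [S3] have the same parity by [htribo_double]. *)
Lemma natv_tip_Rb3_at s z : z \in [:: vb1; vb3; vc1; vc3] ->
  crd (bv (tip s) *m Rb3) z \is a Num.nat.
Proof.
have [q0 p0 _] := htribo_double k; have [q1 p1 _] := htribo_double k.+1.
rewrite doubleS /= negbK in q1 p1.
have [] := crd_S3 s; rewrite p0 p1 !natrD q0 q1.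
move: (htribo false k.*2)./2 (htribo false k.*2.+2)./2 => h h'; rewrite -!mul2n !natrM.
have N0 (m : nat) (t : rat) : t = m%:R -> t \is a Num.nat.
  by move=> ->; rewrite natr_nat.
have N1 (m : nat) (t : rat) : t = m%:R + 1 -> t \is a Num.nat.
  by move=> ->; rewrite natr1 natr_nat.
have d0 x v : dot (bv x) v = crd v x by rewrite dotC dot_bv.
have e0 x : crd ve x = (x == vb3)%:R - (x == vc3)%:R by rewrite ve.unlock crdD crdN !crd_bv.
have e1 x : crd vd x = (x == vb1)%:R - (x == vc1)%:R by rewrite vd.unlock crdD crdN !crd_bv.
have eE x : crd vsum x = crd ve x + crd vd x by rewrite vsum.unlock crdD.
have eF x : crd vdif x = crd ve x - crd vd x by rewrite vdif.unlock crdD crdN.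
have z3 : crd (ve2 *m J) (tip s) = 0 by rewrite -ve2J_Lam crd_Lam; case: (s).
have z4 : crd (X2 *m Dl *m J) (tip s) = 0 by rewrite -X2DJ_Lam crd_Lam; case: (s).
have vP : bv (tip s) *m Pi true = bv (tip s) by rewrite bv_Pi; case: (s).
rewrite Rb3E mulmxDr -!scalemxAr mulmxA vP mul_Rdif !d0 z3 z4.
rewrite X0.unlock X2.unlock !(crdD, crdN, crdZ) !eE !eF !e0 !e1.
move: (osc8_n1 k); rewrite !inE.
case: s {z3 z4 vP} => /= tE h1 h2 h3 h4 /or4P[] /eqP ->;
  rewrite ?(h1, h2, h3, h4) !onN_E !eqvE /= tE;
  case: (odd k) => /=.
all: try by apply: (N0 h); field.
all: try by apply: (N0 h'); field.
all: try by apply: (N1 h); field.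
all: by apply: (N1 h'); field.
Qed.

Lemma lmul_natmx x : natmx (rmul (bar x)) -> natmx (lmul x).
Proof.
by move=> N; apply: natmx_mul natmx_J; apply: natmx_mul natmx_J _.
Qed.

Lemma natmx_PiU b m : (m <= n)%N -> natmx (Pi b *m U m).
Proof. by move=> mn; apply: natmx_mul (natmx_Pi b) (natmx_U mn). Qed.

Definition Rtip s := if s then Rb3 else Rc3.

Lemma rmul_tip s : rmul (tip s) = Rtip s.
Proof. by case: s. Qed.

(** The involution turns [x beta_3] into [bar(beta_3) bar(x)], a product with a
    polynomial in [Delta] when [x] lies on a long path. *)
Lemma natv_path_Rtip s x :
  match x with inl (alpha _) | inr (palpha _) => True | _ => False end ->
  natv (bv x *m Rtip s).
Proof.
move=> xA; rewrite -rmul_tip -rmul_Pil mulmxA bv_Pi.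
case: eqP => [rx|_]; last by move=> z; rewrite mul0mx crd0 rpred0.
rewrite rmul_bar; last by case: s rx.
apply: natv_mul natmx_J; apply: natv_mul; first exact: natv_bv.
case: (vertexP x) xA rx => [m mn||||||| m mn||||] // _ rx.
- rewrite bar_al // rgt_al // in rx *; case: ifP rx => om rx.
    by rewrite rmul_pl //; apply: natmx_PiU.
  by rewrite rmul_al //; apply: natmx_PiU.
- rewrite bar_pl // rgt_pl // in rx *; case: ifP rx => om rx.
    by rewrite rmul_al //; apply: natmx_PiU.
  by rewrite rmul_pl //; apply: natmx_PiU.
Qed.

Lemma Rtip_tr s : (Rtip s)^T = Rtip (~~ s).
Proof. by case: s; rewrite ?Rb3_tr ?Rc3_tr. Qed.

Lemma crd_tr (M : 'M_#|vertex|) (x y : vertex) : crd (bv x *m M) y = crd (bv y *m M^T) x.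
Proof. by rewrite -!dot_bv dot_adj dotC. Qed.

Lemma natv_tip_Rb3 s : natv (bv (tip s) *m Rb3).
Proof.
move=> z; case: (eqVneq (crd (bv (tip s) *m Rb3) z) 0) => [->|nz]; first exact: rpred0.
have [_ lz rz] : [/\ rgt (tip s) = lft vb3, lft z = lft (tip s) & rgt z = rgt vb3].
  exact: (@rmul_support (tip s) vb3 z nz).
case: (vertexP z) lz rz => [m mn||||||| m mn||||] lz rz; try by case: (s) lz.
- by rewrite crd_tr -/(Rtip true) Rtip_tr; apply: natv_path_Rtip.
- by apply: natv_tip_Rb3_at; rewrite !inE eqxx.
- by apply: natv_tip_Rb3_at; rewrite !inE eqxx orbT.
- by apply: natv_tip_Rb3_at; rewrite !inE eqxx !orbT.
- by apply: natv_tip_Rb3_at; rewrite !inE eqxx !orbT.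
Qed.

Lemma Gl_Rb3 : comm_mx Gl Rb3.
Proof. exact: (Gl_rmul vb3). Qed.

(** All rows other than those of the two tips are obtained from these by left
    multiplication with [alpha_1] and [alpha_2], or from the involution. *)
Lemma natmx_Rb3 : natmx Rb3.
Proof.
have b1L s : bv (if s then vb1 else vc1) = bv (tip (~~ s)) *m lmul (al 2).
  rewrite -mul_swap; last by rewrite rgt_al //; case: s.
  rewrite rmul_tip -one_U // -mulmxA.
  have -> : U 2 *m Rtip (~~ s) = Rtip s *m U 2 by case: s; rewrite /= ?Rb3_U2 ?Rc3_U2.
  by rewrite mulmxA; case: s; rewrite ?one_Rb3 ?one_Rc3 ?b3_U2 ?c3_U2.
have N1 s : natv (bv (if s then vb1 else vc1) *m Rb3).
  rewrite b1L -mulmxA (lmul_rmul (al 2) vb3) mulmxA.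
  apply: natv_mul; first exact: natv_tip_Rb3.
  apply: lmul_natmx; have -> : bar (al 2) = al 2 by rewrite bar_al.
  by rewrite rmul_al //; apply: natmx_PiU.
have N2 s : natv (bv (if s then vbb else vbc) *m Rb3).
  have -> : bv (if s then vbb else vbc) = bv (tip (~~ s)) *m Gl.
    by case: s; rewrite ?b3_G ?c3_G.
  by rewrite -mulmxA Gl_Rb3 mulmxA; apply: natv_mul natmx_Gl; apply: natv_tip_Rb3.
have N0 x : rgt x = false -> natv (bv x *m Rb3).
  move=> rx z; rewrite -[Rb3]/(rmul vb3) -rmul_Pil mulmxA bv_Pi rx mul0mx crd0.
  exact: rpred0.
move=> x; case: (vertexP x) => [m mn||||||| m mn||||]; try by apply: N0.
- exact: (natv_path_Rtip true).
- exact: (N1 true).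
- exact: (natv_tip_Rb3 true).
- exact: (N1 false).
- exact: (natv_tip_Rb3 false).
- exact: (natv_path_Rtip true).
- exact: (N2 true).
- exact: (N2 false).
Qed.

Lemma natmx_Rc3 : natmx Rc3.
Proof. by rewrite -Rb3_tr; apply: natmx_tr natmx_Rb3. Qed.

Lemma natmx_rmul_but_f x : x != vF -> natmx (rmul x).
Proof.
case: (vertexP x) => [m mn||||||| m mn||||] xF; rewrite ?rmulE.
- by rewrite rmul_al //; apply: natmx_PiU.
- exact: natmx_mul natmx_Rb3 natmx_U2.
- exact: natmx_mul natmx_Rb3 natmx_Dl.
- exact: natmx_Rb3.
- exact: natmx_mul natmx_Rc3 natmx_U2.
- exact: natmx_mul natmx_Rc3 natmx_Dl.
- exact: natmx_Rc3.
- by rewrite rmul_pl //; apply: natmx_PiU.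
- by rewrite eqxx in xF.
- by apply: natmx_mul natmx_Dl; apply: natmx_mul natmx_Dl natmx_Rb3.
- exact: natmx_mul natmx_Dl natmx_Rc3.
- exact: natmx_mul natmx_Dl natmx_Rb3.
Qed.

(** The involution turns [x f] into [f bar(x)], which is known for [x] other than
    [f]; the remaining rows and columns follow by symmetry, except for the
    coefficient of [f] in [f f], which is computed. *)
Lemma natmx_rmul_f : natmx (rmul vF).
Proof.
have Nx x : x != vF -> natv (bv x *m rmul vF).
  move=> xF; rewrite -rmul_Pil mulmxA bv_Pi.
  case: eqP => [rx|_]; last by move=> z; rewrite mul0mx crd0 rpred0.
  rewrite rmul_bar //; apply: natv_mul natmx_J; apply: natv_mul (natv_bv _) _.
  apply: natmx_rmul_but_f; apply: contra xF => /eqP xF.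
  by rewrite -(barK x) xF.
move=> x; case: (eqVneq x vF) => [->|]; last exact: Nx.
move=> z; case: (eqVneq z vF) => [->|zF]; last by rewrite crd_tr rmul_tr; apply: Nx.
have -> : crd (bv vF *m rmul vF) vF = (tribo k.*2.+2)%:R.
  have k2 : n.+1 = k.*2.+2.*2 by rewrite /nk; lia.
  have k3 : n = k.*2.+1.*2.+1 by rewrite /nk; lia.
  have vP : bv vF *m Pi false = bv vF by rewrite bv_Pi.
  rewrite rmulE mulmxBr !mulmxA vP crdD crdN f_waveE // bvD_F.
  rewrite (crd_Dl _ vF) /= big_seq1.
  have -> : bv (pl n) *m Rb3 = bv vc3 *m U n *m J.
    rewrite -[Rb3]/(rmul vb3) rmul_bar ?rgt_pl ?odd_nk // !barE rmul_al //.
    by rewrite mulmxA bv_Pi.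
  have l3 : (n <= n.+3)%N by lia.
  rewrite crd_J barE (@tip_waveE false _ l3) /tip_wave /f_wave onN_al // onM_E addnK.
  rewrite {1}k2 spread_double /leg_tip [in spread _ _ n]k3 spread_doubleS natrD addrC addKr.
  by [].
exact: natr_nat.
Qed.

Lemma natmx_rmul x : natmx (rmul x).
Proof.
by case: (eqVneq x vF) => [->|]; [exact: natmx_rmul_f | exact: natmx_rmul_but_f].
Qed.

(** * The fusion algebra *)

Definition isN (P : side) : bool := if P is sN then true else false.

Definition emb P Q : basis P Q -> vertex :=
  match P, Q return basis P Q -> vertex with
  | sN, sN => fun x => inl (val x) | sN, sM => fun x => inl (val x)
  | sM, sN => fun x => inr (val x) | sM, sM => fun x => inr (val x)
  end.
Arguments emb {P Q} x.

Lemma lft_emb P Q (x : basis P Q) : lft (emb x) = isN P.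
Proof. by case: P Q x => [] []. Qed.
Lemma rgt_emb P Q (x : basis P Q) : rgt (emb x) = isN Q.
Proof.
case: P Q x => [] [] x /=; [exact: (valP x) | | exact: (valP x) |];
  by apply/negbTE; have := valP x; rewrite ?negbK.
Qed.
Lemma emb_inj P Q : injective (@emb P Q).
Proof. by case: P Q => [] [] x y /= [] /val_inj. Qed.

Lemma emb_surj P Q (w : vertex) : lft w = isN P -> rgt w = isN Q ->
  exists x : basis P Q, emb x == w.
Proof.
case: P Q => [] [] /=; case: w => [u|u] //= _ ou.
- by exists (Sub u ou : V11 k).
- by exists (Sub u (negbFE ou) : V12 k).
- by exists (Sub u ou : V21 k).
- by exists (Sub u (negbT ou) : V22 k).
Qed.

Lemma sum_emb (V : nmodType) P Q (F : vertex -> V) :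
  (forall w, F w != 0 -> lft w = isN P /\ rgt w = isN Q) ->
  \sum_w F w = \sum_(x : basis P Q) F (emb x).
Proof.
move=> F0; rewrite (bigID (fun w => (lft w == isN P) && (rgt w == isN Q))) /=.
rewrite addrC big1 ?add0r; last first.
  move=> w; apply: contraNeq => /F0[-> ->]; by rewrite !eqxx.
rewrite (reindex_omap (@emb P Q) (fun w => [pick x | emb x == w])) /=; last first.
  move=> w /andP[/eqP lw /eqP rw]; case: pickP => [x /eqP xw|nx] /=; first by rewrite xw.
  by have [y ey] := emb_surj lw rw; have := nx y; rewrite /= ey.
apply: eq_bigl => x; rewrite lft_emb rgt_emb !eqxx /=.
by case: pickP => [y /eqP /emb_inj ->|/(_ x)]; rewrite eqxx.
Qed.

Lemma row_sum (v : 'rV_#|vertex|) : v = \sum_w crd v w *: bv w.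
Proof.
apply: crdP => x; rewrite crd_sum (bigD1 x) //= crdZ crd_bv eqxx mulr1 big1 ?addr0 //.
by move=> y yx; rewrite crdZ crd_bv eq_sym (negPf yx) mulr0.
Qed.

Definition rcoef P Q R (x : basis P Q) (y : basis Q R) (z : basis P R) : nat :=
  Num.truncn (crd (bv (emb x) *m rmul (emb y)) (emb z)).

Lemma rcoefE P Q R (x : basis P Q) (y : basis Q R) (z : basis P R) :
  (rcoef x y z)%:R = crd (bv (emb x) *m rmul (emb y)) (emb z).
Proof. by rewrite truncnK //; apply: natmx_rmul. Qed.

Lemma rdual_ex P Q (x : basis P Q) : exists y : basis Q P, emb y == bar (emb x).
Proof. by apply: emb_surj; rewrite ?lft_bar ?rgt_bar ?lft_emb ?rgt_emb. Qed.
Definition rdual P Q (x : basis P Q) : basis Q P := xchoose (rdual_ex x).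
Lemma emb_rdual P Q (x : basis P Q) : emb (rdual x) = bar (emb x).
Proof. exact/eqP/(xchooseP (rdual_ex x)). Qed.

Definition runit P : basis P P :=
  match P with sN => alpha0 k | sM => alpha'0 k end.
Lemma emb_runit P : emb (runit P) = unit_of (isN P).
Proof.
case: P => /=; rewrite /al /pl; [congr (inl (alpha _)) | congr (inr (palpha _))];
  by apply: val_inj; rewrite /= inordK.
Qed.

Definition graph_fusion : fusion_data basis := FusionData rdual rcoef runit.

Lemma mul_emb P Q R (x : basis P Q) (y : basis Q R) :
  bv (emb x) *m rmul (emb y) = \sum_(z : basis P R) (rcoef x y z)%:R *: bv (emb z).
Proof.
rewrite [LHS]row_sum (@sum_emb _ P R).
  by apply: eq_bigr => z _; rewrite rcoefE.
move=> w nz; have /rmul_support[_ lw rw] : crd (bv (emb x) *m rmul (emb y)) w != 0.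
  by apply: contraNneq nz => ->; rewrite scale0r.
by rewrite lw rw lft_emb rgt_emb.
Qed.

Definition hrow P Q (a : homog basis P Q) : 'rV[rat]_#|vertex| :=
  \sum_x (a x)%:~R *: bv (emb x).
Definition hmul P Q (a : homog basis P Q) : 'M[rat]_#|vertex| :=
  \sum_x (a x)%:~R *: rmul (emb x).

Lemma hrow_inj P Q : injective (@hrow P Q).
Proof.
move=> a b ab; apply/ffunP => x; have /(congr1 (fun v => crd v (emb x))) := ab.
have hE (c : homog basis P Q) : crd (hrow c) (emb x) = (c x)%:~R.
  rewrite crd_sum (bigD1 x) //= crdZ crd_bv eqxx mulr1 big1 ?addr0 // => y yx.
  by rewrite crdZ crd_bv (inj_eq (@emb_inj P Q)) eq_sym (negPf yx) mulr0.
by rewrite !hE => /intr_inj.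
Qed.

Lemma hrow_basis P Q (x : basis P Q) : hrow (basis_vec x) = bv (emb x).
Proof.
rewrite /hrow (bigD1 x) //= ffunE eqxx scale1r big1 ?addr0 // => y yx.
by rewrite ffunE (negPf yx) scale0r.
Qed.
Lemma hmul_basis P Q (x : basis P Q) : hmul (basis_vec x) = rmul (emb x).
Proof.
rewrite /hmul (bigD1 x) //= ffunE eqxx scale1r big1 ?addr0 // => y yx.
by rewrite ffunE (negPf yx) scale0r.
Qed.

(** Stated for values in any vector space, so that it applies to the row vectors and
    to the matrices attached to a product, for this and for any other algebra. *)
Lemma sum_fmul (A : fusion_data basis) (V : lmodType rat) P Q R
    (a : homog basis P Q) (b : homog basis Q R) (F : basis P R -> V) :
  \sum_z (fmul A a b z)%:~R *: F z =
  \sum_x \sum_y ((a x)%:~R * (b y)%:~R) *: \sum_z (coef A x y z)%:R *: F z.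
Proof.
transitivity (\sum_z \sum_x \sum_y
    ((a x)%:~R * (b y)%:~R * (coef A x y z)%:R) *: F z).
  apply: eq_bigr => z _; rewrite ffunE rmorph_sum /= scaler_suml.
  apply: eq_bigr => x _; rewrite rmorph_sum /= scaler_suml.
  by apply: eq_bigr => y _; rewrite !rmorphM /=.
rewrite exchange_big /=; apply: eq_bigr => x _.
rewrite exchange_big /=; apply: eq_bigr => y _.
by rewrite scaler_sumr; apply: eq_bigr => z _; rewrite scalerA.
Qed.

Lemma hrow_fmul P Q R (a : homog basis P Q) (b : homog basis Q R) :
  hrow (fmul graph_fusion a b) = hrow a *m hmul b.
Proof.
rewrite /hrow sum_fmul mulmx_suml; apply: eq_bigr => x _.
rewrite mulmx_sumr; apply: eq_bigr => y _.
by rewrite -scalemxAl -scalemxAr scalerA mul_emb.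
Qed.

(** The product is expanded on basis elements [x], [y], [z]; there [x (y z)] is
    written as [(y z) L(x)] and the commutation with [R(z)] concludes. *)
Lemma hmul_fmul P Q R S (a : homog basis P Q) (b : homog basis Q R) (c : homog basis R S) :
  hrow a *m hmul (fmul graph_fusion b c) = hrow a *m hmul b *m hmul c.
Proof.
rewrite /hrow !mulmx_suml; apply: eq_bigr => x _.
rewrite -!scalemxAl; congr (_ *: _).
have -> : bv (emb x) *m hmul b *m hmul c = \sum_y \sum_z
    ((b y)%:~R * (c z)%:~R) *: (bv (emb x) *m rmul (emb y) *m rmul (emb z)).
  rewrite [hmul b]/hmul [bv (emb x) *m _]mulmx_sumr mulmx_suml; apply: eq_bigr => y _.
  rewrite /hmul mulmx_sumr; apply: eq_bigr => z _.
  by rewrite -!scalemxAr -scalemxAl scalerA mulrC.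
rewrite [hmul _]/hmul sum_fmul [LHS]mulmx_sumr; apply: eq_bigr => y _.
rewrite [LHS]mulmx_sumr; apply: eq_bigr => z _.
rewrite -scalemxAr; congr (_ *: _).
rewrite [LHS]mulmx_sumr mul_swap ?rgt_emb ?lft_emb // -mulmxA lmul_rmul mulmxA mul_emb.
rewrite mulmx_suml; apply: eq_bigr => w _.
by rewrite -scalemxAr -scalemxAl mul_swap ?rgt_emb ?lft_emb.
Qed.

Lemma crd_rmul_bar (x y z : vertex) :
  crd (bv x *m rmul y) z = crd (bv z *m rmul (bar y)) x.
Proof. by rewrite crd_tr rmul_tr. Qed.
Lemma crd_rmul_anti (x y z : vertex) : rgt x = lft y ->
  crd (bv x *m rmul y) z = crd (bv (bar y) *m rmul (bar x)) (bar z).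
Proof. by move=> xy; rewrite rmul_bar // crd_J. Qed.

Lemma graph_fusion_algebra : fusion_algebra graph_fusion.
Proof.
split.
- move=> P Q R S a b c; apply: hrow_inj.
  by rewrite !hrow_fmul hmul_fmul.
- by move=> P Q x; apply: emb_inj; rewrite /= !emb_rdual barK.
- move=> P Q R x y z.
  have nat_inj (a b : nat) : a%:R = b%:R :> rat -> a = b by move/eqP; rewrite eqr_nat => /eqP.
  have xy : rgt (emb x) = lft (emb y) by rewrite rgt_emb lft_emb.
  have zx : rgt (bar (emb z)) = lft (emb x) by rewrite rgt_bar !lft_emb.
  split; apply: nat_inj; rewrite /= !rcoefE ?emb_rdual.
  + exact: crd_rmul_bar.
  + by rewrite crd_rmul_anti // crd_rmul_bar barK crd_rmul_anti ?barK.
  + exact: crd_rmul_anti.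
  + by rewrite crd_rmul_anti // crd_rmul_bar barK.
  + by rewrite crd_rmul_anti // crd_rmul_bar barK crd_rmul_anti // !barK crd_rmul_bar.
- move=> P Q a; apply: hrow_inj; rewrite hrow_fmul hrow_basis emb_runit.
  rewrite mulmx_sumr; apply: eq_bigr => x _.
  by rewrite -scalemxAr -(lft_emb x) one_rmul.
- move=> P Q a; apply: hrow_inj; rewrite hrow_fmul hmul_basis emb_runit.
  have -> : rmul (unit_of (isN Q)) = Pi (isN Q).
    by case: Q {a}; rewrite ?rmul_al ?rmul_pl // cheb0 mulmx1.
  rewrite mulmx_suml; apply: eq_bigr => x _.
  by rewrite -scalemxAl bv_Pi rgt_emb eqxx.
Qed.

Lemma rmul_unit b : rmul (unit_of b) = Pi b.
Proof. by case: b; rewrite /= ?inordK // cheb0 mulmx1. Qed.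

Lemma emb_alpha1 : @emb sN sM (alpha1 k) = al 1.
Proof. by congr (inl (alpha _)); apply: val_inj; rewrite /= inordK. Qed.
Lemma emb_balpha1 : @emb sM sN (balpha1 k) = pl 1.
Proof. by congr (inr (palpha _)); apply: val_inj; rewrite /= inordK. Qed.

Lemma crd_adj (x y : vertex) : crd (bv x *m Dl) y = (adjv x y)%:R.
Proof. by rewrite bv_mulE Dl.unlock opf.unlock mxE !enum_rankK. Qed.

Lemma graph_fusion_compatible : compatible graph_fusion.
Proof.
have nat_inj (a b : nat) : a%:R = b%:R :> rat -> a = b by move/eqP; rewrite eqr_nat => /eqP.
have Nal (x : vertex) : rgt x = true -> bv x *m rmul (al 1) = bv x *m Dl.
  by move=> rx; rewrite rmul_al // cheb1 mulmxA bv_Pi rx eqxx.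
have Npl (x : vertex) : rgt x = false -> bv x *m rmul (pl 1) = bv x *m Dl.
  by move=> rx; rewrite rmul_pl // cheb1 mulmxA bv_Pi rx eqxx.
split=> //.
- move=> x y; apply: nat_inj; rewrite rcoefE emb_alpha1 Nal ?crd_adj //.
  exact: (@rgt_emb sN sN).
- move=> x y; apply: nat_inj; rewrite rcoefE emb_alpha1 Nal ?crd_adj //.
  exact: (@rgt_emb sM sN).
- move=> x y; apply: nat_inj; rewrite rcoefE emb_balpha1 Npl ?crd_adj //.
  exact: (@rgt_emb sN sM).
- move=> x y; apply: nat_inj; rewrite rcoefE emb_balpha1 Npl ?crd_adj //.
  exact: (@rgt_emb sM sM).
- move=> P Q x y; apply: nat_inj; rewrite rcoefE emb_runit rmul_unit bv_Pi rgt_emb.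
  by rewrite eqxx crd_bv (inj_eq (@emb_inj P Q)) eq_sym.
- move=> x; have := @emb_rdual sN sM x; rewrite /is_bar /=.
  case: x => -[i||||||] //= ox; rewrite ?ox; move: (rdual _) => [[j||||] oy] //= [].
  by move=> ->.
Qed.

End Construction.

Arguments emb {k P Q} x.

(** * The matrices of an arbitrary compatible algebra *)

(** Right multiplication by [y] consists of two maps, one for each left label; both
    are written as matrices over all the vertices and then added, so that the
    matrices of all elements have the same size. *)
Definition rhalf k (A : fusion_data (basis k)) P Q R (y : basis k Q R) :
    'M[rat]_#|vertex k| :=
  \sum_(x : basis k P Q) \sum_(z : basis k P R)
    (coef A x y z)%:R *: tens (bv (emb x)) (bv (emb z)).
Definition rmat k (A : fusion_data (basis k)) Q R (y : basis k Q R) :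
    'M[rat]_#|vertex k| := rhalf A sN y + rhalf A sM y.

Unset Implicit Arguments.
HB.lock Definition rlin (k : nat) (A : fusion_data (basis k))
    (v : 'rV[rat]_#|vertex k|) : 'M[rat]_#|vertex k| :=
  \sum_(y : basis k sN sN) crd v (@emb k sN sN y) *: @rmat k A sN sN y
  + \sum_(y : basis k sN sM) crd v (@emb k sN sM y) *: @rmat k A sN sM y
  + \sum_(y : basis k sM sN) crd v (@emb k sM sN y) *: @rmat k A sM sN y
  + \sum_(y : basis k sM sM) crd v (@emb k sM sM y) *: @rmat k A sM sM y.
Set Implicit Arguments.

Section Uniqueness.

Variable k : nat.
Local Notation n := (nk k).
Local Notation vertex := (vertex k).
Local Notation Dl := (Dl k).
Local Notation J := (J k).
Local Notation al := (al k).
Local Notation pl := (pl k).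
Local Notation vb1 := (vb1 k).
Local Notation vb2 := (vb2 k).
Local Notation vb3 := (vb3 k).
Local Notation vc1 := (vc1 k).
Local Notation vc2 := (vc2 k).
Local Notation vc3 := (vc3 k).
Local Notation vF := (vF k).
Local Notation vG := (vG k).
Local Notation vbb := (vbb k).
Local Notation vbc := (vbc k).
Local Notation Pi := (Pi k).
Local Notation Lam := (Lam k).
Local Notation Rdif := (Rdif k).
Local Notation S3 := (S3 k).
Local Notation X0 := (X0 k).
Local Notation X2 := (X2 k).
Local Notation vsum := (vsum k).
Local Notation ve := (ve k).
Local Notation vd := (vd k).
Local Notation ve2 := (ve2 k).
Local Notation Rb3 := (Rb3 k).
Local Notation Rc3 := (Rc3 k).
Local Notation rmul := (@rmul k).
Local Notation unit_of := (@unit_of k).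
Local Notation U := (cheb Dl).
Local Notation basis := (basis k).
Local Notation emb := (@emb k _ _).

Variables (A : fusion_data basis).
Hypotheses (FA : fusion_algebra A) (CA : compatible A).
Local Notation RAh P y := (@rhalf k A P _ _ y).
Local Notation RA y := (@rmat k A _ _ y).
Local Notation RL v := (@rlin k A v).

Lemma vertex_emb (w : vertex) : exists P Q (x : basis P Q), emb x = w.
Proof.
pose sd (b : bool) := if b then sN else sM.
have [x /eqP <-] : exists x : basis (sd (lft w)) (sd (rgt w)), emb x == w.
  by apply: emb_surj; [case: (lft w) | case: (rgt w)].
by exists (sd (lft w)), (sd (rgt w)), x.
Qed.

Lemma mul_RAh P Q R (y : basis Q R) w : bv w *m RAh P y =
  \sum_(x : basis P Q) \sum_(z : basis P R)
    ((coef A x y z)%:R * (emb x == w)%:R) *: bv (emb z).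
Proof.
rewrite /rhalf mulmx_sumr; apply: eq_bigr => x _.
rewrite mulmx_sumr; apply: eq_bigr => z _.
by rewrite -scalemxAr mul_tens scalerA dot_bv crd_bv.
Qed.

Lemma mul_RAh0 P Q R (y : basis Q R) w : (forall x : basis P Q, emb x != w) ->
  bv w *m RAh P y = 0.
Proof.
move=> nw; rewrite mul_RAh big1 // => x _; rewrite big1 // => z _.
by rewrite (negPf (nw x)) mulr0 scale0r.
Qed.

Lemma mul_RA P Q R (x : basis P Q) (y : basis Q R) :
  bv (emb x) *m RA y = \sum_z (coef A x y z)%:R *: bv (emb z).
Proof.
have same : bv (emb x) *m RAh P y = \sum_z (coef A x y z)%:R *: bv (emb z).
  rewrite mul_RAh (bigD1 x) //= [X in _ + X]big1 ?addr0.
    by apply: eq_bigr => z _; rewrite eqxx mulr1.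
  move=> x' x'x; rewrite big1 // => z _.
  by rewrite (inj_eq (@emb_inj k P Q)) (negPf x'x) mulr0 scale0r.
rewrite /rmat mulmxDr; case: P x same => x <-.
  rewrite (@mul_RAh0 sM) ?addr0 // => x'.
  by apply/eqP => /(congr1 (@lft k)); rewrite !lft_emb.
rewrite (@mul_RAh0 sN) ?add0r // => x'.
by apply/eqP => /(congr1 (@lft k)); rewrite !lft_emb.
Qed.

Lemma mul_RA0 Q R (y : basis Q R) w : rgt w != isN Q -> bv w *m RA y = 0.
Proof.
move=> wQ; rewrite /rmat mulmxDr !mul_RAh0 ?addr0 // => x;
  by apply: contraNneq wQ => <-; rewrite rgt_emb.
Qed.

Lemma RA_ext Q (M M' : 'M[rat]_#|vertex|) :
  Pi (isN Q) *m M = M -> Pi (isN Q) *m M' = M' ->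
  (forall P (x : basis P Q), bv (emb x) *m M = bv (emb x) *m M') -> M = M'.
Proof.
move=> PM PM' MM'; rewrite -PM -PM'; apply: mx_bvP => w; rewrite !mulmxA bv_Pi.
case: eqP => wQ; last by rewrite !mul0mx.
pose sd (b : bool) := if b then sN else sM.
have [x /eqP <-] : exists x : basis (sd (lft w)) Q, emb x == w.
  by apply: emb_surj; first by case: (lft w).
exact: MM'.
Qed.

Lemma Pi_RA Q R (y : basis Q R) : Pi (isN Q) *m RA y = RA y.
Proof.
apply: mx_bvP => w; rewrite mulmxA bv_Pi; case: eqP => // /eqP wQ.
by rewrite mul0mx mul_RA0.
Qed.

(** The first identity of Frobenius reciprocity. *)
Lemma RA_tr Q R (y : basis Q R) : (RA y)^T = RA (dual A y).
Proof.
have h P : (RAh P y)^T = RAh P (dual A y).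
  transitivity (\sum_(x : basis P Q) \sum_(z : basis P R)
     (coef A z (dual A y) x)%:R *: tens (bv (emb z)) (bv (emb x))).
    rewrite /rhalf raddf_sum; apply: eq_bigr => x _.
    rewrite raddf_sum; apply: eq_bigr => z _ /=.
    have [-> _ _ _ _] := frobenius_reciprocity FA x y z.
    by rewrite linearZ /= tens_tr.
  by rewrite exchange_big.
by rewrite /rmat linearD /= !h.
Qed.

Lemma RA_Pi Q R (y : basis Q R) : RA y *m Pi (isN R) = RA y.
Proof.
rewrite -[LHS]trmxK trmx_mul Pi_tr RA_tr Pi_RA -RA_tr; exact: trmxK.
Qed.

Lemma RA_one Q : RA (Defs.one A Q) = Pi (isN Q).
Proof.
apply: (@RA_ext Q); rewrite ?Pi_RA // ?Pi_Pi ?eqxx // => P x.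
rewrite mul_RA bv_Pi rgt_emb eqxx (bigD1 x) //= (coef_one CA) eqxx scale1r.
by rewrite big1 ?addr0 // => z zx; rewrite (coef_one CA) eq_sym (negPf zx) scale0r.
Qed.

Lemma emb_one Q : emb (Defs.one A Q) = unit_of (isN Q).
Proof.
by rewrite -emb_runit; case: Q; rewrite ?(one_N CA) ?(one_M CA).
Qed.

Definition hmulA P Q (a : homog basis P Q) : 'M[rat]_#|vertex| :=
  \sum_x (a x)%:~R *: RA x.

Lemma hmulA_basis P Q (x : basis P Q) : hmulA (basis_vec x) = RA x.
Proof.
rewrite /hmulA (bigD1 x) //= ffunE eqxx scale1r big1 ?addr0 // => y yx.
by rewrite ffunE (negPf yx) scale0r.
Qed.

Lemma hrow_fmulA P Q R (a : homog basis P Q) (b : homog basis Q R) :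
  hrow (fmul A a b) = hrow a *m hmulA b.
Proof.
rewrite /hrow sum_fmul mulmx_suml; apply: eq_bigr => x _.
rewrite mulmx_sumr; apply: eq_bigr => y _.
by rewrite -scalemxAl -scalemxAr scalerA mul_RA.
Qed.

Lemma hmulA_fmul_basis P Q R (x : basis P Q) (y : basis Q R) :
  hmulA (fmul A (basis_vec x) (basis_vec y)) = \sum_z (coef A x y z)%:R *: RA z.
Proof.
rewrite /hmulA sum_fmul (bigD1 x) //= [X in _ + X]big1 ?addr0; last first.
  move=> x' x'x; rewrite big1 // => y' _.
  by rewrite ffunE (negPf x'x) mul0r scale0r.
rewrite (bigD1 y) //= [X in _ + X]big1 ?addr0.
  by rewrite !ffunE !eqxx mul1r scale1r.
by move=> y' y'y; rewrite ![basis_vec _ _]ffunE (negPf y'y) mulr0 scale0r.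
Qed.

(** Associativity, as multiplicativity of the right regular representation. *)
Lemma RA_mul Q R S (y : basis Q R) (z : basis R S) :
  RA y *m RA z = \sum_w (coef A y z w)%:R *: RA w.
Proof.
rewrite -hmulA_fmul_basis; apply: (@RA_ext Q).
- by rewrite mulmxA Pi_RA.
- rewrite /hmulA mulmx_sumr; apply: eq_bigr => w _.
  by rewrite -scalemxAr Pi_RA.
move=> P x; rewrite -hrow_basis -hrow_fmulA (fmulA FA).
by rewrite !hrow_fmulA !hmulA_basis mulmxA.
Qed.

Lemma one_RA Q R (y : basis Q R) : bv (unit_of (isN Q)) *m RA y = bv (emb y).
Proof.
by rewrite -emb_one -hrow_basis -hmulA_basis -hrow_fmulA (fmul1l FA) hrow_basis.
Qed.

Lemma RLD u v : RL (u + v) = RL u + RL v.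
Proof.
have h P Q : \sum_(y : basis P Q) crd (u + v) (emb y) *: RA y =
   \sum_(y : basis P Q) crd u (emb y) *: RA y +
   \sum_(y : basis P Q) crd v (emb y) *: RA y.
  by rewrite -big_split; apply: eq_bigr => y _; rewrite crdD scalerDl.
by rewrite rlin.unlock !h [RHS]addrACA [X in _ = X + _]addrACA [X in _ = X + _ + _]addrACA.
Qed.
Lemma RLZ a v : RL (a *: v) = a *: RL v.
Proof.
have h P Q : \sum_(y : basis P Q) crd (a *: v) (emb y) *: RA y =
   a *: \sum_(y : basis P Q) crd v (emb y) *: RA y.
  by rewrite scaler_sumr; apply: eq_bigr => y _; rewrite crdZ scalerA.
by rewrite rlin.unlock !h !scalerDr.
Qed.
Lemma RLN v : RL (- v) = - RL v.
Proof. by rewrite -scaleN1r RLZ scaleN1r. Qed.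
Lemma RL0 : RL 0 = 0.
Proof. by rewrite -(scale0r 0) RLZ scale0r. Qed.

Lemma RL_bv Q R (y : basis Q R) : RL (bv (emb y)) = RA y.
Proof.
have same : \sum_(x : basis Q R) crd (bv (emb y)) (emb x) *: RA x = RA y.
  rewrite (bigD1 y) //= crd_bv eqxx scale1r big1 ?addr0 // => x xy.
  by rewrite crd_bv (inj_eq (@emb_inj k Q R)) (negPf xy) scale0r.
have other P S : (isN P != isN Q) || (isN S != isN R) ->
    \sum_(x : basis P S) crd (bv (emb y)) (emb x) *: RA x = 0.
  move=> PS; rewrite big1 // => x _; rewrite crd_bv; case: eqP => [xy|]; last by rewrite scale0r.
  by move: PS; rewrite -(lft_emb x) -(rgt_emb x) -(lft_emb y) -(rgt_emb y) xy !eqxx.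
rewrite rlin.unlock; case: Q R y same other => [] [] y same other; rewrite same !other //;
  by rewrite ?add0r ?addr0.
Qed.

Lemma bv_ind (P : 'rV[rat]_#|vertex| -> Prop) :
  (forall Q R (y : basis Q R), P (bv (emb y))) ->
  P 0 -> (forall u v, P u -> P v -> P (u + v)) -> (forall a v, P v -> P (a *: v)) ->
  forall v, P v.
Proof.
move=> Pb P0 PD PZ v; rewrite (row_sum v); apply: big_ind => // w _; apply: PZ.
by have [Q [R [y <-]]] := vertex_emb w.
Qed.

Lemma RL_sum (I : finType) (F : I -> 'rV[rat]_#|vertex|) :
  RL (\sum_i F i) = \sum_i RL (F i).
Proof. by apply: (big_morph (fun v => RL v) RLD RL0). Qed.

Definition flip P := match P with sN => sM | sM => sN end.
Definition gen Q : basis Q (flip Q) :=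
  match Q with sN => alpha1 k | sM => balpha1 k end.

Lemma coef_gen P Q (x : basis P Q) (z : basis P (flip Q)) :
  coef A x (gen Q) z = adjv (emb x) (emb z).
Proof.
case: P Q x z => [] [] x z /=.
- exact: coef_alpha1_N CA x z.
- exact: coef_balpha1_N CA x z.
- exact: coef_alpha1_M CA x z.
- exact: coef_balpha1_M CA x z.
Qed.

Lemma Dl_emb P Q (x : basis P Q) : bv (emb x) *m Dl =
  \sum_(z : basis P (flip Q)) (adjv (emb x) (emb z))%:R *: bv (emb z).
Proof.
rewrite [LHS]row_sum (@sum_emb _ _ P (flip Q)).
  by apply: eq_bigr => z _; rewrite crd_adj.
move=> w; rewrite crd_adj; case: (boolP (adjv _ _)) => [xw|]; last by rewrite scale0r eqxx.
by rewrite (adjv_rgt xw) (adjv_lft xw) lft_emb rgt_emb; case: (Q).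
Qed.

Lemma RA_gen Q : RA (gen Q) = Pi (isN Q) *m Dl.
Proof.
apply: (@RA_ext Q); rewrite ?Pi_RA ?mulmxA ?Pi_Pi ?eqxx //.
move=> P x; rewrite mul_RA mulmxA bv_Pi rgt_emb eqxx Dl_emb.
by apply: eq_bigr => z _; rewrite coef_gen.
Qed.

(** Compatibility gives [x Delta = x alpha_1] for every basis element; by
    associativity the matrices are compatible with this too, and so with all
    polynomials in [Delta]. *)
Lemma RL_Dl v : RL (v *m Dl) = RL v *m Dl.
Proof.
elim/bv_ind: v => [Q R y||u v IHu IHv|a v IH].
- rewrite RL_bv -(RA_Pi y) -mulmxA -RA_gen RA_mul Dl_emb RL_sum.
  by apply: eq_bigr => z _; rewrite RLZ RL_bv coef_gen.
- by rewrite mul0mx RL0 mul0mx.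
- by rewrite mulmxDl !RLD IHu IHv mulmxDl.
- by rewrite -scalemxAl !RLZ IH scalemxAl.
Qed.

Lemma RL_cheb v m : RL (v *m U m) = RL v *m U m.
Proof.
elim/ltn_ind: m => -[|[|m]] IH; rewrite ?cheb0 ?cheb1 ?mulmx1 ?RL_Dl //.
rewrite chebSS !mulmxBr !mulmxA RLD RLN RL_Dl (IH m.+1) // IH //; lia.
Qed.

Lemma RL_S3 v : RL (v *m S3) = RL v *m S3.
Proof. by rewrite S3.unlock !mulmxBr !RLD !RLN !RL_cheb. Qed.

Lemma RL_unit b : RL (bv (unit_of b)) = Pi b.
Proof.
pose Q := if b then sN else sM; have <- : isN Q = b by rewrite /Q; case: (b).
by rewrite -emb_one RL_bv RA_one.
Qed.

Lemma RL_al m : (m <= n)%N -> RL (bv (al m)) = Pi true *m U m.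
Proof. by move=> mn; rewrite -one_U // RL_cheb (RL_unit true). Qed.
Lemma RL_pl m : (m <= n)%N -> RL (bv (pl m)) = Pi false *m U m.
Proof. by move=> mn; rewrite -one'_U // RL_cheb (RL_unit false). Qed.

Lemma RL_s3 : RL (bv vb3 + bv vc3) = Pi true *m S3.
Proof. by rewrite -one_S3 RL_S3 (RL_unit true). Qed.
Lemma RL_s1 : RL (bv vb1 + bv vc1) = Pi true *m U n.+1.
Proof. by rewrite -one_Un1 RL_cheb (RL_unit true). Qed.

Lemma one_RL v b : v *m Lam b = v -> bv (unit_of b) *m RL v = v.
Proof.
move=> <-; elim/bv_ind: v => [Q R y||u v IHu IHv|a v IH].
- rewrite bv_Lam lft_emb; case: eqP => [<-|_]; last by rewrite RL0 mulmx0.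
  by rewrite RL_bv one_RA.
- by rewrite mul0mx RL0 mulmx0.
- by rewrite mulmxDl RLD mulmxDr IHu IHv.
- by rewrite -scalemxAl RLZ -scalemxAr IH.
Qed.

(** * The involution is forced *)

Lemma dual_V12 (x : basis sN sM) : emb (dual A x) = bar (emb x).
Proof.
have := dual_bar CA x; rewrite /is_bar /=.
case: x => -[i||||||] ox //=; rewrite ?(ox : odd i);
  move: (dual A _) => [[j||||] oy] //=.
by move/eqP=> ->.
Qed.

Lemma dual_V21 (x : basis sM sN) : emb (dual A x) = bar (emb x).
Proof.
have [y /eqP yx] : exists y : basis sN sM, emb y == bar (emb x).
  by apply: emb_surj; rewrite ?lft_bar ?rgt_bar ?lft_emb ?rgt_emb.
have <- : dual A y = x by apply: emb_inj; rewrite dual_V12 yx barK.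
by rewrite (dualK FA) dual_V12 barK.
Qed.

Definition Ke := RL ve.

Lemma ve_U2 : ve *m U 2 = vd.
Proof. by rewrite U2E mulmxBr mulmx1 mulmxA ve_D ve2_D vsum.unlock; vring. Qed.

Lemma RL_vd : RL vd = Ke *m U 2.
Proof. by rewrite -ve_U2 RL_cheb. Qed.

Lemma Pi_RL v b : v *m Lam b = v -> Pi b *m RL v = RL v.
Proof.
move=> <-; elim/bv_ind: v => [Q R y||u v IHu IHv|a v IH].
- rewrite bv_Lam lft_emb; case: eqP => [<-|_]; last by rewrite RL0 mulmx0.
  by rewrite RL_bv Pi_RA.
- by rewrite mul0mx RL0 mulmx0.
- by rewrite mulmxDl RLD mulmxDr IHu IHv.
- by rewrite -scalemxAl RLZ -scalemxAr IH.
Qed.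

Lemma Pi_Ke : Pi true *m Ke = Ke.
Proof. exact: Pi_RL (ve_Lam k). Qed.

Lemma bv_inj (x y : vertex) : bv x = bv y -> x = y.
Proof.
move=> /(congr1 (fun v => crd v x)); rewrite !crd_bv eqxx.
by case: eqP => // _ /eqP; rewrite oner_eq0.
Qed.

Lemma bv_dual Q R (x : basis Q R) :
  bv (emb (dual A x)) = bv (unit_of (isN R)) *m (RA x)^T.
Proof. by rewrite RA_tr one_RA. Qed.

Definition tb1 : basis sN sN := exist (fun u : Gamma k => ~~ odd_vertex u) beta1 isT.
Definition tb3 : basis sN sN := exist (fun u : Gamma k => ~~ odd_vertex u) beta3 isT.
Definition tc1 : basis sN sN := exist (fun u : Gamma k => ~~ odd_vertex u) gamma1 isT.
Definition tc3 : basis sN sN := exist (fun u : Gamma k => ~~ odd_vertex u) gamma3 isT.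

Lemma RL_b1 : RL (bv vb1) = RA tb1. Proof. exact: (RL_bv tb1). Qed.
Lemma RL_b3 : RL (bv vb3) = RA tb3. Proof. exact: (RL_bv tb3). Qed.
Lemma RL_c1 : RL (bv vc1) = RA tc1. Proof. exact: (RL_bv tc1). Qed.
Lemma RL_c3 : RL (bv vc3) = RA tc3. Proof. exact: (RL_bv tc3). Qed.

(** The dual of [alpha_m] is [1 R(alpha_m)^T], and [R(alpha_m)] is symmetric for even
    [m]. *)
Lemma dual_al (x : basis sN sN) m : (m <= n)%N -> emb x = al m ->
  emb (dual A x) = al m.
Proof.
move=> mn xm; have om : odd m = false.
  by apply/negbTE; rewrite -(rgt_al mn) -xm rgt_emb.
apply: bv_inj; rewrite bv_dual -RL_bv xm RL_al // Pi_U om addbF mulmxA.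
by rewrite (one_Pi k true) one_U.
Qed.

(** The image of a pair under the involution is known at first only through its
    sum. *)
Lemma pair_eq (x y u v : vertex) : bv x + bv y = bv u + bv v ->
  (x = u /\ y = v) \/ (x = v /\ y = u).
Proof.
move=> xyuv; have := congr1 (fun w => crd w x) xyuv; rewrite /= !crdD !crd_bv eqxx.
case: (eqVneq x u) => [xu _|_].
  by left; split=> //; apply: bv_inj; apply: (addrI (bv x)); rewrite xyuv xu.
case: (eqVneq x v) => [xv _|_].
  by right; split=> //; apply: bv_inj; apply: (addrI (bv x)); rewrite xyuv xv addrC.
by case: eqP => _ /eqP; rewrite -?natrD.
Qed.

Lemma dual_1 : exists s : bool,
  emb (dual A tb1) = (if s then vc1 else vb1) /\
  emb (dual A tc1) = (if s then vb1 else vc1).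
Proof.
have /pair_eq : bv (emb (dual A tb1)) + bv (emb (dual A tc1)) = bv vb1 + bv vc1.
  rewrite !bv_dual -mulmxDr -linearD /= -RL_b1 -RL_c1 -RLD RL_s1 Pi_U.
  by rewrite oddS odd_nk addbF mulmxA (one_Pi k true) one_Un1.
by case=> -[-> ->]; [exists false | exists true].
Qed.

Lemma dual_3 : exists s : bool,
  emb (dual A tb3) = (if s then vc3 else vb3) /\
  emb (dual A tc3) = (if s then vb3 else vc3).
Proof.
have /pair_eq : bv (emb (dual A tb3)) + bv (emb (dual A tc3)) = bv vb3 + bv vc3.
  rewrite !bv_dual -mulmxDr -linearD /= -RL_b3 -RL_c3 -RLD RL_s3.
  by rewrite trmx_mul S3_tr Pi_tr -Pi_S3 mulmxA (one_Pi k true) one_S3.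
by case=> -[-> ->]; [exists false | exists true].
Qed.

Definition sgb (s : bool) : rat := if s then -1 else 1.

Lemma RL_bar Q R (y : basis Q R) w : emb (dual A y) = w ->
  (RL (bv (emb y)))^T = RL (bv w).
Proof. by move=> <-; rewrite !RL_bv RA_tr. Qed.

Lemma Ke_tr s : emb (dual A tb3) = (if s then vc3 else vb3) ->
  emb (dual A tc3) = (if s then vb3 else vc3) -> Ke^T = sgb s *: Ke.
Proof.
move=> h1 h2; have e1 := RL_bar h1; have e2 := RL_bar h2.
rewrite /Ke ve.unlock RLD RLN linearB /= -[vb3]/(emb tb3) -[vc3]/(emb tc3) e1 e2.
by case: s {e1 e2 h1 h2}; rewrite /sgb ?scale1r // scaleN1r opprB.
Qed.

Lemma KeU2_tr s : emb (dual A tb1) = (if s then vc1 else vb1) ->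
  emb (dual A tc1) = (if s then vb1 else vc1) -> (Ke *m U 2)^T = sgb s *: (Ke *m U 2).
Proof.
move=> h1 h2; have e1 := RL_bar h1; have e2 := RL_bar h2.
rewrite -RL_vd vd.unlock RLD RLN linearB /= -[vb1]/(emb tb1) -[vc1]/(emb tc1) e1 e2.
by case: s {e1 e2 h1 h2}; rewrite /sgb ?scale1r // scaleN1r opprB.
Qed.

Definition tb2 : basis sN sM := exist (fun u : Gamma k => odd_vertex u) beta2 isT.
Definition tc2 : basis sN sM := exist (fun u : Gamma k => odd_vertex u) gamma2 isT.

Lemma KeD_tr : (Ke *m Dl)^T = RL (ve2 *m J).
Proof.
have e1 := RL_bar (dual_V12 tb2); have e2 := RL_bar (dual_V12 tc2).
rewrite -RL_Dl ve_D ve2.unlock RLD RLN linearB /= -[vb2]/(emb tb2) -[vc2]/(emb tc2).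
by rewrite e1 e2 mulmxBl !bv_J RLD RLN.
Qed.

(** The image of [e Delta = beta_2 - gamma_2] under the involution is annihilated by
    [Delta], because both ends of it are attached to the same vertex [g]. *)
Lemma Dl_Ke_Dl : Dl *m Ke *m Dl = 0.
Proof.
have z : (Ke *m Dl)^T *m Dl = 0 by rewrite KeD_tr -RL_Dl ve2J_D RL0.
have [s [h1 h2]] := dual_3; move: z; rewrite trmx_mul Dl_tr (Ke_tr h1 h2).
rewrite -scalemxAr -scalemxAl => /eqP; rewrite scaler_eq0 => /orP[|/eqP //].
by case: s {h1 h2}.
Qed.

Lemma KeD_neq0 : Ke *m Dl != 0.
Proof.
apply/eqP => /(congr1 (fun M => bv (al 0) *m M)).
rewrite /= -RL_Dl ve_D (@one_RL _ true (ve2_Lam k)) mulmx0.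
move/(congr1 (fun v => crd v vb2)); rewrite ve2.unlock !(crdD, crdN, crd_bv, crd0).
by rewrite !eqvE.
Qed.

(** Transposing [R(beta_1 - gamma_1) = Ke U_2] with signs [s] and [t] for the two
    pairs gives [s U_2 Ke = t Ke U_2].  Multiplied by [Delta] on the right, it becomes
    [- s Ke Delta = t Ke Delta] since [Delta Ke Delta = 0]; hence [t = - s]. *)
Lemma dual_signs : exists s : bool,
  [/\ emb (dual A tb3) = (if s then vc3 else vb3),
      emb (dual A tc3) = (if s then vb3 else vc3),
      emb (dual A tb1) = (if s then vb1 else vc1),
      emb (dual A tc1) = (if s then vc1 else vb1)
    & [/\ Ke^T = sgb s *: Ke & U 2 *m Ke = - (Ke *m U 2)]].
Proof.
have [s [h1 h2]] := dual_3; have [t [g1 g2]] := dual_1.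
have UK : sgb s *: (U 2 *m Ke) = sgb t *: (Ke *m U 2).
  by rewrite -(KeU2_tr g1 g2) trmx_mul (Ke_tr h1 h2) U2_tr scalemxAr.
have UKD : U 2 *m Ke *m Dl = - (Ke *m Dl).
  by rewrite U2E !mulmxBl mul1mx -!mulmxA (mulmxA Dl Ke) Dl_Ke_Dl mulmx0 sub0r.
have KUD : Ke *m U 2 *m Dl = Ke *m Dl.
  rewrite -RL_vd -!RL_Dl; congr (RL _); by rewrite vd_D ve_D.
have := congr1 (fun M => M *m Dl) UK; rewrite /= -!scalemxAl UKD KUD => st.
have tE : t = ~~ s.
  apply/eqP; rewrite -[_ == _]negbK; apply/negP => tns.
  have ts : t = s by case: (t) (s) tns => [] [].
  move: st; rewrite ts => /eqP; rewrite -subr_eq0 -scalerBr scaler_eq0.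
  have -> : (sgb s == 0) = false by case: (s).
  rewrite /= -opprD oppr_eq0 -mulr2n -scaler_nat scaler_eq0 pnatr_eq0 /=.
  by rewrite (negPf KeD_neq0).
exists s; split=> //.
- by apply: (etrans g1); rewrite tE; case: (s).
- by apply: (etrans g2); rewrite tE; case: (s).
split; first exact: Ke_tr h1 h2.
by move: UK; rewrite tE; case: (s); rewrite /sgb /= ?scaleN1r ?scale1r // => <-;
  rewrite opprK.
Qed.

(** The structure constants of the N-N part as a trilinear form; Frobenius
    reciprocity can then be applied to [e] and [beta_1 - gamma_1] directly. *)
Definition trif u v w := dot (u *m RL v) w.
Definition barNN : 'M[rat]_#|vertex| :=
  \sum_(x : basis sN sN) tens (bv (emb x)) (bv (emb (dual A x))).
Definition inNN (u : 'rV[rat]_#|vertex|) := u *m Lam true = u /\ u *m Pi true = u.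

Lemma bv_barNN (x : basis sN sN) : bv (emb x) *m barNN = bv (emb (dual A x)).
Proof.
rewrite /barNN mulmx_sumr (bigD1 x) //= [X in _ + X]big1 ?addr0.
  by rewrite mul_tens dot_bv crd_bv eqxx scale1r.
move=> y yx; rewrite mul_tens dot_bv crd_bv.
by rewrite (inj_eq (@emb_inj k sN sN)) (negPf yx) scale0r.
Qed.

Lemma nn_ind (P : 'rV[rat]_#|vertex| -> Prop) :
  (forall x : basis sN sN, P (bv (emb x))) -> P 0 ->
  (forall u v, P u -> P v -> P (u + v)) -> (forall a v, P v -> P (a *: v)) ->
  forall v, inNN v -> P v.
Proof.
move=> Pb P0 PD PZ v [vL vP]; rewrite (row_sum v) (@sum_emb k _ sN sN).
  by apply: big_ind => // x _; apply: PZ.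
move=> w; rewrite scaler_eq0 negb_or => /andP[vw _]; split.
  by move: vw; rewrite -vL crd_Lam; case: (lft w); rewrite ?eqxx.
by move: vw; rewrite -vP crd_Pi; case: (rgt w); rewrite ?eqxx.
Qed.

Lemma trif_bv (x y z : basis sN sN) :
  trif (bv (emb x)) (bv (emb y)) (bv (emb z)) = (coef A x y z)%:R.
Proof.
rewrite /trif RL_bv mul_RA dot_bv crd_sum (bigD1 z) //= crdZ crd_bv eqxx mulr1.
rewrite big1 ?addr0 // => w wz.
by rewrite crdZ crd_bv (inj_eq (@emb_inj k sN sN)) eq_sym (negPf wz) mulr0.
Qed.

Lemma trifDl u u' v w : trif (u + u') v w = trif u v w + trif u' v w.
Proof. by rewrite /trif mulmxDl dotDl. Qed.
Lemma trifZl a u v w : trif (a *: u) v w = a * trif u v w.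
Proof. by rewrite /trif -scalemxAl dotZl. Qed.
Lemma trif0l v w : trif 0 v w = 0.
Proof. by rewrite /trif mul0mx dot0l. Qed.
Lemma trifDm u v v' w : trif u (v + v') w = trif u v w + trif u v' w.
Proof. by rewrite /trif RLD mulmxDr dotDl. Qed.
Lemma trifZm a u v w : trif u (a *: v) w = a * trif u v w.
Proof. by rewrite /trif RLZ -scalemxAr dotZl. Qed.
Lemma trif0m u w : trif u 0 w = 0.
Proof. by rewrite /trif RL0 mulmx0 dot0l. Qed.
Lemma trifDr u v w w' : trif u v (w + w') = trif u v w + trif u v w'.
Proof. by rewrite /trif dotDr. Qed.
Lemma trifZr a u v w : trif u v (a *: w) = a * trif u v w.
Proof. by rewrite /trif dotZr. Qed.
Lemma trif0r u v : trif u v 0 = 0.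
Proof. by rewrite /trif dot0r. Qed.
Lemma trifNl u v w : trif (- u) v w = - trif u v w.
Proof. by rewrite -scaleN1r trifZl mulN1r. Qed.
Lemma trifNr u v w : trif u v (- w) = - trif u v w.
Proof. by rewrite -scaleN1r trifZr mulN1r. Qed.

Lemma trif_swap u v w : inNN u -> inNN v -> inNN w ->
  trif u v w = trif (u *m barNN) w v.
Proof.
move=> Nu Nv Nw; elim/nn_ind: Nu => [x||u1 u2 H1 H2|a u1 H1].
- elim/nn_ind: Nv => [y||u1 u2 H1 H2|a u1 H1].
  + elim/nn_ind: Nw => [z||u1 u2 H1 H2|a u1 H1].
    * rewrite bv_barNN !trif_bv.
      by have [_ -> _ _ _] := frobenius_reciprocity FA x y z.
    * by rewrite trif0r trif0m.
    * by rewrite trifDr trifDm H1 H2.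
    * by rewrite trifZr trifZm H1.
  + by rewrite trif0r trif0m.
  + by rewrite trifDr trifDm H1 H2.
  + by rewrite trifZr trifZm H1.
- by rewrite mul0mx !trif0l.
- by rewrite mulmxDl !trifDl H1 H2.
- by rewrite -scalemxAl !trifZl H1.
Qed.

Lemma trif_rev u v w : inNN u -> inNN v -> inNN w ->
  trif u v w = trif (v *m barNN) (u *m barNN) (w *m barNN).
Proof.
move=> Nu Nv Nw; elim/nn_ind: Nu => [x||u1 u2 H1 H2|a u1 H1].
- elim/nn_ind: Nv => [y||u1 u2 H1 H2|a u1 H1].
  + elim/nn_ind: Nw => [z||u1 u2 H1 H2|a u1 H1].
    * rewrite !bv_barNN !trif_bv.
      by have [_ _ -> _ _] := frobenius_reciprocity FA x y z.
    * by rewrite mul0mx !trif0r.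
    * by rewrite mulmxDl !trifDr H1 H2.
    * by rewrite -scalemxAl !trifZr H1.
  + by rewrite mul0mx trif0l trif0m.
  + by rewrite mulmxDl trifDl trifDm H1 H2.
  + by rewrite -scalemxAl trifZl trifZm H1.
- by rewrite mul0mx trif0l trif0m.
- by rewrite mulmxDl trifDl trifDm H1 H2.
- by rewrite -scalemxAl trifZl trifZm H1.
Qed.

Local Notation s3 := (bv vb3 + bv vc3).
Local Notation s1 := (bv vb1 + bv vc1).

Lemma inNN_bv (x : basis sN sN) : inNN (bv (emb x)).
Proof. by split; rewrite ?bv_Lam ?bv_Pi ?lft_emb ?rgt_emb. Qed.
Lemma inNND u v : inNN u -> inNN v -> inNN (u + v).
Proof. by move=> [? ?] [? ?]; split; rewrite mulmxDl; congr (_ + _). Qed.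
Lemma inNN_e : inNN ve. Proof. by split; rewrite ?ve_Lam ?ve_Pi. Qed.
Lemma inNN_d : inNN vd. Proof. by split; rewrite ?vd_Lam ?vd_Pi. Qed.
Lemma inNN_s3 : inNN s3.
Proof. exact: inNND (inNN_bv tb3) (inNN_bv tc3). Qed.
Lemma inNN_s1 : inNN s1.
Proof. exact: inNND (inNN_bv tb1) (inNN_bv tc1). Qed.

Lemma vd_U2 : vd *m U 2 = ve.
Proof. by rewrite U2E mulmxBr mulmx1 mulmxA vd_D ve2_D vsum.unlock; vring. Qed.

Lemma dot_U2 u v : dot (u *m U 2) v = dot u (v *m U 2).
Proof. by rewrite dot_adj U2_tr. Qed.

Lemma s3_U2 : s3 *m U 2 = s1.
Proof. by rewrite mulmxDl b3_U2 c3_U2. Qed.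

Lemma RL_s1_S3 : RL s1 = Pi true *m S3 *m U 2.
Proof. by rewrite -s3_U2 RL_cheb RL_s3. Qed.

Lemma trif_s3 u w : inNN u -> trif u s3 w = dot (u *m S3) w.
Proof. by case=> _ uP; rewrite /trif RL_s3 mulmxA uP. Qed.
Lemma trif_s1 u w : inNN u -> trif u s1 w = dot (u *m S3) (w *m U 2).
Proof. by case=> _ uP; rewrite /trif RL_s1_S3 !mulmxA uP dot_U2. Qed.
Lemma trif_d u w : trif u vd w = trif u ve (w *m U 2).
Proof. by rewrite /trif RL_vd mulmxA dot_U2. Qed.

Lemma trif_halves a b c d u v :
  trif ((1/2) *: (a + b)) ((1/2) *: (c + d)) ((1/2) *: (u + v)) =
  (trif a c u + trif a c v + trif a d u + trif a d v
   + trif b c u + trif b c v + trif b d u + trif b d v) / 8.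
Proof. by rewrite !(trifDl, trifDm, trifDr, trifZl, trifZm, trifZr); field. Qed.

(** With [beta_3 = (s3 + e) / 2] and [beta_1 = (s1 + d) / 2], where [s3], [s1] are
    the sums and [e], [d] the differences of the pairs, eight times a coefficient of
    [beta_3 beta_3] is a sum of eight values of the trilinear form.  Those with only
    [e] and [d] vanish and the others reduce to [S3].  The sum of the
    coefficients at [beta_3] and [beta_1] then comes out as half an odd
    integer. *)
Lemma not_selfdual :
  emb (dual A tb3) = vb3 -> emb (dual A tc3) = vc3 ->
  emb (dual A tb1) = vc1 -> emb (dual A tc1) = vb1 ->
  Ke^T = Ke -> U 2 *m Ke = - (Ke *m U 2) -> False.
Proof.
move=> h3 g3 h1 g1 KT UK.
have J3 : bv vb3 *m barNN = bv vb3 by rewrite -[vb3]/(emb tb3) bv_barNN h3.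
have J3' : bv vc3 *m barNN = bv vc3 by rewrite -[vc3]/(emb tc3) bv_barNN g3.
have J1 : bv vb1 *m barNN = bv vc1 by rewrite -[vb1]/(emb tb1) bv_barNN h1.
have J1' : bv vc1 *m barNN = bv vb1 by rewrite -[vc1]/(emb tc1) bv_barNN g1.
have eJ : ve *m barNN = ve by rewrite ve.unlock mulmxBl J3 J3'.
have dJ : vd *m barNN = - vd by rewrite vd.unlock mulmxBl J1 J1' opprB.
have s3J : s3 *m barNN = s3 by rewrite mulmxDl J3 J3'.
have s1J : s1 *m barNN = s1 by rewrite mulmxDl J1 J1' addrC.
have Ne := inNN_e; have Nd := inNN_d; have N3 := inNN_s3; have N1 := inNN_s1.
have eed : trif ve ve vd = 0.
  by have := trif_rev Ne Ne Nd; rewrite eJ dJ trifNr; lra.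
have eee : trif ve ve ve = 0.
  (* <d e, d> is - <e e, e> by UK, and it is its own negative by reciprocity. *)
  have := trif_swap Nd Nd Ne; rewrite dJ trifNl trif_d ve_U2.
  have -> : trif vd ve vd = - trif ve ve ve.
    rewrite /trif -/Ke -{1}ve_U2 -mulmxA UK mulmxN mulmxA dotNl dot_U2.
    by rewrite vd_U2.
  by lra.
have e1 : trif s3 ve s3 = dot (ve *m S3) s3.
  by rewrite (trif_rev N3 Ne N3) eJ s3J trif_s3.
have e2 : trif s3 ve s1 = dot (ve *m S3) s1.
  by rewrite (trif_rev N3 Ne N1) eJ s3J s1J trif_s3.
have e3 : trif s3 ve ve = dot (ve *m S3) ve.
  by rewrite (trif_rev N3 Ne Ne) eJ s3J trif_s3.
have e4 : trif s3 ve vd = - dot (ve *m S3) vd.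
  by rewrite (trif_rev N3 Ne Nd) eJ s3J dJ trifNr trif_s3.
have e5 : trif ve ve s3 = dot (ve *m S3) ve.
  by rewrite (trif_swap Ne Ne N3) eJ trif_s3.
have e6 : trif ve ve s1 = dot (ve *m S3) vd.
  by rewrite (trif_swap Ne Ne N1) eJ trif_s1 // ve_U2.
have b3E : bv vb3 = (1/2) *: (s3 + ve).
  rewrite ve.unlock; vring.
have b1E : bv vb1 = (1/2) *: (s1 + vd).
  rewrite vd.unlock; vring.
have [x1 x2 x3 x4] := crd_S3 k true; have [y1 y2 y3 y4] := crd_S3 k false.
have := trif_bv tb3 tb3 tb3; have := trif_bv tb3 tb3 tb1.
rewrite -![emb tb3]/vb3 -![emb tb1]/vb1 b1E b3E.
rewrite !trif_halves !trif_s3 // e1 e2 e3 e4 e5 e6 eed eee.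
have eS x : crd (ve *m S3) x = crd (bv vb3 *m S3) x - crd (bv vc3 *m S3) x.
  by rewrite ve.unlock mulmxBl crdD crdN.
have sS x : crd (s3 *m S3) x = crd (bv vb3 *m S3) x + crd (bv vc3 *m S3) x.
  by rewrite mulmxDl crdD.
have dte u : dot u ve = crd u vb3 - crd u vc3 by rewrite ve.unlock !dotLE !dot_bv.
have dtd u : dot u vd = crd u vb1 - crd u vc1 by rewrite vd.unlock !dotLE !dot_bv.
have dt3 u : dot u s3 = crd u vb3 + crd u vc3 by rewrite dotDr !dot_bv.
have dt1 u : dot u s1 = crd u vb1 + crd u vc1 by rewrite dotDr !dot_bv.
rewrite !(dte, dtd, dt3, dt1) !(eS, sS).
rewrite /= in x1 x2 x3 x4 y1 y2 y3 y4.
rewrite !x1 !x2 !x3 !x4 !y1 !y2 !y3 !y4.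
have [q0 p0 _] := htribo_double k; have [q1 p1 _] := htribo_double k.+1.
rewrite doubleS /= negbK in q1 p1.
rewrite p0 p1 !natrD q0 q1.
move: (htribo false k.*2)./2 (htribo false k.*2.+2)./2 => h h'.
rewrite -!muln2 !natrM => c1 c2.
have nat_inj (a b : nat) : a%:R = b%:R :> rat -> a = b by move/eqP; rewrite eqr_nat => /eqP.
(* By c1 and c2, eight times the sum of the two coefficients is congruent to 4
   modulo 8. *)
case: (odd k) c1 c2 => /= c1 c2.
  have : ((coef A tb3 tb3 tb3 + coef A tb3 tb3 tb1) * 8)%N = (8 * (h + h') + 4)%N.
    by apply: nat_inj; rewrite !(natrM, natrD) -c1 -c2; field.
  by lia.
have : ((coef A tb3 tb3 tb3 + coef A tb3 tb3 tb1) * 8 + 4)%N = (8 * (h + h'))%N.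
  by apply: nat_inj; rewrite !(natrM, natrD) -c1 -c2; field.
by lia.
Qed.

Lemma dual_b : [/\ emb (dual A tb3) = vc3, emb (dual A tc3) = vb3,
    emb (dual A tb1) = vb1, emb (dual A tc1) = vc1 & Ke^T = - Ke].
Proof.
have [[] [h3 g3 h1 g1 [KT UK]]] := dual_signs.
  by split=> //; rewrite KT /sgb scaleN1r.
by case: (not_selfdual h3 g3 h1 g1 _ UK); rewrite KT /sgb scale1r.
Qed.

Lemma dual_V11 (z : basis sN sN) : emb (dual A z) = bar (emb z).
Proof.
have [h3 g3 h1 g1 _] := dual_b.
have same (y : basis sN sN) : emb z = emb y -> z = y by apply: emb_inj.
have := lft_emb z; have := rgt_emb z; have := erefl (emb z).
case: {2 3 4}(emb z) / (vertexP (emb z)) => [m mn||||||| m mn||||] zE //.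
- rewrite rgt_al // => om _; rewrite (dual_al mn zE) zE bar_al //.
  by rewrite (negPf om).
- by move=> _ _; rewrite zE barE (same tb1 zE).
- by move=> _ _; rewrite zE barE (same tb3 zE).
- by move=> _ _; rewrite zE barE (same tc1 zE).
- by move=> _ _; rewrite zE barE (same tc3 zE).
Qed.

Lemma dual_N P (z : basis P sN) : emb (dual A z) = bar (emb z).
Proof. by case: P z => z; [apply: dual_V11 | apply: dual_V21]. Qed.

(** * The product with the difference is forced *)

(** The involution writes [x e] in terms of [e bar(x)]. *)
Lemma row_Ke P (x : basis P sN) : bv (emb x) *m Ke = - (ve *m RA (dual A x) *m J).
Proof.
have rowb (y : basis sN sN) :
    bv (emb x) *m RA y = bv (bar (emb y)) *m RA (dual A x) *m J.
  rewrite mul_RA -dual_V11 mul_RA mulmx_suml.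
  rewrite [RHS](reindex (@dual _ A P sN)); last first.
    by exists (@dual _ A sN P) => z _; rewrite (dualK FA).
  apply: eq_bigr => z _; rewrite -scalemxAl bv_J dual_N barK.
  by have [_ _ -> _ _] := frobenius_reciprocity FA x y z.
rewrite /Ke ve.unlock RLD RLN RL_b3 RL_c3 mulmxBr !rowb !barE.
by rewrite !mulmxBl opprB.
Qed.

Lemma row_Rdif (x : vertex) : rgt x = true ->
  bv x *m Rdif = - (ve *m rmul (bar x) *m J).
Proof.
move=> rx; have -> : Rdif = rmul vb3 - rmul vc3.
  rewrite !rmulE Rb3E Rc3E; mring.
rewrite mulmxBr (@rmul_bar k x vb3 rx) (@rmul_bar k x vc3 rx) !barE.
by rewrite ve.unlock !mulmxBl opprB.
Qed.

Definition defect := Ke - Rdif.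

Lemma defect_tr : defect^T = - defect.
Proof.
have [_ _ _ _ KT] := dual_b.
by rewrite /defect linearB /= KT Rdif_tr opprB addrC opprK.
Qed.

Lemma defect_anti x y : crd (bv x *m defect) y = - crd (bv y *m defect) x.
Proof. by rewrite crd_tr defect_tr mulmxN crdN. Qed.

Lemma row_defect P (x : basis P sN) : bv (emb x) *m defect =
  - (ve *m (RL (bv (bar (emb x))) - rmul (bar (emb x))) *m J).
Proof.
rewrite /defect mulmxBr row_Ke row_Rdif ?rgt_emb // -dual_N RL_bv.
by rewrite mulmxBr mulmxBl opprB addrC opprK.
Qed.

Lemma defect_M x : rgt x = false -> bv x *m defect = 0.
Proof.
move=> rx; rewrite /defect -Pi_Ke -Pi_Rdif -mulmxBr mulmxA bv_Pi rx.
by rewrite mul0mx.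
Qed.

(** Products with the elements of the long paths are polynomials in [Delta] in both
    algebras. *)
Lemma defect_path x :
  match x with inl (alpha _) | inr (palpha _) => True | _ => False end ->
  bv x *m defect = 0.
Proof.
move=> xA; case rx: (rgt x); last exact: defect_M.
have [P [y yx]] : exists P (y : basis P sN), emb y = x.
  have [P [Q [y yx]]] := vertex_emb x; exists P; move: rx; rewrite -yx rgt_emb.
  by case: Q y yx => // y yx _; exists y.
rewrite -yx row_defect yx.
suff -> : RL (bv (bar x)) = rmul (bar x) by rewrite subrr mulmx0 mul0mx oppr0.
case: (vertexP x) xA => [m mn||||||| m mn||||] // _.
- by rewrite bar_al //; case: ifP => _; rewrite ?RL_pl ?RL_al ?rmul_pl ?rmul_al.
- by rewrite bar_pl //; case: ifP => _; rewrite ?RL_pl ?RL_al ?rmul_pl ?rmul_al.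
Qed.

Definition tbb : basis sM sN := exist (fun u : Gamma' k => odd_vertex' u) bbeta2 isT.
Definition tbc : basis sM sN := exist (fun u : Gamma' k => odd_vertex' u) bgamma2 isT.

Lemma Rb3D_Rc3 : Rb3 + Rc3 = Pi true *m S3.
Proof. rewrite Rb3E Rc3E; mring. Qed.

(** Products with [beta_3 + gamma_3] are polynomials in [Delta] in both algebras.  The
    same argument gives the next two lemmas. *)
Lemma defect_pair3 : bv vb3 *m defect = - (bv vc3 *m defect).
Proof.
rewrite (row_defect tb3) (row_defect tc3) !barE !rmulE opprK.
apply/eqP; rewrite -subr_eq0 -opprD oppr_eq0 -mulmxDl -mulmxDr.
have -> : RL (bv vc3) - Rc3 + (RL (bv vb3) - Rb3) = 0.
  have -> : RL (bv vb3) = Pi true *m S3 - RL (bv vc3) by rewrite -RL_s3 RLD addrK.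
  by rewrite -Rb3D_Rc3; mring.
by rewrite mulmx0 mul0mx.
Qed.

Lemma defect_pair1 : bv vb1 *m defect = - (bv vc1 *m defect).
Proof.
rewrite (row_defect tb1) (row_defect tc1) !barE !rmulE opprK.
apply/eqP; rewrite -subr_eq0 -opprD oppr_eq0 -mulmxDl -mulmxDr.
have -> : RL (bv vb1) - Rb3 *m U 2 + (RL (bv vc1) - Rc3 *m U 2) = 0.
  have -> : RL (bv vb1) = Pi true *m S3 *m U 2 - RL (bv vc1) by rewrite -RL_s1_S3 RLD addrK.
  by rewrite -Rb3D_Rc3 mulmxDl; mring.
by rewrite mulmx0 mul0mx.
Qed.

Lemma defect_pair2 : bv vbb *m defect = - (bv vbc *m defect).
Proof.
rewrite (row_defect tbb) (row_defect tbc) !barE !rmulE opprK.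
apply/eqP; rewrite -subr_eq0 -opprD oppr_eq0 -mulmxDl -mulmxDr.
have -> : RL (bv vb2) - Rb3 *m Dl + (RL (bv vc2) - Rc3 *m Dl) = 0.
  have -> : RL (bv vb2) = Pi true *m S3 *m Dl - RL (bv vc2).
    by rewrite -RL_s3 -RL_Dl mulmxDl !bvDE RLD addrK.
  by rewrite -Rb3D_Rc3 mulmxDl; mring.
by rewrite mulmx0 mul0mx.
Qed.

(** Reciprocity exchanges the last two arguments of the trilinear form at the price of
    the sign of [e] under the involution: [<e e, d> = - <e d, e>].  As
    [R(d) = Ke U_2] and [e U_2 = d], the right-hand side is [- <e e, d>]. *)
Lemma Ke_ed : dot (ve *m Ke) vd = 0.
Proof.
have [h3 g3 _ _ _] := dual_b.
have eJ : ve *m barNN = - ve.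
  by rewrite ve.unlock mulmxBl -[vb3]/(emb tb3) -[vc3]/(emb tc3) !bv_barNN h3 g3 opprB.
have := trif_swap inNN_e inNN_d inNN_e; rewrite eJ trifNl trif_d ve_U2 /trif -/Ke; lra.
Qed.

Lemma Rdif_ed : dot (ve *m Rdif) vd = 0.
Proof.
have de v : dot v ve = crd v vb3 - crd v vc3 by rewrite ve.unlock !dotLE !dot_bv.
have dd v : dot v vd = crd v vb1 - crd v vc1 by rewrite vd.unlock !dotLE !dot_bv.
have z1 : dot ve (ve2 *m J) = 0 by exact: dot_Lam (ve_Lam k) (ve2J_Lam k).
have z2 : dot ve (X2 *m Dl *m J) = 0 by exact: dot_Lam (ve_Lam k) (X2DJ_Lam k).
rewrite mul_Rdif z1 z2 !(dotC ve) !de !(dotZl, dotDl, dotNl) !dd.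
by rewrite X0.unlock X2.unlock !onN_E; ring.
Qed.

Lemma defect_13 : crd (bv vb1 *m defect) vb3 = 0.
Proof.
have : dot (ve *m defect) vd = 0.
  by rewrite /defect mulmxBr dotDl dotNl Ke_ed Rdif_ed subr0.
have f1 x : crd (bv vc1 *m defect) x = - crd (bv vb1 *m defect) x.
  by rewrite defect_pair1 crdN opprK.
have f3 x : crd (bv vc3 *m defect) x = - crd (bv vb3 *m defect) x.
  by rewrite defect_pair3 crdN opprK.
have a1 := defect_anti vb3 vb1.
have a2 : crd (bv vb3 *m defect) vc1 = crd (bv vb1 *m defect) vb3.
  by rewrite defect_anti f1 opprK.
rewrite ve.unlock vd.unlock mulmxBl !dotLE !dot_bv !f3 a1 a2; lra.
Qed.

Lemma defect_Lam x : bv x *m defect = bv x *m defect *m Lam (lft x).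
Proof.
rewrite /defect mulmxBr mulmxBl -(mulmxA _ Rdif) -Lam_Rdif mulmxA bv_Lam eqxx.
congr (_ - _); have [P [Q [y <-]]] := vertex_emb x.
have h (z : basis sN sN) : bv (emb y) *m RA z = bv (emb y) *m RA z *m Lam (lft (emb y)).
  case: Q y => y; last by rewrite mul_RA0 ?mul0mx // rgt_emb.
  rewrite mul_RA mulmx_suml; apply: eq_bigr => w _.
  by rewrite -scalemxAl bv_Lam !lft_emb eqxx.
by rewrite /Ke ve.unlock RLD RLN RL_b3 RL_c3 mulmxBr mulmxBl -!h.
Qed.

(** Rows and columns at the long paths and at the elements with right label M
    vanish.  Entries between an element of a pair and its partner, or itself,
    vanish by antisymmetry; only those between the pairs [{beta_1, gamma_1}] and
    [{beta_3, gamma_3}] remain, all equal up to sign to the one of [defect_13]. *)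
Lemma defect0 : defect = 0.
Proof.
have diag x : crd (bv x *m defect) x = 0 by have := defect_anti x x; lra.
have col x y : bv y *m defect = 0 -> crd (bv x *m defect) y = 0.
  by move=> y0; rewrite defect_anti y0 crd0 oppr0.
have lr x y : lft x != lft y -> crd (bv x *m defect) y = 0.
  by move=> xy; rewrite defect_Lam crd_Lam eq_sym (negPf xy).
have b1 : bv vb1 *m defect = 0.
  apply: crdP => z; rewrite crd0.
  case: (vertexP z) => [m mn||||||| m mn||||]; try by [apply: lr | apply: diag].
  - by apply: col; apply: defect_path.
  - by apply: col; apply: defect_M.
  - exact: defect_13.
  - by rewrite defect_pair1 crdN diag oppr0.
  - by apply: col; apply: defect_M.
  - by rewrite defect_anti -[bv vc3 *m _]opprK -defect_pair3 crdN -defect_anti defect_13 oppr0.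
have b3 : bv vb3 *m defect = 0.
  apply: crdP => z; rewrite crd0.
  case: (vertexP z) => [m mn||||||| m mn||||]; try by [apply: lr | apply: diag].
  - by apply: col; apply: defect_path.
  - exact: col.
  - by apply: col; apply: defect_M.
  - by apply: col; rewrite -[LHS]opprK -defect_pair1 b1 oppr0.
  - by apply: col; apply: defect_M.
  - by rewrite defect_pair3 crdN diag oppr0.
have bb : bv vbb *m defect = 0.
  apply: crdP => z; rewrite crd0.
  case: (vertexP z) => [m mn||||||| m mn||||]; try by [apply: lr | apply: diag].
  - by apply: col; apply: defect_path.
  - by apply: col; apply: defect_M.
  - by apply: col; apply: defect_M.
  - by rewrite defect_pair2 crdN diag oppr0.
apply: mx_bvP => x; rewrite mulmx0.
case: (vertexP x) => [m mn||||||| m mn||||]; try by [apply: defect_M | apply: defect_path].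
- exact: b1.
- exact: b3.
- by rewrite -[LHS]opprK -defect_pair1 b1 oppr0.
- by rewrite -[LHS]opprK -defect_pair3 b3 oppr0.
- exact: bb.
- by rewrite -[LHS]opprK -defect_pair2 bb oppr0.
Qed.

Lemma RL_rmul x : RL (bv x) = rmul x.
Proof.
have KE : Ke = Rdif by apply/eqP; rewrite -subr_eq0; apply/eqP; exact: defect0.
have b3E : RL (bv vb3) = Rb3.
  have -> : bv vb3 = (1/2) *: (bv vb3 + bv vc3) + (1/2) *: ve.
    by rewrite ve.unlock; vring.
  by rewrite RLD !RLZ RL_s3 -/Ke KE Rb3E.
have c3E : RL (bv vc3) = Rc3.
  have -> : bv vc3 = (1/2) *: (bv vb3 + bv vc3) - (1/2) *: ve.
    by rewrite ve.unlock; vring.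
  by rewrite RLD RLN !RLZ RL_s3 -/Ke KE Rc3E.
have b2E : RL (bv vb2) = Rb3 *m Dl by rewrite -bvD_b3 RL_Dl b3E.
have c2E : RL (bv vc2) = Rc3 *m Dl by rewrite -bvD_c3 RL_Dl c3E.
have bbE : RL (bv vbb) = Dl *m Rc3.
  have := RL_bar (dual_V12 tb2); rewrite -[emb tb2]/vb2 barE => <-.
  by rewrite b2E trmx_mul Dl_tr Rb3_tr.
have bcE : RL (bv vbc) = Dl *m Rb3.
  have := RL_bar (dual_V12 tc2); rewrite -[emb tc2]/vc2 barE => <-.
  by rewrite c2E trmx_mul Dl_tr Rc3_tr.
have gE : RL (bv vG) = Dl *m Rb3 *m Dl by rewrite -bvD_bc RL_Dl bcE.
case: (vertexP x) => [m mn||||||| m mn||||]; rewrite ?rmulE //.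
- by rewrite RL_al // rmul_al.
- by rewrite -b3_U2 RL_cheb b3E.
- by rewrite -c3_U2 RL_cheb c3E.
- by rewrite RL_pl // rmul_pl.
- have -> : bv vF = bv (pl 0) *m U n.+1 - bv vG by rewrite one'_Un1 addrK.
  by rewrite RLD RLN RL_cheb (RL_unit false) gE.
Qed.

Lemma RA_rmul Q R (y : basis Q R) : RA y = rmul (emb y).
Proof. by rewrite -RL_bv RL_rmul. Qed.

Lemma coef_unique P Q R (x : basis P Q) (y : basis Q R) (z : basis P R) :
  coef A x y z = rcoef x y z.
Proof.
have : (coef A x y z)%:R = (rcoef x y z)%:R :> rat.
  rewrite rcoefE -RA_rmul mul_RA crd_sum (bigD1 z) //= crdZ crd_bv eqxx mulr1.
  rewrite big1 ?addr0 // => w wz.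
  by rewrite crdZ crd_bv (inj_eq (@emb_inj k P R)) eq_sym (negPf wz) mulr0.
by move/eqP; rewrite eqr_nat => /eqP.
Qed.

Lemma dual_unique P Q (x : basis P Q) : dual A x = rdual x.
Proof.
apply: emb_inj; rewrite emb_rdual; apply: bv_inj.
by rewrite bv_dual RA_rmul rmul_tr -(rgt_emb x) -lft_bar one_rmul.
Qed.

Lemma one_unique P : Defs.one A P = runit k P.
Proof. by apply: emb_inj; rewrite emb_one emb_runit. Qed.

End Uniqueness.

Lemma fusion_data_ext (X : side -> side -> finType) (A B : fusion_data X) :
  (forall P Q (x : X P Q), dual A x = dual B x) ->
  (forall P Q R (x : X P Q) (y : X Q R) z, coef A x y z = coef B x y z) ->
  (forall P, Defs.one A P = Defs.one B P) -> A = B.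
Proof.
case: A => dA cA oA; case: B => dB cB oB /= dE cE oE.
have -> : dA = dB by do 3!(apply: functional_extensionality_dep => ?).
have -> : cA = cB by do 6!(apply: functional_extensionality_dep => ?).
by have -> : oA = oB by apply: functional_extensionality_dep => ?.
Qed.

Theorem theorem1p1 (k : nat) :
  exists! A : fusion_data (basis k), fusion_algebra A /\ compatible A.
Proof.
exists (graph_fusion k); split.
  by split; [exact: graph_fusion_algebra | exact: graph_fusion_compatible].
move=> A [FA CA]; apply: fusion_data_ext => *.
- by rewrite (dual_unique FA CA).
- by rewrite (coef_unique FA CA).
- by rewrite (one_unique CA).
Qed.
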